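(* Let $0<q<1$, $p=-q$, let $\epsilon_i\in\{1,-1\}$, $\mu_i>0$ for $i=1,2,3$, let $W=W^{(\epsilon_1,\mu_1)}\otimes W^{(\epsilon_2,\mu_2)}\otimes W^{(\epsilon_3,\mu_3)}$, let $N\geq0$ be an integer, put $\mu_N=N+\mu_1+\mu_2+\mu_3+1$, and set $$\alpha=-(-1)^Nq^{\mu_1+\mu_2+\mu_3-\mu_N},\quad \beta=-(-1)^Nq^{\mu_1+\mu_2-\mu_3+\mu_N},\quad \gamma=-q^{2\mu_2},\quad \delta=-q^{2\mu_3}$$ (so that $\alpha p=p^{-N}$). Then, with a suitable choice of phases of the orthonormal basis vectors $|m;\tau_{12}(n);\tau_N\rangle$ and $|m;\tau_{23}(s);\tau_N\rangle$, the Racah coefficients of $\mathfrak{osp}_q(1|2)$ are given, for all $n,s\in\{0,1,\ldots,N\}$ and independently of $m$, by $$\langle m;\tau_{12}(n);\tau_N\,|\,m;\tau_{23}(s);\tau_N\rangle=(-1)^n\sqrt{\frac{\Omega_s(\alpha,\beta,\gamma,\delta;p)}{h_n(\alpha,\beta,\gamma,\delta;p)}}\;R_n(\mu(s);\alpha,\beta,\gamma,\delta\,|\,p),$$ where $R_n(\mu(s);\alpha,\beta,\gamma,\delta\,|\,p)$ is the $p$-Racah polynomial $$R_n(\mu(s);\alpha,\beta,\gamma,\delta\,|\,p)={}_4\varphi_3\left({p^{-n},\ \alpha\beta p^{n+1},\ p^{-s},\ \gamma\delta p^{s+1}\atop \alpha p,\ \beta\delta p,\ \gamma p};p,p\right),$$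 and $$\Omega_s(\alpha,\beta,\gamma,\delta;p)=\frac{(\alpha p,\beta\delta p,\gamma p,\gamma\delta p;p)_s}{(p,\alpha^{-1}\gamma\delta p,\beta^{-1}\gamma p,\delta p;p)_s}\,\frac{1-\gamma\delta p^{2s+1}}{(\alpha\beta p)^s(1-\gamma\delta p)},$$ $$h_n(\alpha,\beta,\gamma,\delta;p)=\frac{(\beta^{-1},\gamma\delta p^2;p)_N}{(\beta^{-1}\gamma p,\delta p;p)_N}\,\frac{(1-\beta p^{-N})(\gamma\delta p)^n}{1-\beta p^{2n-N}}\,\frac{(p,\beta p,\beta\gamma^{-1}p^{-N},\delta^{-1}p^{-N};p)_n}{(\beta p^{-N},\beta\delta p,\gamma p,p^{-N};p)_n}.$$ In particular the coefficients do not depend on $\epsilon_1,\epsilon_2,\epsilon_3$.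
   Context: Notation: $[x]_q=\frac{q^x-q^{-x}}{q-q^{-1}}$; $[x,y]=xy-yx$, $\{x,y\}=xy+yx$; $(a;q)_s=\prod_{k=1}^s(1-q^{k-1}a)$, $(a_1,\ldots,a_k;q)_s=\prod_{i=1}^k(a_i;q)_s$; $\mu(s)=p^{-s}+\gamma\delta p^{s+1}$; and $${}_4\varphi_3\left({a_1,a_2,a_3,a_4\atop b_1,b_2,b_3};p,p\right)=\sum_{k\geq0}\frac{(a_1,a_2,a_3,a_4;p)_k}{(b_1,b_2,b_3;p)_k}\frac{p^k}{(p;p)_k},$$ where here the sum terminates at $k=\min(n,s)$. The algebra $\mathfrak{osp}_q(1|2)$ (extended by its grade involution) has generators $A_0,A_+,A_-,P$, with $P^2=1$ and, writing $K=q^{A_0/2}$, $$[A_0,P]=0,\quad \{A_\pm,P\}=0,\quad [A_0,A_\pm]=\pm A_\pm,\quad \{A_+,A_-\}=\frac{K^2-K^{-2}}{q^{1/2}-q^{-1/2}}.$$ Its Casimir operator is $Q=\left[A_+A_--\frac{q^{-1/2}K^2-q^{1/2}K^{-2}}{q-q^{-1}}\right]P$. The coassociative coproduct is the algebra homomorphism with $\Delta(A_\pm)=A_\pm\otimes KP+K^{-1}\otimes A_\pm$, $\Delta(K^{\pm1})=K^{\pm1}\otimes K^{\pm1}$, $\Delta(P)=P\otimes P$ and $\Delta(A_0)=A_0\otimes1+1\otimes A_0$, with the ungraded product $(a\otimes b)(c\otimes d)=ac\otimes bd$. For $\epsilon=\pm1$, $\mu>0$, $W^{(\epsilon,\mu)}$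 has orthonormal basis $|\epsilon,\mu;n\rangle$, $n\geq0$, with $$A_0|\epsilon,\mu;n\rangle=(n+\mu+\tfrac12)|\epsilon,\mu;n\rangle,\quad P|\epsilon,\mu;n\rangle=\epsilon(-1)^n|\epsilon,\mu;n\rangle,$$ $$A_+|\epsilon,\mu;n\rangle=\sqrt{\sigma_{n+1}}|\epsilon,\mu;n+1\rangle,\quad A_-|\epsilon,\mu;n\rangle=\sqrt{\sigma_n}|\epsilon,\mu;n-1\rangle,\quad \sigma_n=[n+\mu]_q-(-1)^n[\mu]_q.$$ On $W$ define $Q^{(12)}=\Delta(Q)\otimes1$, $Q^{(23)}=1\otimes\Delta(Q)$, $\mathcal{Q}=(1\otimes\Delta)\Delta(Q)$, and $E=(1\otimes\Delta)\Delta(A_0)$. Each of $\{Q^{(12)},\mathcal{Q},E\}$ and $\{Q^{(23)},\mathcal{Q},E\}$ is a complete set of commuting self-adjoint operators on $W$. The eigenvalues of $\mathcal{Q}$ are $\tau_N=-\epsilon_N[\mu_N]_q$ with $\epsilon_N=(-1)^N\epsilon_1\epsilon_2\epsilon_3$, $N=0,1,2,\ldots$; on the $\tau_N$-eigenspace the eigenvalues of $Q^{(12)}$ are $\tau_{12}(n)=-(-1)^n\epsilon_1\epsilon_2[n+\mu_1+\mu_2+\tfrac12]_q$, $n=0,\ldots,N$, and those of $Q^{(23)}$ are $\tau_{23}(s)=-(-1)^s\epsilon_2\epsilon_3[s+\mu_2+\mu_3+\tfrac12]_q$, $s=0,\ldots,N$. The vectors $|m;\tau_{12}(n);\tau_N\rangle$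 (resp. $|m;\tau_{23}(s);\tau_N\rangle$) are the orthonormal joint eigenvectors, unique up to phase, of $Q^{(12)},\mathcal{Q},E$ (resp. $Q^{(23)},\mathcal{Q},E$) with eigenvalues $\tau_{12}(n),\tau_N,m$ (resp. $\tau_{23}(s),\tau_N,m$), where $m$ runs over the eigenvalues of $E$ on the $\tau_N$-eigenspace, i.e. $m\in\{\mu_N+\tfrac12+k:k=0,1,2,\ldots\}$. Their overlaps $\langle m;\tau_{12}(n);\tau_N|m;\tau_{23}(s);\tau_N\rangle$ are the Racah coefficients. *)

(* Defs.v *)
From HB Require Import structures.
From mathcomp Require Import all_boot all_order all_algebra.
From mathcomp Require Import finmap.
From mathcomp Require Import complex.
From mathcomp Require Import reals exp.
From mathcomp.multinomials Require Import monalg.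

Set Implicit Arguments.
Unset Strict Implicit.
Unset Printing Implicit Defensive.

Import Order.TTheory GRing.Theory Num.Theory.

Local Open Scope ring_scope.
Local Open Scope complex_scope.

(* {malg R[i][I]} is used only as the free R[i]-module on I, i.e. the complex
   pre-Hilbert space with orthonormal basis (<< i >>), i : I; its product is
   never used. *)

Definition lext (C : nzRingType) (I J : choiceType)
    (f : I -> {malg C[J]}) (v : {malg C[I]}) : {malg C[J]} :=
  \sum_(i <- msupp v) v@_i *: f i.

Definition inner (C : numClosedFieldType) (I : choiceType)
    (u v : {malg C[I]}) : C :=
  \sum_(i <- msupp u) (u@_i)^* * v@_i.

(* The tensor product of the spaces on I and J is the space on I * J. *)
Definition tens (C : nzRingType) (I J : choiceType)
    (u : {malg C[I]}) (v : {malg C[J]}) : {malg C[(I * J)%type]} :=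
  \sum_(i <- msupp u) \sum_(j <- msupp v) << u@_i * v@_j *g (i, j) >>.

Definition tensop (C : nzRingType) (I J : choiceType)
    (S : {malg C[I]} -> {malg C[I]}) (T : {malg C[J]} -> {malg C[J]}) :
    {malg C[(I * J)%type]} -> {malg C[(I * J)%type]} :=
  lext (fun ij => tens (S << ij.1 >>) (T << ij.2 >>)).

Definition assoc (C : nzRingType) (I J L : choiceType) :
    {malg C[(I * J * L)%type]} -> {malg C[(I * (J * L))%type]} :=
  lext (fun x => << (x.1.1, (x.1.2, x.2)) >>).

Definition unassoc (C : nzRingType) (I J L : choiceType) :
    {malg C[(I * (J * L))%type]} -> {malg C[(I * J * L)%type]} :=
  lext (fun x => << ((x.1, x.2.1), x.2.2) >>).

(* The operators by which the generators (together with K = q^(A0/2) and its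
   inverse) of osp_q(1|2) act in a representation with basis indexed by I. *)
Record osp_ops (C : nzRingType) (I : choiceType) := OspOps {
  opA0 : {malg C[I]} -> {malg C[I]};
  opAp : {malg C[I]} -> {malg C[I]};
  opAm : {malg C[I]} -> {malg C[I]};
  opP  : {malg C[I]} -> {malg C[I]};
  opK  : {malg C[I]} -> {malg C[I]};
  opKV : {malg C[I]} -> {malg C[I]}
}.

(* The tensor product representation (X (x) Y) o Delta. Since Delta is an
   algebra morphism, an element of the algebra given by an expression in the
   generators acts by the same expression in these operators. *)
Definition coprod (C : nzRingType) (I J : choiceType)
    (X : osp_ops C I) (Y : osp_ops C J) : osp_ops C (I * J)%type := {|
  opA0 := fun v => tensop (opA0 X) id v + tensop id (opA0 Y) v;
  opAp := fun v => tensop (opAp X) (opK Y \o opP Y) v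
                   + tensop (opKV X) (opAp Y) v;
  opAm := fun v => tensop (opAm X) (opK Y \o opP Y) v
                   + tensop (opKV X) (opAm Y) v;
  opP  := tensop (opP X) (opP Y);
  opK  := tensop (opK X) (opK Y);
  opKV := tensop (opKV X) (opKV Y)
|}.

(* Q = [A+ A- - (q^(-1/2) K^2 - q^(1/2) K^(-2)) / (q - q^(-1))] P *)
Definition casimir (R : realType) (q : R) (I : choiceType)
    (X : osp_ops R[i] I) (v : {malg R[i][I]}) : {malg R[i][I]} :=
  let w := opP X v in
  opAp X (opAm X w)
  - ((q - q^-1)^-1)%:C *:
      ((q `^ (- 2^-1))%:C *: opK X (opK X w)
       - (q `^ (2^-1))%:C *: opKV X (opKV X w)).

Definition qnum (R : realType) (q x : R) : R :=
  (q `^ x - q `^ (- x)) / (q - q^-1).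

Definition sigma (R : realType) (q mu : R) (n : nat) : R :=
  qnum q (n%:R + mu) - (-1) ^+ n * qnum q mu.

(* W^(eps, mu); at n = 0 the value of opAm is 0 because sigma_0 = 0. *)
Definition irrep (R : realType) (q eps mu : R) : osp_ops R[i] nat := {|
  opA0 := lext (fun n => << (n%:R + mu + 2^-1)%:C *g n >>);
  opAp := lext (fun n => << (Num.sqrt (sigma q mu n.+1))%:C *g n.+1 >>);
  opAm := lext (fun n => << (Num.sqrt (sigma q mu n))%:C *g n.-1 >>);
  opP  := lext (fun n => << (eps * (-1) ^+ n)%:C *g n >>);
  opK  := lext (fun n => << (q `^ ((n%:R + mu + 2^-1) / 2))%:C *g n >>);
  opKV := lext (fun n => << (q `^ (- ((n%:R + mu + 2^-1) / 2)))%:C *g n >>)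
|}.

(* Delta(Q) (x) 1 *)
Definition casimir12 (R : realType) (q : R) (I J L : choiceType)
    (X : osp_ops R[i] I) (Y : osp_ops R[i] J)
    (v : {malg R[i][(I * (J * L))%type]}) : {malg R[i][(I * (J * L))%type]} :=
  assoc (tensop (casimir q (coprod X Y)) id (unassoc v)).

(* 1 (x) Delta(Q) *)
Definition casimir23 (R : realType) (q : R) (I J L : choiceType)
    (Y : osp_ops R[i] J) (Z : osp_ops R[i] L) :
    {malg R[i][(I * (J * L))%type]} -> {malg R[i][(I * (J * L))%type]} :=
  tensop id (casimir q (coprod Y Z)).

(* u n k is the vector |m; lam n; tau> for the k-th value m = mm k. *)
Definition orthonormal_joint_eigenvectors (R : realType) (I : choiceType)
    (N : nat) (T Q E : {malg R[i][I]} -> {malg R[i][I]})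
    (lam : nat -> R) (tau : R) (mm : nat -> R)
    (u : 'I_N.+1 -> nat -> {malg R[i][I]}) : Prop :=
  (forall n k, [/\ T (u n k) = (lam n)%:C *: u n k,
                   Q (u n k) = tau%:C *: u n k
                 & E (u n k) = (mm k)%:C *: u n k])
  /\ (forall n k n' k',
        inner (u n k) (u n' k') = ((n == n') && (k == k'))%:R).

Definition qpoch (R : nzRingType) (a q : R) (s : nat) : R :=
  \prod_(k < s) (1 - q ^+ k * a).

Definition qpochs (R : nzRingType) (l : seq R) (q : R) (s : nat) : R :=
  \prod_(a <- l) qpoch a q s.

(* The basic hypergeometric series 4phi3, base p and argument z, summed up to
   and including k = M. *)
Definition phi43 (R : fieldType) (M : nat)
    (a1 a2 a3 a4 b1 b2 b3 p z : R) : R :=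
  \sum_(k < M.+1)
    qpochs [:: a1; a2; a3; a4] p k / qpochs [:: b1; b2; b3] p k
    * (z ^+ k / qpoch p p k).

(* R_n(mu(s); alpha, beta, gamma, delta | p), mu(s) = p^-s + gamma delta p^(s+1),
   as a function of s. *)
Definition pRacah (R : fieldType) (n s : nat)
    (alpha beta gamma delta p : R) : R :=
  phi43 (minn n s)
    (p ^- n) (alpha * beta * p ^+ n.+1) (p ^- s) (gamma * delta * p ^+ s.+1)
    (alpha * p) (beta * delta * p) (gamma * p) p p.

Definition Omega (R : fieldType) (s : nat) (alpha beta gamma delta p : R) : R :=
  qpochs [:: alpha * p; beta * delta * p; gamma * p; gamma * delta * p] p s
  / qpochs [:: p; alpha^-1 * gamma * delta * p; beta^-1 * gamma * p; delta * p]
      p s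
  * ((1 - gamma * delta * p ^+ (2 * s).+1)
     / ((alpha * beta * p) ^+ s * (1 - gamma * delta * p))).

Definition hnorm (R : fieldType) (N n : nat)
    (alpha beta gamma delta p : R) : R :=
  qpochs [:: beta^-1; gamma * delta * p ^+ 2] p N
  / qpochs [:: beta^-1 * gamma * p; delta * p] p N
  * ((1 - beta * p ^- N) * (gamma * delta * p) ^+ n
     / (1 - beta * p ^ ((2 * n)%:Z - N%:Z)))
  * (qpochs [:: p; beta * p; beta * gamma^-1 * p ^- N; delta^-1 * p ^- N] p n
     / qpochs [:: beta * p ^- N; beta * delta * p; gamma * p; p ^- N] p n).

(* Main.v *)
Require Import Defs.
From HB Require Import structures.
From mathcomp Require Import all_boot all_order all_algebra.
From mathcomp Require Import finmap.
From mathcomp Require Import complex.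
From mathcomp Require Import boolp reals exp.
From mathcomp.multinomials Require Import monalg.
From mathcomp Require Import ring lra zify.

Import Order.TTheory GRing.Theory Num.Theory.

Local Open Scope ring_scope.

Set Implicit Arguments.
Unset Strict Implicit.
Unset Printing Implicit Defensive.

(* The lowering operator A_- commutes with both intermediate Casimirs, and its
   powers map each joint eigenspace of the total Casimir (eigenvalue tau_N) and
   E, isometrically up to a factor, onto the (N+1)-dimensional space of
   lowest-weight vectors of A_0-weight mu_N + 1/2; hence the overlaps do not
   depend on m and may be computed there. A lowest-weight vector is determined
   by its coordinates at |a,0,N-a>, a = 0..N, in which Q^(12) is lower and
   Q^(23) upper bidiagonal. In a suitable triangular basis F_0, ..., F_N of this
   space both take split form,
     Q^(12) F_k = X0 (x_k F_k + F_(k+1)),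
     Q^(23) F_k = Y0 (y_k F_k + phi_k F_(k-1)),
   with eigenvalues X0 x_k and Y0 y_k. Solving the resulting recursions gives
   <u_n|v_s> = A_n B_s R_n(mu(s)). The overlap matrix is unitary, and the total
   mass of the weight and the orthogonality of R_n to R_0 = 1, for the
   polynomials and their duals, determine |A_n|^2 |B_s|^2 = Omega_s / h_n. *)

(** * Free modules, tensor products and adjoints *)

(** The base is [p = -q] because the sign (-1)^n in the eigenvalues and in [sigma] merges with q^n:
    in p the eigenvalues lie on grids p^-n + a p^n, and [sigma] factors by one formula for both
    parities of n. The line |a,0,N-a> works because A_- has a single term on |a,0> and on |0,c>, and
    because A_- w = 0, whose coefficient at the middle index never vanishes, eliminates the one
    neighbour that lies off the line. Entries along the line contain square roots of [sigma]. A
    diagonal rescaling removes them, since only the product of two opposite off-diagonal entries is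
    intrinsic. In the split basis F_0 is the eigenvector of Q^(23) for s = 0, and F_k is obtained
    from it by applying Q^(12)/X0 - x_j for all j < k. Computing the norms of the eigenvectors
    directly would mean summing squares of Pochhammer products and controlling their signs;
    unitarity of the overlap matrix avoids both. The orthogonality to constants that it requires
    comes from a q-difference equation. The algebra is done over an abstract closed field [C] with
    an embedding [io] of the reals; R[i] is substituted only at the end. *)

Section LinearMaps.
Variables (C : nzRingType) (U V : lmodType C) (f : U -> V).
Hypothesis fL : linear f.

Lemma linD u v : f (u + v) = f u + f v.
Proof. by rewrite -[u in LHS]scale1r fL scale1r. Qed.
Lemma lin0 : f 0 = 0.
Proof. by apply: (@addrI _ (f 0)); rewrite -linD !addr0. Qed.
Lemma linZ c u : f (c *: u) = c *: f u.
Proof. by rewrite -[c *: u]addr0 fL lin0 addr0. Qed.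
Lemma linN u : f (- u) = - f u.
Proof. by rewrite -scaleN1r linZ scaleN1r. Qed.
Lemma linB u v : f (u - v) = f u - f v.
Proof. by rewrite linD linN. Qed.
Lemma lin_sum (I : Type) (r : seq I) (P : pred I) (F : I -> U) :
  f (\sum_(i <- r | P i) F i) = \sum_(i <- r | P i) f (F i).
Proof. exact: (big_morph f linD lin0). Qed.
End LinearMaps.

Section Malg.
Variables (C : numClosedFieldType).
Implicit Types I J L : choiceType.

Lemma malgUZ I (c : C) (i : I) : << c *g i >> = c *: << i >>.
Proof. by apply/malgP => k; rewrite mcoeffZ !mcoeffU mulrnAr mulr1. Qed.

(** Stated as three rewrite rules that turn a vector identity into a scalar one, which [ring] can
    settle; [malg_sep] makes the reduction. *)
Definition functional (V : lmodType C) (phi : V -> C) :=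
  [/\ forall u v, phi (u + v) = phi u + phi v,
      forall u, phi (- u) = - phi u
    & forall c u, phi (c *: u) = c * phi u].

Lemma funD (V : lmodType C) (phi : V -> C) : functional phi ->
  forall u v, phi (u + v) = phi u + phi v.
Proof. by case. Qed.
Lemma funN (V : lmodType C) (phi : V -> C) : functional phi ->
  forall u, phi (- u) = - phi u.
Proof. by case. Qed.
Lemma funZ (V : lmodType C) (phi : V -> C) : functional phi ->
  forall c u, phi (c *: u) = c * phi u.
Proof. by case. Qed.

Lemma coef_functional I (i : I) :
  functional (fun u : {malg C[I]} => u@_i).
Proof. by split=> *; [apply: mcoeffD|apply: mcoeffN|apply: mcoeffZ]. Qed.

Lemma malg_sep I (u v : {malg C[I]}) :
  (forall phi : {malg C[I]} -> C, functional phi -> phi u = phi v) -> u = v.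
Proof. by move=> uv; apply/malgP => i; apply: (uv _ (coef_functional i)). Qed.

Lemma malg_basis I (u : {malg C[I]}) :
  u = \sum_(i <- msupp u) u@_i *: << i >>.
Proof. by rewrite {1}[u]monalgE; apply: eq_bigr => i _; rewrite malgUZ. Qed.

Lemma lextw I J (f : I -> {malg C[J]}) v (d : {fset I}) :
  (msupp v `<=` d)%fset -> lext f v = \sum_(i <- d) v@_i *: f i.
Proof.
move=> vd; rewrite /lext; apply: big_fset_incl => // i _ /mcoeff_outdom ->.
by rewrite scale0r.
Qed.

Lemma lext_linear I J (f : I -> {malg C[J]}) : linear (lext f).
Proof.
move=> c u v; pose d := (msupp (c *: u + v) `|` (msupp u `|` msupp v))%fset.
rewrite (@lextw _ _ f _ d) ?fsubsetUl //.
rewrite (@lextw _ _ f u d); last by rewrite /d fsetUC -fsetUA fsubsetUl.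
rewrite (@lextw _ _ f v d); last by rewrite /d fsetUA fsubsetUr.
rewrite scaler_sumr -big_split /=; apply: eq_bigr => i _.
by rewrite mcoeffD mcoeffZ scalerDl scalerA.
Qed.

Lemma lextU I J (f : I -> {malg C[J]}) i : lext f << i >> = f i.
Proof. by rewrite /lext msuppU oner_eq0 big_seq_fset1 mcoeffUU scale1r. Qed.

Lemma malg_ext I (V : lmodType C) (f g : {malg C[I]} -> V) :
  linear f -> linear g -> (forall i, f << i >> = g << i >>) -> f =1 g.
Proof.
move=> fL gL fg u; rewrite (malg_basis u) (lin_sum fL) (lin_sum gL).
by apply: eq_bigr => i _; rewrite (linZ fL) (linZ gL) fg.
Qed.

Lemma tensE I J (u : {malg C[I]}) (v : {malg C[J]}) k :
  (tens u v)@_k = u@_(k.1) * v@_(k.2).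
Proof.
case: k => i j /=; rewrite {2}[u]monalgE {2}[v]monalgE.
rewrite !raddf_sum /= mulr_suml; apply: eq_bigr => i' _.
rewrite raddf_sum /= mulr_sumr; apply: eq_bigr => j' _.
by rewrite !mcoeffU xpair_eqE mulrnAl mulrnAr -mulrnA mulnb andbC.
Qed.

Lemma tensDl I J (v : {malg C[J]}) : linear (fun u : {malg C[I]} => tens u v).
Proof.
move=> c u u'; apply/malgP => k.
by rewrite mcoeffD mcoeffZ !tensE mcoeffD mcoeffZ mulrDl mulrA.
Qed.

Lemma tensDr I J (u : {malg C[I]}) : linear (fun v : {malg C[J]} => tens u v).
Proof.
move=> c v v'; apply/malgP => k.
rewrite mcoeffD mcoeffZ !tensE mcoeffD mcoeffZ mulrDr.
by rewrite !mulrA [c * _]mulrC.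
Qed.

Lemma tensUU I J (i : I) (j : J) :
  tens << i >> << j >> = << (i, j) >> :> {malg C[(I * J)%type]}.
Proof.
apply/malgP => -[i' j']; rewrite tensE !mcoeffU xpair_eqE /=.
by case: (i == i'); rewrite ?mul1r ?mul0r.
Qed.

Definition tensZl I J c (u : {malg C[I]}) (v : {malg C[J]}) :
  tens (c *: u) v = c *: tens u v := linZ (tensDl v) c u.
Definition tensZr I J c (u : {malg C[I]}) (v : {malg C[J]}) :
  tens u (c *: v) = c *: tens u v := linZ (tensDr u) c v.
Definition tensAl I J (u u' : {malg C[I]}) (v : {malg C[J]}) :
  tens (u + u') v = tens u v + tens u' v := linD (tensDl v) u u'.
Definition tensAr I J (u : {malg C[I]}) (v v' : {malg C[J]}) :
  tens u (v + v') = tens u v + tens u v' := linD (tensDr u) v v'.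
Definition tensNl I J (u : {malg C[I]}) (v : {malg C[J]}) :
  tens (- u) v = - tens u v := linN (tensDl v) u.
Definition tensNr I J (u : {malg C[I]}) (v : {malg C[J]}) :
  tens u (- v) = - tens u v := linN (tensDr u) v.

Lemma tens_ext I J (V : lmodType C) (f g : {malg C[(I * J)%type]} -> V) :
  linear f -> linear g -> (forall u v, f (tens u v) = g (tens u v)) -> f =1 g.
Proof.
move=> fL gL fg; apply: malg_ext => // -[i j]; by rewrite -tensUU fg.
Qed.

Lemma tensop_linear I J S T : linear (@tensop C I J S T).
Proof. exact: lext_linear. Qed.

Lemma tensopE I J S T u v : linear S -> linear T ->
  @tensop C I J S T (tens u v) = tens (S u) (T v).
Proof.
move=> SL TL; rewrite [in LHS](malg_basis u) [in RHS](malg_basis u).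
rewrite (lin_sum (tensDl _)) (lin_sum (tensop_linear _ _)) (lin_sum SL).
rewrite (lin_sum (tensDl _)); apply: eq_bigr => i _.
rewrite tensZl (linZ (tensop_linear _ _)) (linZ SL) tensZl; congr (_ *: _).
rewrite [in LHS](malg_basis v) [in RHS](malg_basis v).
rewrite (lin_sum (tensDr _)) (lin_sum (tensop_linear _ _)) (lin_sum TL).
rewrite (lin_sum (tensDr _)); apply: eq_bigr => j _.
rewrite tensZr (linZ (tensop_linear _ _)) (linZ TL) tensZr; congr (_ *: _).
by rewrite tensUU /tensop lextU.
Qed.

Lemma assocE I J L (u : {malg C[I]}) (v : {malg C[J]}) (w : {malg C[L]}) :
  assoc (tens (tens u v) w) = tens u (tens v w).
Proof.
have aL : linear (@assoc C I J L) by exact: lext_linear.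
move: u; apply: malg_ext => [c u u'|c u u'|i].
- by rewrite !tensDl aL.
- by rewrite tensDl.
move: v; apply: malg_ext => [c u u'|c u u'|j].
- by rewrite tensDr tensDl aL.
- by rewrite tensDl tensDr.
move: w; apply: malg_ext => [c u u'|c u u'|k].
- by rewrite tensDr aL.
- by rewrite !tensDr.
by rewrite !tensUU /assoc lextU.
Qed.

Lemma unassocE I J L (u : {malg C[I]}) (v : {malg C[J]}) (w : {malg C[L]}) :
  unassoc (tens u (tens v w)) = tens (tens u v) w.
Proof.
have aL : linear (@unassoc C I J L) by exact: lext_linear.
move: u; apply: malg_ext => [c u u'|c u u'|i].
- by rewrite !tensDl aL.
- by rewrite !tensDl.
move: v; apply: malg_ext => [c u u'|c u u'|j].
- by rewrite tensDl tensDr aL.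
- by rewrite tensDr tensDl.
move: w; apply: malg_ext => [c u u'|c u u'|k].
- by rewrite !tensDr aL.
- by rewrite !tensDr.
by rewrite !tensUU /unassoc lextU.
Qed.

Lemma assocK I J L : cancel (@assoc C I J L) (@unassoc C I J L).
Proof.
have aL : linear (@assoc C I J L) by exact: lext_linear.
have bL : linear (@unassoc C I J L) by exact: lext_linear.
apply: malg_ext => [c u v|//|i]; first by rewrite aL bL.
by rewrite /assoc lextU /unassoc lextU /=; case: i => -[].
Qed.

Lemma unassocK I J L : cancel (@unassoc C I J L) (@assoc C I J L).
Proof.
have aL : linear (@assoc C I J L) by exact: lext_linear.
have bL : linear (@unassoc C I J L) by exact: lext_linear.
apply: malg_ext => [c u v|//|i]; first by rewrite bL aL.
by rewrite /unassoc lextU /assoc lextU /=; case: i => i [].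
Qed.

(** Vectors have finite support, so this is an identity of finite sums between everywhere defined
    operators, and no domains occur. *)
Definition adjoint I (S T : {malg C[I]} -> {malg C[I]}) :=
  forall u v, inner (S u) v = inner u (T v).

Lemma assocD I J L (u v : {malg C[(I * J * L)%type]}) :
  assoc (u + v) = assoc u + assoc v.
Proof.
have aL : linear (@assoc C I J L) by exact: lext_linear.
exact: (linD aL).
Qed.

Lemma assocZ I J L x (u : {malg C[(I * J * L)%type]}) :
  assoc (x *: u) = x *: assoc u.
Proof.
have aL : linear (@assoc C I J L) by exact: lext_linear.
exact: (linZ aL).
Qed.

Lemma adjoint_id I : adjoint (@id {malg C[I]}) id.
Proof. by []. Qed.

Lemma innerw I (u v : {malg C[I]}) (d : {fset I}) :
  (msupp u `<=` d)%fset -> inner u v = \sum_(i <- d) (u@_i)^* * v@_i.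
Proof.
move=> ud; rewrite /inner; apply: big_fset_incl => // i _ /mcoeff_outdom ->.
by rewrite conjC0 mul0r.
Qed.

Lemma inner_linear I (u : {malg C[I]}) :
  linear (inner u : {malg C[I]} -> C^o).
Proof.
move=> c v w; rewrite /inner scaler_sumr -big_split /=.
by apply: eq_bigr => i _; rewrite mcoeffD mcoeffZ mulrDr mulrCA.
Qed.

Lemma innerC I (u v : {malg C[I]}) : inner u v = (inner v u)^*.
Proof.
rewrite (innerw _ (fsubsetUl (msupp u) (msupp v))).
rewrite (innerw _ (fsubsetUr (msupp u) (msupp v))).
rewrite rmorph_sum /=; apply: eq_bigr => i _.
by rewrite rmorphM /= conjCK mulrC.
Qed.

Lemma innerDr I (u v w : {malg C[I]}) : inner u (v + w) = inner u v + inner u w.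
Proof. exact: (linD (inner_linear u)). Qed.
Lemma innerZr I c (u v : {malg C[I]}) : inner u (c *: v) = c * inner u v.
Proof. exact: (linZ (inner_linear u)). Qed.
Lemma inner_sumr I (u : {malg C[I]}) (J : Type) (r : seq J) (P : pred J) F :
  inner u (\sum_(i <- r | P i) F i) = \sum_(i <- r | P i) inner u (F i).
Proof. exact: (lin_sum (inner_linear u)). Qed.
Lemma innerDl I (u v w : {malg C[I]}) : inner (u + v) w = inner u w + inner v w.
Proof. by rewrite innerC innerDr rmorphD /= -!innerC. Qed.
Lemma innerZl I c (u v : {malg C[I]}) : inner (c *: u) v = c^* * inner u v.
Proof. by rewrite innerC innerZr rmorphM /= -innerC. Qed.
Lemma inner_suml I (u : {malg C[I]}) (J : Type) (r : seq J) (P : pred J) F :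
  inner (\sum_(i <- r | P i) F i) u = \sum_(i <- r | P i) inner (F i) u.
Proof.
rewrite innerC inner_sumr rmorph_sum /=.
by apply: eq_bigr => i _; rewrite -innerC.
Qed.

Lemma innerU I i (v : {malg C[I]}) : inner << i >> v = v@_i.
Proof. by rewrite /inner msuppU oner_eq0 big_seq_fset1 mcoeffUU conjC1 mul1r. Qed.

Lemma inner_ge0 I (v : {malg C[I]}) : 0 <= inner v v.
Proof. by apply: sumr_ge0 => i _; rewrite mulrC mul_conjC_ge0. Qed.

Lemma inner_eq0 I (v : {malg C[I]}) : inner v v = 0 -> v = 0.
Proof.
move=> v0; apply/malgP => i; rewrite mcoeff0; case: msuppP => // iv.
apply/eqP; move/eqP: v0; rewrite psumr_eq0 => [/allP /(_ i iv) /=|k _].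
  by rewrite mulrC mul_conjC_eq0.
by rewrite mulrC mul_conjC_ge0.
Qed.

Lemma inner_tens I J (u u' : {malg C[I]}) (v v' : {malg C[J]}) :
  inner (tens u v) (tens u' v') = inner u u' * inner v v'.
Proof.
rewrite [u]malg_basis (lin_sum (tensDl _)) !inner_suml mulr_suml.
apply: eq_bigr => i _; rewrite tensZl !innerZl -mulrA; congr (_ * _).
rewrite [v]malg_basis (lin_sum (tensDr _)) !inner_suml mulr_sumr.
apply: eq_bigr => j _; rewrite tensZr !innerZl [RHS]mulrCA; congr (_ * _).
by rewrite tensUU !innerU tensE.
Qed.

Lemma adjoint_tens I J (f g : {malg C[(I * J)%type]} -> {malg C[(I * J)%type]}) :
  linear f -> linear g ->
  (forall u v u' v', inner (f (tens u v)) (tens u' v') =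
     inner (tens u v) (g (tens u' v'))) -> adjoint f g.
Proof.
move=> fL gL fg w z.
rewrite [w]malg_basis (lin_sum fL) !inner_suml; apply: eq_bigr => i _.
rewrite (linZ fL) !innerZl; congr (_ * _).
rewrite [z]malg_basis (lin_sum gL) !inner_sumr; apply: eq_bigr => j _.
rewrite (linZ gL) !innerZr; congr (_ * _).
by case: i j => [i1 i2] [j1 j2]; rewrite -!tensUU fg.
Qed.

Lemma adjoint_tensop I J (S S' : {malg C[I]} -> {malg C[I]})
    (T T' : {malg C[J]} -> {malg C[J]}) :
  linear S -> linear S' -> linear T -> linear T' ->
  adjoint S S' -> adjoint T T' -> adjoint (tensop S T) (tensop S' T').
Proof.
move=> SL SL' TL TL' SS TT.
apply: adjoint_tens; [exact: tensop_linear | exact: tensop_linear |].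
move=> u v u' v'; rewrite (tensopE _ _ SL TL) (tensopE _ _ SL' TL').
by rewrite inner_tens inner_tens SS TT.
Qed.

Lemma inner_assoc I J L (u v : {malg C[(I * J * L)%type]}) :
  inner (assoc u) (assoc v) = inner u v.
Proof.
have aL : linear (@assoc C I J L) by exact: lext_linear.
rewrite [u]malg_basis (lin_sum aL) !inner_suml; apply: eq_bigr => i _.
rewrite (linZ aL) !innerZl; congr (_ * _).
rewrite [v]malg_basis (lin_sum aL) !inner_sumr; apply: eq_bigr => j _.
rewrite (linZ aL) !innerZr; congr (_ * _).
rewrite /assoc !lextU !innerU !mcoeffU.
by case: i j => [[i1 i2] i3] [[j1 j2] j3]; rewrite !xpair_eqE andbA.
Qed.

Lemma inner_assocl I J L (u : {malg C[(I * J * L)%type]}) v :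
  inner (assoc u) v = inner u (unassoc v).
Proof. by rewrite -{1}[v]unassocK inner_assoc. Qed.

(** [assoc] carries one orthonormal basis bijectively onto another, so conjugating by it preserves
    self-adjointness. *)
Lemma adjoint_assoc I J L (S : {malg C[(I * J * L)%type]} -> _) :
  adjoint S S -> adjoint (fun v => assoc (S (unassoc v))) (fun v => assoc (S (unassoc v))).
Proof.
move=> SA u v; rewrite inner_assocl SA innerC -inner_assocl -innerC //.
Qed.

End Malg.

(** * Representations and their coproducts *)

(* io stands for the embedding of R into R[i]. *)
Section Rep.
Variables (R : realType) (C : numClosedFieldType) (io : {rmorphism R -> C}).
Hypothesis io_conj : forall x, (io x)^* = io x.
Variable q : R.
Hypothesis hq : 0 < q < 1.
Local Notation "x %:C" := (io x) (format "x %:C").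
Local Notation h := (q `^ 2^-1).
Local Notation hv := (q `^ (- 2^-1)).

Lemma q_gt0 : 0 < q. Proof. by case/andP: hq. Qed.
Lemma q_neq0 : q != 0. Proof. by rewrite gt_eqF ?q_gt0. Qed.
Lemma qpow_gt0 x : 0 < q `^ x. Proof. exact/powR_gt0/q_gt0. Qed.
Lemma qpow_neq0 x : q `^ x != 0. Proof. by rewrite gt_eqF ?qpow_gt0. Qed.
Lemma qpowD x y : q `^ (x + y) = q `^ x * q `^ y.
Proof. by rewrite powRD // q_neq0 implybT. Qed.
Lemma qpow_nat n : q `^ n%:R = q ^+ n.
Proof. by rewrite powR_mulrn // ltW ?q_gt0. Qed.

Lemma hhv : h * hv = 1. Proof. by rewrite powRN mulfV ?qpow_neq0. Qed.
Lemma hh : h * h = q.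
Proof.
rewrite -qpowD (_ : 2^-1 + 2^-1 = 1); last by field.
by rewrite powRr1 // ltW ?q_gt0.
Qed.

Lemma qV_neq : q - q^-1 != 0.
Proof.
rewrite subr_eq0; apply/eqP => e.
have /andP [q0 q1] := hq.
have : q * q = 1 by rewrite {2}e mulfV ?q_neq0.
by apply/eqP; rewrite lt_eqF // (lt_trans _ q1) // gtr_pMr.
Qed.

(** The relations are expressed through K = q^(A0/2): the weights of A_+ and A_- become the factors
    q^(1/2) and q^(-1/2) in [KAp] and [KAm]. A0 enters only later, through its eigenspaces. The last
    three fields are the star structure. *)
Record osp_rep (I : choiceType) (X : osp_ops C I) : Prop := OspRep {
  ApL : linear (opAp X);
  AmL : linear (opAm X);
  PL : linear (opP X);
  KL : linear (opK X);
  KVL : linear (opKV X);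
  KKV : forall v, opK X (opKV X v) = v;
  KVK : forall v, opKV X (opK X v) = v;
  PP : forall v, opP X (opP X v) = v;
  PK : forall v, opP X (opK X v) = opK X (opP X v);
  PAp : forall v, opP X (opAp X v) = - opAp X (opP X v);
  PAm : forall v, opP X (opAm X v) = - opAm X (opP X v);
  KAp : forall v, opK X (opAp X v) = h%:C *: opAp X (opK X v);
  KAm : forall v, opK X (opAm X v) = hv%:C *: opAm X (opK X v);
  antiA : forall v, opAp X (opAm X v) + opAm X (opAp X v) =
     ((h - hv)^-1)%:C *: (opK X (opK X v) - opKV X (opKV X v));
  adjA : adjoint (opAp X) (opAm X);
  adjP : adjoint (opP X) (opP X);
  adjK : adjoint (opK X) (opK X)
}.

Section RepTheory.
Variables (I : choiceType) (X : osp_ops C I).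
Hypothesis HX : osp_rep X.

Lemma adjKV : adjoint (opKV X) (opKV X).
Proof. by move=> u v; rewrite -{1}(KKV HX v) -(adjK HX) (KKV HX). Qed.
Lemma PKV v : opP X (opKV X v) = opKV X (opP X v).
Proof. by rewrite -{2}(KKV HX v) (PK HX) (KVK HX). Qed.
Lemma KVAp v : opKV X (opAp X v) = hv%:C *: opAp X (opKV X v).
Proof.
rewrite -[RHS](KVK HX) (linZ (KL HX)) (KAp HX) (KKV HX) scalerA -rmorphM.
by rewrite mulrC hhv rmorph1 scale1r.
Qed.
Lemma KVAm v : opKV X (opAm X v) = h%:C *: opAm X (opKV X v).
Proof.
rewrite -[RHS](KVK HX) (linZ (KL HX)) (KAm HX) (KKV HX) scalerA -rmorphM.
by rewrite hhv rmorph1 scale1r.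
Qed.
End RepTheory.

Section Coprod.
Variables (I J : choiceType) (X : osp_ops C I) (Y : osp_ops C J).
Hypothesis (HX : osp_rep X) (HY : osp_rep Y).

Lemma linear_comp (U V W : lmodType C) (f : V -> W) (g : U -> V) :
  linear f -> linear g -> linear (f \o g).
Proof. by move=> fL gL c u v /=; rewrite gL fL. Qed.
Lemma linear_add (U V : lmodType C) (f g : U -> V) :
  linear f -> linear g -> linear (fun u => f u + g u).
Proof. by move=> fL gL c u v /=; rewrite gL fL scalerDr addrACA. Qed.
Lemma linear_opp (U V : lmodType C) (f : U -> V) :
  linear f -> linear (fun u => - f u).
Proof. by move=> fL c u v /=; rewrite fL opprD scalerN. Qed.
Lemma linear_scale (U V : lmodType C) (c : C) (f : U -> V) :
  linear f -> linear (fun u => c *: f u).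
Proof. by move=> fL b u v /=; rewrite fL scalerDr !scalerA mulrC. Qed.
Lemma linear_id (U : lmodType C) : linear (@id U).
Proof. by []. Qed.

Lemma coApL : linear (opAp (coprod X Y)).
Proof. by apply: linear_add; exact: tensop_linear. Qed.
Lemma coAmL : linear (opAm (coprod X Y)).
Proof. by apply: linear_add; exact: tensop_linear. Qed.

Lemma coApE u v : opAp (coprod X Y) (tens u v) =
  tens (opAp X u) (opK Y (opP Y v)) + tens (opKV X u) (opAp Y v).
Proof.
rewrite /= !tensopE //; try exact: (linear_comp (KL HY) (PL HY)).
all: by [apply: (ApL HX) | apply: (ApL HY) | apply: (KVL HX)].
Qed.
Lemma coAmE u v : opAm (coprod X Y) (tens u v) =
  tens (opAm X u) (opK Y (opP Y v)) + tens (opKV X u) (opAm Y v).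
Proof.
rewrite /= !tensopE //; try exact: (linear_comp (KL HY) (PL HY)).
all: by [apply: (AmL HX) | apply: (AmL HY) | apply: (KVL HX)].
Qed.
Lemma coPE u v : opP (coprod X Y) (tens u v) = tens (opP X u) (opP Y v).
Proof. by rewrite /= tensopE //; [apply: (PL HX) | apply: (PL HY)]. Qed.
Lemma coKE u v : opK (coprod X Y) (tens u v) = tens (opK X u) (opK Y v).
Proof. by rewrite /= tensopE //; [apply: (KL HX) | apply: (KL HY)]. Qed.
Lemma coKVE u v : opKV (coprod X Y) (tens u v) = tens (opKV X u) (opKV Y v).
Proof. by rewrite /= tensopE //; [apply: (KVL HX) | apply: (KVL HY)]. Qed.

Let tE := (coApE, coAmE, coPE, coKE, coKVE).

(** The coproduct is compatible with the star structure because K and P are self-adjoint and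
    commute, so that KP is self-adjoint as well. *)
Lemma coprod_rep : osp_rep (coprod X Y).
Proof.
have pL : linear (opP (coprod X Y)) by exact: tensop_linear.
have kL : linear (opK (coprod X Y)) by exact: tensop_linear.
have kvL : linear (opKV (coprod X Y)) by exact: tensop_linear.
have apL := coApL; have amL := coAmL.
split; [exact: apL|exact: amL|exact: pL|exact: kL|exact: kvL|..].
- apply: tens_ext => [||u v]; [exact: (linear_comp kL kvL)|exact: linear_id|].
  by rewrite !tE (KKV HX) (KKV HY).
- apply: tens_ext => [||u v]; [exact: (linear_comp kvL kL)|exact: linear_id|].
  by rewrite !tE (KVK HX) (KVK HY).
- apply: tens_ext => [||u v]; [exact: (linear_comp pL pL)|exact: linear_id|].
  by rewrite !tE (PP HX) (PP HY).
- apply: tens_ext => [||u v]; [exact: (linear_comp pL kL)|exact: (linear_comp kL pL)|].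
  by rewrite !tE (PK HX) (PK HY).
- apply: tens_ext => [||u v]; first exact: (linear_comp pL apL).
    by apply: linear_opp; exact: (linear_comp apL pL).
  rewrite !tE (linD pL) !tE (PAp HX) (PAp HY) (PKV HX) (PK HY).
  by rewrite tensNl tensNr -opprD.
- apply: tens_ext => [||u v]; first exact: (linear_comp pL amL).
    by apply: linear_opp; exact: (linear_comp amL pL).
  rewrite !tE (linD pL) !tE (PAm HX) (PAm HY) (PKV HX) (PK HY).
  by rewrite tensNl tensNr -opprD.
- apply: tens_ext => [||u v]; first exact: (linear_comp kL apL).
    by apply: linear_scale; exact: (linear_comp apL kL).
  rewrite !tE (linD kL) !tE (KAp HX) (KAp HY) (KVK HX) (KKV HX) (PK HY).
  by rewrite tensZl tensZr -scalerDr.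
- apply: tens_ext => [||u v]; first exact: (linear_comp kL amL).
    by apply: linear_scale; exact: (linear_comp amL kL).
  rewrite !tE (linD kL) !tE (KAm HX) (KAm HY) (KVK HX) (KKV HX) (PK HY).
  by rewrite tensZl tensZr -scalerDr.
- apply: tens_ext => [||u v].
  + by apply: linear_add; [exact: (linear_comp apL amL) | exact: (linear_comp amL apL)].
  + apply: linear_scale; apply: linear_add; first exact: (linear_comp kL kL).
    by apply: linear_opp; exact: (linear_comp kvL kvL).
  rewrite !tE (linD apL) (linD amL) !tE.
  rewrite (PAm HY) (linN (KL HY)) (KAm HY) (PAp HY) (linN (KL HY)) (KAp HY).
  rewrite (KVAm HX) (KVAp HX) (PK HY) (PP HY).
  rewrite !(tensNr, tensNl, tensZl, tensZr).
  set a1 := tens (opAp X (opAm X u)) _; set a2 := tens (opAp X (opKV X u)) _.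
  set a3 := tens (opAm X (opKV X u)) _; set a4 := tens _ (opAp Y (opAm Y v)).
  set b1 := tens (opAm X (opAp X u)) _; set b4 := tens _ (opAm Y (opAp Y v)).
  (* The mixed products cancel in pairs: P anticommutes with A_+ and A_-, while the factors from
     moving K and its inverse past them agree. *)
  have -> : a1 + h%:C *: a3 + (- (hv%:C *: a2) + a4) +
     (b1 + hv%:C *: a2 + (- (h%:C *: a3) + b4)) = (a1 + b1) + (a4 + b4).
    move: (h%:C *: a3) (hv%:C *: a2) (a1) (b1) (a4) (b4) => z1 z2 z3 z4 z5 z6.
    apply: malg_sep => f [fD fN _]; rewrite !(fD, fN); ring.
  (* What remains telescopes: (K^2 - K^-2) x K^2 + K^-2 x (K^2 - K^-2) equals K^2 x K^2 - K^-2 x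
     K^-2. *)
  rewrite -tensAl -tensAr (antiA HX) (antiA HY) tensZl tensZr -scalerDr.
  congr (_ *: _); rewrite !tensAl !tensAr !tensNl !tensNr.
  by rewrite -!addrA; congr (_ + _); rewrite addrA addNr add0r.
- apply: adjoint_tens => [||u v u' v']; [exact: apL | exact: amL |].
  rewrite !tE !innerDl !innerDr !inner_tens (adjA HX) (adjA HY) (adjKV HX).
  by rewrite (adjK HY) (adjP HY) -(PK HY).
- by apply: adjoint_tensop; [exact: (PL HX)|exact: (PL HX)|exact: (PL HY)|
   exact: (PL HY)|exact: (adjP HX)|exact: (adjP HY)].
- by apply: adjoint_tensop; [exact: (KL HX)|exact: (KL HX)|exact: (KL HY)|
   exact: (KL HY)|exact: (adjK HX)|exact: (adjK HY)].
Qed.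

Lemma commute_coprodl (T : {malg C[I]} -> {malg C[I]}) : linear T ->
  (forall v, T (opAp X v) = opAp X (T v)) ->
  (forall v, T (opAm X v) = opAm X (T v)) ->
  (forall v, T (opK X v) = opK X (T v)) ->
  [/\ forall v, tensop T id (opAp (coprod X Y) v) =
        opAp (coprod X Y) (tensop T id v),
      forall v, tensop T id (opAm (coprod X Y) v) =
        opAm (coprod X Y) (tensop T id v)
    & forall v, tensop T id (opK (coprod X Y) v) =
        opK (coprod X Y) (tensop T id v)].
Proof.
move=> TL Tp Tm Tk.
have tL : linear (@tensop C I J T id) by exact: tensop_linear.
have TV v : T (opKV X v) = opKV X (T v).
  by rewrite -{2}(KKV HX v) Tk (KVK HX).
have tTE u v : tensop T id (tens u v : {malg C[(I * J)%type]}) = tens (T u) v.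
  by rewrite tensopE.
have kL : linear (opK (coprod X Y)) by exact: tensop_linear.
have apL := coApL; have amL := coAmL.
split.
- apply: tens_ext => [||u v];
    [exact: (linear_comp tL apL)|exact: (linear_comp apL tL)|].
  by rewrite !(tE, tTE) (linD tL) !tTE Tp TV.
- apply: tens_ext => [||u v];
    [exact: (linear_comp tL amL)|exact: (linear_comp amL tL)|].
  by rewrite !(tE, tTE) (linD tL) !tTE Tm TV.
- apply: tens_ext => [||u v];
    [exact: (linear_comp tL kL)|exact: (linear_comp kL tL)|].
  by rewrite !(tE, tTE) Tk.
Qed.

(** Commutation with P enters because the coproduct of A_+ and A_- carries KP in its right
    factor. *)
Lemma commute_coprodr (T : {malg C[J]} -> {malg C[J]}) : linear T ->
  (forall v, T (opAp Y v) = opAp Y (T v)) ->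
  (forall v, T (opAm Y v) = opAm Y (T v)) ->
  (forall v, T (opK Y v) = opK Y (T v)) ->
  (forall v, T (opP Y v) = opP Y (T v)) ->
  [/\ forall v, tensop id T (opAp (coprod X Y) v) =
        opAp (coprod X Y) (tensop id T v),
      forall v, tensop id T (opAm (coprod X Y) v) =
        opAm (coprod X Y) (tensop id T v)
    & forall v, tensop id T (opK (coprod X Y) v) =
        opK (coprod X Y) (tensop id T v)].
Proof.
move=> TL Tp Tm Tk TP.
have tL : linear (@tensop C I J id T) by exact: tensop_linear.
have tTE u v : tensop id T (tens u v : {malg C[(I * J)%type]}) = tens u (T v).
  by rewrite tensopE.
have kL : linear (opK (coprod X Y)) by exact: tensop_linear.
have apL := coApL; have amL := coAmL.
split.
- apply: tens_ext => [||u v];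
    [exact: (linear_comp tL apL)|exact: (linear_comp apL tL)|].
  by rewrite !(tE, tTE) (linD tL) !tTE Tp Tk TP.
- apply: tens_ext => [||u v];
    [exact: (linear_comp tL amL)|exact: (linear_comp amL tL)|].
  by rewrite !(tE, tTE) (linD tL) !tTE Tm Tk TP.
- apply: tens_ext => [||u v];
    [exact: (linear_comp tL kL)|exact: (linear_comp kL tL)|].
  by rewrite !(tE, tTE) Tk.
Qed.
End Coprod.

End Rep.

(** * Abstract inner-product spaces *)

Section InnerProduct.
Variables (C : numClosedFieldType) (V : lmodType C).

Record is_inner (ip : V -> V -> C) : Prop := IsInner {
  ipDr : forall u v w, ip u (v + w) = ip u v + ip u w;
  ipZr : forall c u v, ip u (c *: v) = c * ip u v;
  ipC : forall u v, ip u v = (ip v u)^*;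
  ip_ge0 : forall v, 0 <= ip v v;
  ip_eq0 : forall v, ip v v = 0 -> v = 0
}.

Variable ip : V -> V -> C.
Hypothesis Hip : is_inner ip.

Definition self_adjoint (T : V -> V) := forall u v, ip (T u) v = ip u (T v).

Lemma ip0r u : ip u 0 = 0.
Proof. by rewrite -(scale0r 0) (ipZr Hip) mul0r. Qed.
Lemma ipNr u v : ip u (- v) = - ip u v.
Proof. by rewrite -scaleN1r (ipZr Hip) mulN1r. Qed.
Lemma ipBr u v w : ip u (v - w) = ip u v - ip u w.
Proof. by rewrite (ipDr Hip) ipNr. Qed.
Lemma ipDl u v w : ip (u + v) w = ip u w + ip v w.
Proof. by rewrite (ipC Hip) (ipDr Hip) rmorphD /= -!(ipC Hip). Qed.
Lemma ipZl c u v : ip (c *: u) v = c^* * ip u v.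
Proof. by rewrite (ipC Hip) (ipZr Hip) rmorphM /= -(ipC Hip). Qed.
Lemma ipNl u v : ip (- u) v = - ip u v.
Proof. by rewrite (ipC Hip) ipNr rmorphN /= -(ipC Hip). Qed.
Lemma ip_sumr u (J : Type) (r : seq J) (Q : pred J) (F : J -> V) :
  ip u (\sum_(i <- r | Q i) F i) = \sum_(i <- r | Q i) ip u (F i).
Proof. exact: (big_morph (ip u) (ipDr Hip u) (ip0r u)). Qed.

(** The counterpart of [malg_sep] in an abstract space: pairing with an arbitrary [w] makes vector
    identities accessible to [ring]. *)
Lemma ip_sep u v : (forall w, ip w u = ip w v) -> u = v.
Proof.
move=> uv; apply/eqP; rewrite -subr_eq0; apply/eqP/(ip_eq0 Hip).
by rewrite ipBr uv subrr.
Qed.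
End InnerProduct.

(** * The Casimir operator of a star representation *)

Section Rep.
Variables (R : realType) (C : numClosedFieldType) (io : {rmorphism R -> C}).
Hypothesis io_conj : forall x, (io x)^* = io x.
Variable q : R.
Hypothesis hq : 0 < q < 1.
Local Notation "x %:C" := (io x) (format "x %:C").
Local Notation h := (q `^ 2^-1).
Local Notation hv := (q `^ (- 2^-1)).

(** Since q - q^-1 = (h - h^-1)(h + h^-1), this compares the normalisation of the anticommutator
    with that of the Casimir. *)
Lemma kappaE : (h - hv)^-1 = (q - q^-1)^-1 * (h + hv).
Proof.
have qE : q - q^-1 = (h - hv) * (h + hv).
  have -> : q^-1 = hv * hv.
    by rewrite -[in LHS](hh hq) invfM -!powRN.
  by rewrite -{1}(hh hq) mulrDr !mulrBl [hv * h]mulrC addrA subrK.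
have := qV_neq hq; rewrite qE mulf_eq0 negb_or => /andP [H1 H2].
by rewrite invfM -mulrA mulVf ?mulr1.
Qed.

Variables (V : lmodType C) (ip : V -> V -> C).
Hypothesis Hip : is_inner ip.

(** The relations of [osp_rep] for bare functions on an abstract space, so that arguments about the
    Casimir and its eigenvectors never meet tensor products. *)
Record star_rep (Ap Am P K KV : V -> V) : Prop := StarRep {
  vApL : linear Ap;
  vAmL : linear Am;
  vPL : linear P;
  vKL : linear K;
  vKVL : linear KV;
  vKKV : forall v, K (KV v) = v;
  vKVK : forall v, KV (K v) = v;
  vPP : forall v, P (P v) = v;
  vPK : forall v, P (K v) = K (P v);
  vPAp : forall v, P (Ap v) = - Ap (P v);
  vPAm : forall v, P (Am v) = - Am (P v);
  vKAp : forall v, K (Ap v) = h%:C *: Ap (K v);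
  vKAm : forall v, K (Am v) = hv%:C *: Am (K v);
  vantiA : forall v, Ap (Am v) + Am (Ap v) =
     ((h - hv)^-1)%:C *: (K (K v) - KV (KV v));
  vadjA : forall u v, ip (Ap u) v = ip u (Am v);
  vadjP : self_adjoint ip P;
  vadjK : self_adjoint ip K
}.

Variables Ap Am P K KV : V -> V.
Hypothesis HX : star_rep Ap Am P K KV.

Lemma vadjAC u v : ip (Am u) v = ip u (Ap v).
Proof. by rewrite (ipC Hip) -(vadjA HX) -(ipC Hip). Qed.
Lemma vadjKV : self_adjoint ip KV.
Proof. by move=> u v; rewrite -{1}(vKKV HX v) -(vadjK HX) (vKKV HX). Qed.
Lemma vPKV v : P (KV v) = KV (P v).
Proof. by rewrite -{2}(vKKV HX v) (vPK HX) (vKVK HX). Qed.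
Lemma vKVAp v : KV (Ap v) = hv%:C *: Ap (KV v).
Proof.
rewrite -[RHS](vKVK HX) (linZ (vKL HX)) (vKAp HX) (vKKV HX) scalerA -rmorphM.
by rewrite mulrC (hhv hq) rmorph1 scale1r.
Qed.
Lemma vKVAm v : KV (Am v) = h%:C *: Am (KV v).
Proof.
rewrite -[RHS](vKVK HX) (linZ (vKL HX)) (vKAm HX) (vKKV HX) scalerA -rmorphM.
by rewrite (hhv hq) rmorph1 scale1r.
Qed.

Definition casV (v : V) : V :=
  let w := P v in
  Ap (Am w)
  - ((q - q^-1)^-1)%:C *: (hv%:C *: K (K w) - h%:C *: KV (KV w)).
Local Notation Q := casV.

Lemma casV_linear : linear Q.
Proof.
rewrite /casV; apply: linear_add.
  exact: (linear_comp (vApL HX) (linear_comp (vAmL HX) (vPL HX))).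
apply: linear_opp; apply: linear_scale; apply: linear_add.
  apply: linear_scale; exact: (linear_comp (vKL HX) (linear_comp (vKL HX) (vPL HX))).
apply: linear_opp; apply: linear_scale.
exact: (linear_comp (vKVL HX) (linear_comp (vKVL HX) (vPL HX))).
Qed.

Lemma casVP v : Q (P v) = P (Q v).
Proof.
rewrite /casV /= (linB (vPL HX)) (linZ (vPL HX)) (linB (vPL HX)).
rewrite !(linZ (vPL HX)) (vPAp HX) (vPAm HX) (linN (vApL HX)) opprK.
by rewrite !(vPK HX) !vPKV.
Qed.

Lemma casVK v : Q (K v) = K (Q v).
Proof.
have KVC u : KV (K u) = K (KV u) by rewrite (vKKV HX) (vKVK HX).
rewrite /casV /= (linB (vKL HX)) (linZ (vKL HX)) (linB (vKL HX)).
rewrite !(linZ (vKL HX)) (vKAp HX) (vKAm HX) (linZ (vApL HX)) scalerA.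
rewrite -rmorphM (hhv hq) rmorph1 scale1r.
by rewrite !(vPK HX) !KVC.
Qed.

Lemma vKKAm v : K (K (Am v)) = (hv * hv)%:C *: Am (K (K v)).
Proof. by rewrite (vKAm HX) (linZ (vKL HX)) (vKAm HX) scalerA -rmorphM. Qed.
Lemma vKKAp v : K (K (Ap v)) = (h * h)%:C *: Ap (K (K v)).
Proof. by rewrite (vKAp HX) (linZ (vKL HX)) (vKAp HX) scalerA -rmorphM. Qed.
Lemma vVVAm v : KV (KV (Am v)) = (h * h)%:C *: Am (KV (KV v)).
Proof. by rewrite vKVAm (linZ (vKVL HX)) vKVAm scalerA -rmorphM. Qed.
Lemma vVVAp v : KV (KV (Ap v)) = (hv * hv)%:C *: Ap (KV (KV v)).
Proof. by rewrite vKVAp (linZ (vKVL HX)) vKVAp scalerA -rmorphM. Qed.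

Lemma vAmAp v : Am (Ap v) =
  ((h - hv)^-1)%:C *: (K (K v) - KV (KV v)) - Ap (Am v).
Proof. by rewrite -(vantiA HX) addrC addKr. Qed.

(** Passing A_- through P costs a sign, and the resulting A_- A_+ A_- is reduced by the
    anticommutator. The terms in K^2 and K^-2 then match because of [kappaE] and h h^-1 = 1. *)
Lemma casVAm v : Q (Am v) = Am (Q v).
Proof.
rewrite /casV /= (vPAm HX); set w := P v.
rewrite !(linN (vAmL HX)) !(linN (vApL HX)) !(linN (vKL HX)) !(linN (vKVL HX)).
rewrite vKKAm vVVAm (linB (vAmL HX)) !(linZ (vAmL HX)) (linB (vAmL HX)).
rewrite !(linZ (vAmL HX)) vAmAp vKKAm vVVAm.
rewrite kappaE; move: (congr1 io (hhv hq)).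
rewrite !rmorphM rmorph1 rmorphD /=.
move: ((q - q^-1)^-1%:C) (h%:C) (hv%:C) => r z z' zz.
apply: (ip_sep Hip) => f; rewrite !(ipNr Hip, ipZr Hip, ipDr Hip).
ring: zz.
Qed.

Lemma casVAp v : Q (Ap v) = Ap (Q v).
Proof.
rewrite /casV /= (vPAp HX); set w := P v.
rewrite !(linN (vAmL HX)) !(linN (vApL HX)) !(linN (vKL HX)) !(linN (vKVL HX)).
rewrite vKKAp vVVAp vAmAp (linB (vApL HX)) !(linZ (vApL HX)) !(linB (vApL HX)).
rewrite !(linZ (vApL HX)) (linB (vApL HX)) !(linZ (vApL HX)).
rewrite kappaE; move: (congr1 io (hhv hq)).
rewrite !rmorphM rmorph1 rmorphD /=.
move: ((q - q^-1)^-1%:C) (h%:C) (hv%:C) => r z z' zz.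
apply: (ip_sep Hip) => f; rewrite !(ipNr Hip, ipZr Hip, ipDr Hip).
ring: zz.
Qed.

(** Tailored to basis vectors |n,0> and |0,n> of a two-fold product, which A_- sends to a multiple
    of a single vector [f]. *)
Lemma casV_weight e f x k k' y : P e = x%:C *: e -> K e = k%:C *: e ->
  KV e = k'%:C *: e -> Am e = y%:C *: f ->
  Q e = (x * y)%:C *: Ap f
    - (x * ((q - q^-1)^-1 * (hv * (k * k) - h * (k' * k'))))%:C *: e.
Proof.
move=> Pe Ke KVe Ae; rewrite /casV /= Pe.
rewrite !(linZ (vAmL HX)) !(linZ (vApL HX)) !(linZ (vKL HX)) !(linZ (vKVL HX)).
rewrite Ae Ke KVe (linZ (vApL HX)) (linZ (vKL HX)) (linZ (vKVL HX)) Ke KVe.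
rewrite !scalerA -!rmorphM; congr (_ - _).
rewrite -scalerBl scalerA; congr (_ *: _).
by rewrite -rmorphB -rmorphM; congr (_%:C); ring.
Qed.

Lemma casV_adj : self_adjoint ip Q.
Proof.
move=> u v; rewrite /casV /=.
rewrite !(ipDl Hip, ipNl Hip, ipZl Hip) !(ipDr Hip, ipNr Hip, ipZr Hip) !io_conj.
rewrite !(vadjA HX) !vadjAC !(vadjK HX) !vadjKV !(vadjP HX).
by rewrite !(vPK HX) !vPKV (vPAp HX) (vPAm HX) (linN (vApL HX)) opprK.
Qed.
End Rep.

(** * The irreducible representations W^(eps,mu) *)

Section Irrep.
Variables (R : realType) (C : numClosedFieldType) (io : {rmorphism R -> C}).
Hypothesis io_conj : forall x, (io x)^* = io x.
Variable q : R.
Hypothesis hq : 0 < q < 1.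
Local Notation "x %:C" := (io x) (format "x %:C").
Local Notation h := (q `^ 2^-1).
Local Notation hv := (q `^ (- 2^-1)).

Lemma qpow_lt x y : x < y -> q `^ y < q `^ x.
Proof.
move=> xy; have q0 := q_gt0 hq; have /andP [_ q1] := hq.
rewrite /powR (gt_eqF q0) ltr_expR ltr_nM2r //.
by rewrite ln_lt0 // q0.
Qed.

Lemma qV_lt0 : q - q^-1 < 0.
Proof.
have q0 := q_gt0 hq; have /andP [_ q1] := hq.
by rewrite subr_lt0 (lt_trans q1) // invf_gt1.
Qed.

Lemma qnum_lt x y : x < y -> qnum q x < qnum q y.
Proof.
move=> xy; rewrite /qnum ltr_nM2r ?invr_lt0 ?qV_lt0 //.
by rewrite ltrB // qpow_lt // ltrN2.
Qed.

Lemma qnum0 : qnum q 0 = 0.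
Proof. by rewrite /qnum oppr0 subrr mul0r. Qed.

Lemma qnum_gt0 x : 0 < x -> 0 < qnum q x.
Proof. by rewrite -{2}qnum0; exact: qnum_lt. Qed.

Lemma sigma0 mu : sigma q mu 0 = 0.
Proof. by rewrite /sigma add0r expr0 mul1r subrr. Qed.

(** [qnum] is strictly increasing and positive on positive reals, so [n+mu] exceeds [mu] taken with
    either sign. *)
Lemma sigma_gt0 mu n : 0 < mu -> 0 < sigma q mu n.+1.
Proof.
move=> mu0; have m0 := qnum_gt0 mu0.
have lt : qnum q mu < qnum q (n.+1%:R + mu).
  by apply: qnum_lt; rewrite ltrDr ltr0Sn.
rewrite /sigma subr_gt0; apply: le_lt_trans lt.
rewrite -signr_odd; case: (odd _); rewrite ?expr0 ?mul1r //.
by rewrite expr1 mulN1r ge0_cp // ltW.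
Qed.

Lemma sigma_ge0 mu n : 0 < mu -> 0 <= sigma q mu n.
Proof. by case: n => [|n] mu0; rewrite ?sigma0 // ltW // sigma_gt0. Qed.

(** The anticommutator on the n-th basis vector: the alternating terms of consecutive [sigma]
    cancel, and [n+mu] + [n+1+mu] is rewritten by [kappaE]. *)
Lemma sigmaD mu n : sigma q mu n + sigma q mu n.+1 =
  (h - hv)^-1 * (q `^ (n%:R + mu + 2^-1) - q `^ (- (n%:R + mu + 2^-1))).
Proof.
rewrite (kappaE hq) /sigma exprS mulN1r mulNr opprK.
rewrite -addrA [- _ + (_ + _)]addrC addrK /qnum -mulrDl mulrC -mulrA.
congr (_ * _).
have -> : n.+1%:R + mu = n%:R + mu + 1 by rewrite -natr1 addrAC.
rewrite !opprD !(qpowD hq).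
rewrite powRr1 ?(ltW (q_gt0 hq)) // powR_inv1 ?(ltW (q_gt0 hq)) //.
have := hh hq; have := hhv hq; move: (q `^ n%:R * q `^ mu) (q `^ - n%:R * q `^ - mu) => x y.
have q0 := q_neq0 hq.
move: h hv => z z' zz e; rewrite -e.
have -> : (z * z)^-1 = z' * z'.
  have z0 : z != 0 by apply: contraTneq isT => z0; move: zz; rewrite z0 mul0r => /eqP; rewrite eq_sym oner_eq0.
  by rewrite invfM; have -> : z' = z^-1 by rewrite -[LHS](mulKf z0) zz mulr1.
by ring: zz.
Qed.

Lemma adjoint_basis I (f g : {malg C[I]} -> {malg C[I]}) :
  linear f -> linear g ->
  (forall i j, inner (f << i >>) << j >> = inner << i >> (g << j >>)) ->
  adjoint f g.
Proof.
move=> fL gL fg w z.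
rewrite [w]malg_basis (lin_sum fL) !inner_suml; apply: eq_bigr => i _.
rewrite (linZ fL) !innerZl; congr (_ * _).
rewrite [z]malg_basis (lin_sum gL) !inner_sumr; apply: eq_bigr => j _.
by rewrite (linZ gL) !innerZr fg.
Qed.

Variables (eps mu : R).
Hypothesis heps : eps = 1 \/ eps = -1.
Hypothesis hmu : 0 < mu.

(** [irrep] with its real scalars embedded by an arbitrary [io]. For [io] equal to [real_complex]
    the two are convertible, which the final theorem relies on. *)
Definition irrepC : osp_ops C nat := {|
  opA0 := lext (fun n => << (n%:R + mu + 2^-1)%:C *g n >>);
  opAp := lext (fun n => << (Num.sqrt (sigma q mu n.+1))%:C *g n.+1 >>);
  opAm := lext (fun n => << (Num.sqrt (sigma q mu n))%:C *g n.-1 >>);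
  opP  := lext (fun n => << (eps * (-1) ^+ n)%:C *g n >>);
  opK  := lext (fun n => << (q `^ ((n%:R + mu + 2^-1) / 2))%:C *g n >>);
  opKV := lext (fun n => << (q `^ (- ((n%:R + mu + 2^-1) / 2)))%:C *g n >>)
|}.
Local Notation X := irrepC.

Lemma irAp n : opAp X << n >> = (Num.sqrt (sigma q mu n.+1))%:C *: << n.+1 >>.
Proof. by rewrite /= lextU malgUZ. Qed.
Lemma irAm n : opAm X << n >> = (Num.sqrt (sigma q mu n))%:C *: << n.-1 >>.
Proof. by rewrite /= lextU malgUZ. Qed.
Lemma irP n : opP X << n >> = (eps * (-1) ^+ n)%:C *: << n >>.
Proof. by rewrite /= lextU malgUZ. Qed.
Lemma irK n : opK X << n >> = (q `^ ((n%:R + mu + 2^-1) / 2))%:C *: << n >>.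
Proof. by rewrite /= lextU malgUZ. Qed.
Lemma irKV n : opKV X << n >> = (q `^ (- ((n%:R + mu + 2^-1) / 2)))%:C *: << n >>.
Proof. by rewrite /= lextU malgUZ. Qed.
Lemma irA0 n : opA0 X << n >> = (n%:R + mu + 2^-1)%:C *: << n >>.
Proof. by rewrite /= lextU malgUZ. Qed.

Lemma eps2 : eps * eps = 1.
Proof. by case: heps => ->; rewrite ?mulrNN mul1r. Qed.

Lemma scale_comb (V : lmodType C) (a b k c d : C) (x : V) :
  a + b = k * (c - d) -> a *: x + b *: x = k *: (c *: x - d *: x).
Proof. by move=> e; rewrite -scalerDl -scalerBl scalerA e. Qed.

Lemma irrep_rep : osp_rep io q X.
Proof.
have apL : linear (opAp X) by exact: lext_linear.
have amL : linear (opAm X) by exact: lext_linear.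
have pL : linear (opP X) by exact: lext_linear.
have kL : linear (opK X) by exact: lext_linear.
have kvL : linear (opKV X) by exact: lext_linear.
have kkv x : q `^ x * q `^ (- x) = 1 by rewrite powRN mulfV ?qpow_neq0.
split; [exact: apL|exact: amL|exact: pL|exact: kL|exact: kvL|..].
- apply: malg_ext => [||n]; [exact: (linear_comp kL kvL)|exact: linear_id|].
  by rewrite irKV (linZ kL) irK scalerA -rmorphM mulrC kkv rmorph1 scale1r.
- apply: malg_ext => [||n]; [exact: (linear_comp kvL kL)|exact: linear_id|].
  by rewrite irK (linZ kvL) irKV scalerA -rmorphM kkv rmorph1 scale1r.
- apply: malg_ext => [||n]; [exact: (linear_comp pL pL)|exact: linear_id|].
  by rewrite irP (linZ pL) irP scalerA -rmorphM mulrACA eps2 mul1r -expr2 sqrr_sign rmorph1 scale1r.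
- apply: malg_ext => [||n]; [exact: (linear_comp pL kL)|exact: (linear_comp kL pL)|].
  by rewrite irP irK (linZ pL) (linZ kL) irP irK !scalerA mulrC.
- apply: malg_ext => [||n]; first exact: (linear_comp pL apL).
    by apply: linear_opp; exact: (linear_comp apL pL).
  rewrite irP irAp (linZ pL) (linZ apL) irP irAp !scalerA -!rmorphM -scaleNr.
  by rewrite -rmorphN /= exprS; congr (_%:C *: _); ring.
- apply: malg_ext => [||n]; first exact: (linear_comp pL amL).
    by apply: linear_opp; exact: (linear_comp amL pL).
  rewrite irP irAm (linZ pL) (linZ amL) irP irAm !scalerA -!rmorphM -scaleNr.
  case: n => [|n]; first by rewrite sigma0 sqrtr0 mul0r mulr0 rmorph0 oppr0 !scale0r.
  by rewrite -rmorphN /= exprS; congr (_%:C *: _); ring.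
- apply: malg_ext => [||n]; first exact: (linear_comp kL apL).
    by apply: linear_scale; exact: (linear_comp apL kL).
  rewrite irAp irK (linZ kL) irK (linZ apL) irAp !scalerA -!rmorphM /=.
  congr (_%:C *: _); rewrite mulrC [_ * q `^ _]mulrC -!mulrA.
  rewrite [RHS]mulrCA [RHS]mulrA -(qpowD hq); congr (q `^ _ * _).
  by rewrite -natr1; field.
- apply: malg_ext => [||n]; first exact: (linear_comp kL amL).
    by apply: linear_scale; exact: (linear_comp amL kL).
  rewrite irAm irK (linZ kL) irK (linZ amL) irAm !scalerA -!rmorphM /=.
  case: n => [|n]; first by rewrite sigma0 sqrtr0 mul0r !mulr0.
  congr (_%:C *: _); rewrite mulrC; congr (_ * _).
  by rewrite -(qpowD hq); congr (q `^ _); rewrite -natr1; field.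
- apply: malg_ext => [||n].
  + by apply: linear_add; [exact: (linear_comp apL amL) | exact: (linear_comp amL apL)].
  + apply: linear_scale; apply: linear_add; first exact: (linear_comp kL kL).
    by apply: linear_opp; exact: (linear_comp kvL kvL).
  rewrite irAm irAp irK irKV (linZ apL) (linZ amL) (linZ kL) (linZ kvL).
  rewrite irAp irAm irK irKV !scalerA -!rmorphM /=.
  rewrite -!(qpowD hq).
  (* At n = 0 the index [n.-1.+1] is 1 instead of n, but sigma_0 = 0 makes both sides vanish. *)
  have -> : ((Num.sqrt (sigma q mu n) * Num.sqrt (sigma q mu n.-1.+1))%:C *: << n.-1.+1 >>
     = (sigma q mu n)%:C *: << n >> :> {malg C[nat]}).
    case: n => [|n]; first by rewrite sigma0 sqrtr0 mul0r rmorph0 !scale0r.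
    by rewrite -expr2 sqr_sqrtr ?sigma_ge0.
  rewrite -expr2 sqr_sqrtr ?sigma_ge0 //; apply: scale_comb.
  rewrite -rmorphD -rmorphB -rmorphM sigmaD /=; congr ((_ * (q `^ _ - q `^ _))%:C).
    by field.
  by field.
- apply: adjoint_basis => // n m.
  rewrite irAp irAm innerZl innerZr !innerU io_conj !mcoeffU.
  case: m => [|m] /=; first by rewrite sigma0 sqrtr0 mulr0n mulr0 (_ : io 0 = 0) ?mul0r // rmorph0.
  by rewrite eqSS eq_sym; case: eqP => [->|_] //; rewrite !mulr0.
- apply: adjoint_basis => // n m.
  rewrite !irP innerZl innerZr !innerU io_conj !mcoeffU.
  by rewrite eq_sym; case: eqP => [->|_] //; rewrite !mulr0.
- apply: adjoint_basis => // n m.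
  rewrite !irK innerZl innerZr !innerU io_conj !mcoeffU.
  by rewrite eq_sym; case: eqP => [->|_] //; rewrite !mulr0.
Qed.
End Irrep.

(** * Lowest-weight vectors and joint eigenbases *)

Section Levels.
Variables (R : realType) (C : numClosedFieldType) (io : {rmorphism R -> C}).
Hypothesis io_conj : forall x, (io x)^* = io x.
Hypothesis io_ge0 : forall x, (0 <= io x) = (0 <= x).
Variable q : R.
Hypothesis hq : 0 < q < 1.
Local Notation "x %:C" := (io x) (format "x %:C").
Local Notation h := (q `^ 2^-1).
Local Notation hv := (q `^ (- 2^-1)).

Variables (V : lmodType C) (ip : V -> V -> C).
Hypothesis Hip : is_inner ip.
Variables Ap Am P K KV E : V -> V.
Hypothesis HX : star_rep io q ip Ap Am P K KV.
Local Notation Q := (casV io q Ap Am P K KV).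

Variables (muN epsN : R).
Hypothesis muN_gt0 : 0 < muN.
Hypothesis epsN2 : epsN * epsN = 1.
(** The eigenvalue of K at A0-weight muN + 1/2 + k. Levels are cut out by K because the relations
    involve K; [HE] identifies them with the eigenspaces of [E]. *)
Definition kap (k : nat) : R := q `^ ((muN + 2^-1 + k%:R) / 2).
Definition lev k w := K w = (kap k)%:C *: w.
Hypothesis HE : forall k w,
  E w = (muN + 2^-1 + k%:R)%:C *: w <-> lev k w.
Hypothesis HP : forall k w, lev k w -> P w = (epsN * (-1) ^+ k)%:C *: w.
Local Notation tauN := (- epsN * qnum q muN).

Lemma kap_neq0 k : kap k != 0. Proof. exact: qpow_neq0. Qed.
Lemma kapS k : kap k.+1 = h * kap k.
Proof. by rewrite /kap -(qpowD hq); congr (q `^ _); rewrite -natr1; field. Qed.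

Lemma lev_lin k c u v : lev k u -> lev k v -> lev k (c *: u + v).
Proof.
by rewrite /lev (vKL HX) => -> ->; rewrite scalerDr !scalerA [c * _]mulrC.
Qed.

Lemma lev_Ap k w : lev k w -> lev k.+1 (Ap w).
Proof.
by rewrite /lev (vKAp HX) => ->; rewrite (linZ (vApL HX)) scalerA -rmorphM kapS.
Qed.

Lemma lev_Am k w : lev k.+1 w -> lev k (Am w).
Proof.
rewrite /lev (vKAm HX) => ->; rewrite (linZ (vAmL HX)) scalerA -rmorphM kapS.
by rewrite mulrA [hv * h]mulrC (hhv hq) mul1r.
Qed.

Lemma lev_KV k w : lev k w -> KV w = (kap k)^-1%:C *: w.
Proof.
move=> kw; rewrite -[RHS](vKVK HX) (linZ (vKL HX)) kw scalerA -rmorphM.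
by rewrite mulVf ?kap_neq0 // rmorph1 scale1r.
Qed.

Lemma kap2 k : kap k * kap k = q `^ (muN + k%:R + 2^-1).
Proof. by rewrite -(qpowD hq); congr (q `^ _); field. Qed.

(** Solving the Casimir for A_+ A_- on level k of the tau_N-eigenspace gives [sigma] at parameter
    muN: the eigenspace behaves like copies of W^(epsN,muN). *)
Lemma sigma_lev k :
  epsN * (-1) ^+ k * tauN
  + (q - q^-1)^-1 * (hv * (kap k * kap k) - h * ((kap k)^-1 * (kap k)^-1))
  = sigma q muN k.
Proof.
rewrite -invfM kap2 -powRN -!(qpowD hq) /sigma /qnum.
have -> : - 2^-1 + (muN + k%:R + 2^-1) = k%:R + muN by ring.
have -> : 2^-1 + - (muN + k%:R + 2^-1) = - (k%:R + muN) by ring.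
by ring: epsN2.
Qed.

Lemma casV_lev k w : lev k w -> Q w =
  (epsN * (-1) ^+ k)%:C *: Ap (Am w)
  - ((epsN * (-1) ^+ k) * ((q - q^-1)^-1 * (hv * (kap k * kap k)
      - h * ((kap k)^-1 * (kap k)^-1))))%:C *: w.
Proof.
move=> kw; rewrite /casV /= (HP kw); have vw := lev_KV kw.
rewrite !(linZ (vAmL HX)) !(linZ (vApL HX)) !(linZ (vKL HX)) !(linZ (vKVL HX)).
rewrite kw vw (linZ (vKL HX)) (linZ (vKVL HX)) kw vw !scalerA.
congr (_ - _); rewrite -scalerBl scalerA; congr (_ *: _).
by rewrite -!rmorphM -rmorphB -rmorphM /=; congr (_%:C); ring.
Qed.

Lemma ApAm_lev k w : lev k w -> Q w = tauN%:C *: w ->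
  Ap (Am w) = (sigma q muN k)%:C *: w.
Proof.
move=> kw; rewrite (casV_lev kw) => /(congr1 (fun v => (epsN * (-1) ^+ k)%:C *: v)).
have e1 : (epsN * (-1) ^+ k) * (epsN * (-1) ^+ k) = 1.
  by rewrite mulrACA epsN2 mul1r -expr2 sqrr_sign.
rewrite scalerBr !scalerA -!rmorphM e1 rmorph1 scale1r mulrA e1 mul1r.
by move/eqP; rewrite subr_eq => /eqP ->; rewrite -scalerDl -rmorphD sigma_lev.
Qed.

(** By [VN_cas] and [cas_VN] this is exactly the bottom level of the tau_N-eigenspace. It is kept as
    a predicate on [V] rather than a subspace type. *)
Definition VN w := lev 0 w /\ Am w = 0.

Lemma VN_lin c u v : VN u -> VN v -> VN (c *: u + v).
Proof.
move=> [u0 u1] [v0 v1]; split; first exact: lev_lin.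
by rewrite (vAmL HX) u1 v1 scaler0 addr0.
Qed.

Lemma VN0 : VN 0.
Proof.
by split; rewrite /lev ?(lin0 (vKL HX)) ?(lin0 (vAmL HX)) ?scaler0.
Qed.
Lemma VN_Z c u : VN u -> VN (c *: u).
Proof. by move=> uV; rewrite -[_ *: _]addr0; exact: VN_lin uV VN0. Qed.
Lemma VN_D u v : VN u -> VN v -> VN (u + v).
Proof. by move=> uV vV; rewrite -[u]scale1r; exact: VN_lin. Qed.

Lemma VN_cas w : VN w -> Q w = tauN%:C *: w.
Proof.
move=> [kw aw]; rewrite (casV_lev kw) aw (lin0 (vApL HX)) scaler0 add0r -scaleNr.
congr (_ *: _); rewrite -rmorphN; congr (_%:C).
have := sigma_lev 0; rewrite sigma0 expr0 !mulr1; set x := (_ * (_ - _)) => e.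
have -> : x = - (epsN * tauN) by rewrite -[x](addKr (epsN * tauN)) e addr0.
by ring: epsN2.
Qed.

(** Here A_+ A_- w = sigma_0 w = 0, hence A_- w has norm zero. *)
Lemma cas_VN w : lev 0 w -> Q w = tauN%:C *: w -> VN w.
Proof.
move=> kw Qw; split => //; apply: (ip_eq0 Hip).
rewrite -(vadjA HX) (ApAm_lev kw Qw) sigma0 rmorph0 scale0r.
by rewrite (ipC Hip) (ip0r Hip) conjC0.
Qed.

Lemma ip_Am k w w' : lev k w -> Q w = tauN%:C *: w ->
  ip (Am w) (Am w') = (sigma q muN k)%:C * ip w w'.
Proof.
by move=> kw Qw; rewrite -(vadjA HX) (ApAm_lev kw Qw) (ipZl Hip) io_conj.
Qed.

(** The factor by which k successive lowerings scale inner products; each lowering contributes one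
    [sigma] through [ip_Am]. *)
Definition levprod k : R := \prod_(j < k) sigma q muN j.+1.
Lemma levprod_gt0 k : 0 < levprod k.
Proof. by apply: prodr_gt0 => j _; exact: sigma_gt0. Qed.

Lemma lower k w w' : lev k w -> Q w = tauN%:C *: w ->
  lev k w' -> Q w' = tauN%:C *: w' ->
  [/\ VN (iter k Am w), VN (iter k Am w')
    & ip (iter k Am w) (iter k Am w') = (levprod k)%:C * ip w w'].
Proof.
elim: k w w' => [|k IH] w w' kw Qw kw' Qw'.
  by split; rewrite /= ?/levprod ?big_ord0 ?rmorph1 ?mul1r //; exact: cas_VN.
have QA z : Q z = tauN%:C *: z -> Q (Am z) = tauN%:C *: Am z.
  by move=> e; rewrite (casVAm hq Hip HX) e (linZ (vAmL HX)).
have [H1 H2 H3] := IH _ _ (lev_Am kw) (QA _ Qw) (lev_Am kw') (QA _ Qw').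
rewrite !iterSr; split => //.
rewrite H3 (ip_Am _ kw Qw) mulrA -rmorphM; congr (_%:C * _).
by rewrite /levprod big_ord_recr.
Qed.

Lemma lev_orth j k w w' : j != k -> lev j w -> lev k w' -> ip w w' = 0.
Proof.
move=> jk jw kw; have := vadjK HX w w'; rewrite jw kw (ipZl Hip) (ipZr Hip).
rewrite io_conj => /eqP; rewrite -subr_eq0 -mulrBl mulf_eq0 -rmorphB fmorph_eq0.
case/orP => [|/eqP //]; rewrite subr_eq0 /kap => /eqP e.
have inj x y : q `^ x = q `^ y -> x = y.
  move=> exy; apply/eqP; case: (ltgtP x y) => // xy.
    by have := qpow_lt hq xy; rewrite exy ltxx.
  by have := qpow_lt hq xy; rewrite exy ltxx.
move/inj: e => e; case/negP: jk; rewrite -(eqr_nat R); apply/eqP.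
have : (muN + 2^-1 + j%:R) / 2 * 2 = (muN + 2^-1 + k%:R) / 2 * 2 by rewrite e.
by rewrite !divfK ?pnatr_eq0 // => /addrI.
Qed.

Variable T : V -> V.
Hypothesis TL : linear T.
Hypothesis TA : self_adjoint ip T.
Hypothesis TAp : forall v, T (Ap v) = Ap (T v).
Hypothesis TAm : forall v, T (Am v) = Am (T v).
Hypothesis TK : forall v, T (K v) = K (T v).

Lemma VN_T w : VN w -> VN (T w).
Proof.
move=> [kw aw]; split; first by rewrite /lev -TK kw (linZ TL).
by rewrite -TAm aw (lin0 TL).
Qed.

Lemma T_iter k c w : T w = c *: w -> T (iter k Am w) = c *: iter k Am w.
Proof. by move=> Tw; elim: k => //= k IH; rewrite TAm IH (linZ (vAmL HX)). Qed.

Lemma T_orth (a b : R) w w' : a != b ->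
  T w = a%:C *: w -> T w' = b%:C *: w' -> ip w w' = 0.
Proof.
move=> ab Tw Tw'; have := TA w w'; rewrite Tw Tw' (ipZl Hip) (ipZr Hip) io_conj.
move/eqP; rewrite -subr_eq0 -mulrBl mulf_eq0 -rmorphB fmorph_eq0 subr_eq0.
by rewrite (negbTE ab) => /eqP.
Qed.

Variables (N : nat) (lam : nat -> R).
Hypothesis lam_inj : forall i j, (i <= N)%N -> (j <= N)%N -> lam i = lam j -> i = j.

Definition joint_eigenbasis (u : 'I_N.+1 -> nat -> V) : Prop :=
  (forall n k, [/\ T (u n k) = (lam n)%:C *: u n k,
                   Q (u n k) = tauN%:C *: u n k
                 & E (u n k) = (muN + 2^-1 + k%:R)%:C *: u n k])
  /\ (forall n k n' k',
        ip (u n k) (u n' k') = ((n == n') && (k == k'))%:R).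

(** Eigenvectors at the bottom level are normalised and then raised by A_+, dividing by the square
    root of [sigma] at every step. [T] and the Casimir commute with A_+, so the eigenvalues persist;
    different levels or different n are orthogonal because the eigenvalues differ. *)
Lemma joint_eigenbasis_exists (w : nat -> V) :
  (forall n, (n <= N)%N -> [/\ VN (w n), w n != 0 & T (w n) = (lam n)%:C *: w n]) ->
  exists u, joint_eigenbasis u.
Proof.
move=> Hw.
pose e n := (sqrtC (ip (w n) (w n)))^-1 *: w n.
pose fix f (n : nat) (k : nat) : V := if k is k'.+1 then
  ((Num.sqrt (sigma q muN k))^-1)%:C *: Ap (f n k') else e n.
have Hf n k : (n <= N)%N -> [/\ lev k (f n k), Q (f n k) = tauN%:C *: f n k,
    T (f n k) = (lam n)%:C *: f n k & ip (f n k) (f n k) = 1].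
  move=> nN; have [wV w0 Tw] := Hw n nN.
  elim: k => [|k [f1 f2 f3 f4]].
    have eV : VN (e n) by exact: VN_Z.
    have wn0 : ip (w n) (w n) != 0.
      by apply: contra w0 => /eqP /(ip_eq0 Hip) ->.
    split; [by case: eV | exact: VN_cas | |].
      by rewrite /= /e (linZ TL) Tw !scalerA mulrC.
    rewrite /= /e (ipZl Hip) (ipZr Hip) mulrA -normCKC normfV.
    rewrite ger0_norm ?sqrtC_ge0 ?(ip_ge0 Hip) // exprVn sqrtCK.
    by rewrite mulVf.
  have lA := lev_Ap f1.
  have QA : Q (Ap (f n k)) = tauN%:C *: Ap (f n k).
    by rewrite (casVAp hq Hip HX) f2 (linZ (vApL HX)).
  have s0 := sigma_gt0 hq k muN_gt0.
  have nA : ip (Ap (f n k)) (Ap (f n k)) = (sigma q muN k.+1)%:C.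
    (* The anticommutator gives A_- A_+ as a scalar minus A_+ A_- = sigma_k, and [sigmaD] identifies
       the difference as sigma_(k+1). *)
    have e2 : Am (Ap (f n k)) = (sigma q muN k.+1)%:C *: f n k.
      rewrite (vAmAp HX) (ApAm_lev f1 f2) (lev_KV f1) f1.
      rewrite (linZ (vKL HX)) (linZ (vKVL HX)) f1 (lev_KV f1) !scalerA.
      rewrite -scalerBl scalerA -scalerBl -!rmorphM -rmorphB -rmorphM -rmorphB.
      congr (_%:C *: _); apply/eqP; rewrite subr_eq [_ + sigma q muN k]addrC sigmaD //.
      rewrite -invfM kap2 -powRN; apply/eqP; congr (_ * (q `^ _ - q `^ _)); ring.
    rewrite (vadjA HX) e2 (ipZr Hip) f4 mulr1 //.
  split => /=.
  - by rewrite /lev (linZ (vKL HX)) lA !scalerA mulrC.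
  - by rewrite (linZ (casV_linear HX)) QA !scalerA mulrC.
  - by rewrite (linZ TL) TAp f3 (linZ (vApL HX)) !scalerA mulrC.
  - rewrite (ipZl Hip) (ipZr Hip) io_conj nA mulrA -!rmorphM -invfM -expr2.
    by rewrite sqr_sqrtr ?ltW // mulVf ?rmorph1 // gt_eqF.
exists (fun n k => f n k); split.
  move=> n k; have [f1 f2 f3 _] := Hf n k (ltn_ord n).
  by split => //; apply/HE.
move=> n k n' k'.
have [f1 f2 f3 f4] := Hf n k (ltn_ord n).
have [g1 g2 g3 g4] := Hf n' k' (ltn_ord n').
case: (eqVneq k k') => [kk|kk]; last by rewrite andbF (lev_orth kk).
case: (eqVneq n n') => [nn|nn]; first by rewrite -kk -nn f4.
rewrite andFb; apply: T_orth f3 g3; apply: contra nn => /eqP /lam_inj H.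
by apply/eqP/val_inj; apply: H; rewrite -ltnS.
Qed.

(* The normalisation makes lowering to the bottom level an isometry. *)
Definition lowered (u : 'I_N.+1 -> nat -> V) k n : V :=
  (Num.sqrt (levprod k))^-1%:C *: iter k Am (u n k).

Lemma lowered_VN u k n : joint_eigenbasis u ->
  [/\ VN (lowered u k n) & T (lowered u k n) = (lam n)%:C *: lowered u k n].
Proof.
move=> [Hu _]; have [u1 u2 /HE u3] := Hu n k.
have [H _ _] := lower u3 u2 u3 u2.
split; first exact: VN_Z.
by rewrite /lowered (linZ TL) (T_iter k u1) !scalerA mulrC.
Qed.
End Levels.

(** * p-Racah polynomials and their orthogonality *)

Section Pochhammer.
Variables (F : fieldType) (p : F).
Implicit Types z : F.

Lemma qpoch0 z : qpoch z p 0 = 1.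
Proof. by rewrite /qpoch big_ord0. Qed.
Lemma qpochS z k : qpoch z p k.+1 = qpoch z p k * (1 - p ^+ k * z).
Proof. by rewrite /qpoch big_ord_recr. Qed.
Lemma qpochSl z k : qpoch z p k.+1 = (1 - z) * qpoch (z * p) p k.
Proof.
rewrite /qpoch big_ord_recl expr0 mul1r; congr (_ * _).
by apply: eq_bigr => i _; rewrite exprS -mulrA [p * _]mulrC -mulrA.
Qed.
Lemma qpoch_neq0 z k :
  (forall j, (j < k)%N -> p ^+ j * z != 1) -> qpoch z p k != 0.
Proof.
move=> H; rewrite /qpoch prodf_seq_neq0; apply/allP => j _ /=.
by rewrite subr_eq0 eq_sym H.
Qed.
Lemma qpoch_eq0 z k j : (j < k)%N -> p ^+ j * z = 1 -> qpoch z p k = 0.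
Proof.
move=> jk e; rewrite /qpoch (bigD1 (Ordinal jk)) //= e subrr mul0r //.
Qed.
End Pochhammer.

Section Racah.
Variables (F : fieldType) (p b c d : F) (N : nat).
Hypothesis p0 : p != 0.
Hypothesis pX : forall j, p ^+ j.+1 != 1.
Hypothesis b0 : b != 0.
Hypothesis c0 : c != 0.
Hypothesis d0 : d != 0.
Hypothesis bN : b * p ^+ N = 1.
Hypothesis cX : forall j, p ^+ j * c != 1.
Hypothesis dX : forall j, p ^+ j * d != 1.

Let pn0 k : p ^+ k != 0. Proof. exact: expf_neq0. Qed.

(** Up to a constant, the Newton polynomial in the variable [grid a s] with nodes [grid a 0], ...,
    [grid a k.-1] (see [tau_grid]). *)
Definition tau (a : F) k s := qpoch (p ^- s) p k * qpoch (a * p ^+ s) p k.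
Definition grid (a : F) s := p ^- s + a * p ^+ s.
Definition rcoef k :=
  p ^+ k / (qpoch b p k * qpoch c p k * qpoch d p k * qpoch p p k).
(** The 4phi3 with its two grids on an equal footing: exchanging [a'] and [a] is the duality of
    degree and variable. Summation runs to N because [tau] vanishes once k exceeds n or s. *)
Definition racah (a' a : F) n s :=
  \sum_(k < N.+1) tau a' k n * tau a k s * rcoef k.

Lemma racahC a' a n s : racah a' a n s = racah a a' s n.
Proof. by apply: eq_bigr => k _; rewrite [tau a' _ _ * _]mulrC. Qed.

Lemma tau0 a s : tau a 0 s = 1.
Proof. by rewrite /tau !qpoch0 mulr1. Qed.

Lemma tau_eq0 a k s : (s < k)%N -> tau a k s = 0.
Proof.
by move=> sk; rewrite /tau (@qpoch_eq0 _ _ (p ^- s) _ _ sk) ?mul0r ?mulfV.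
Qed.

Lemma tauS a k s : tau a k.+1 s =
  tau a k s * ((1 - p ^+ k / p ^+ s) * (1 - a * p ^+ s * p ^+ k)).
Proof. by rewrite /tau !qpochS; ring. Qed.

Lemma tau_grid a k s : tau a k.+1 s = - p ^+ k * (grid a s - grid a k) * tau a k s.
Proof. by rewrite tauS /grid; field; rewrite !pn0. Qed.

Lemma racah0 a' a s : racah a' a 0 s = 1.
Proof.
rewrite /racah big_ord_recl; set t := (\sum_(i < N) _).
have -> : t = 0 by apply: big1 => i _; rewrite [tau a' _ _]tau_eq0 ?mul0r ?mul0r.
by rewrite addr0 /= !tau0 /rcoef !qpoch0 expr0 !mulr1 divr1 mulr1.
Qed.

Lemma bX j : (j < N)%N -> p ^+ j * b != 1.
Proof.
move=> jN; apply/eqP => e; move: bN; rewrite -(subnK (ltnW jN)) exprD.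
rewrite mulrCA [b * _]mulrC e mulr1; apply/eqP.
by have := subn_gt0 j N; rewrite jN; case: (N - j)%N => [//|m _]; exact: pX.
Qed.

Lemma rcoefS k : (k < N)%N -> rcoef k.+1 * ((1 - p ^+ k * b) * (1 - p ^+ k * c)
   * (1 - p ^+ k * d) * (1 - p ^+ k.+1)) = p * rcoef k.
Proof.
move=> kN; rewrite /rcoef !qpochS !exprS.
have H z : (forall j, (j < k.+1)%N -> p ^+ j * z != 1) ->
   (qpoch z p k != 0) * (1 - p ^+ k * z != 0).
  move=> Hz; split; last by rewrite subr_eq0 eq_sym Hz.
  by apply: qpoch_neq0 => j jk; apply: Hz; rewrite ltnW.
have [Hb Hb'] : (qpoch b p k != 0) * (1 - p ^+ k * b != 0).
  by apply: H => j jk; apply: bX; apply: leq_trans kN.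
have [Hc Hc'] := H c (fun j _ => cX j).
have [Hd Hd'] := H d (fun j _ => dX j).
have [Hp Hp'] : (qpoch p p k != 0) * (1 - p ^+ k * p != 0).
  by apply: H => j jk; rewrite -exprSr.
by field; rewrite Hb Hb' Hc Hc' Hd Hd' Hp Hp'.
Qed.

(** * Difference equation, total mass and orthogonality to constants *)

Section Weights.
Variables (a a' : F).
Hypothesis a0 : a != 0.
Hypothesis a'0 : a' != 0.
Hypothesis aX : forall j, p ^+ j * a != 1.
Hypothesis a'X : forall j, p ^+ j * a' != 1.
Hypothesis aa' : a * a' * p = b * c * d.
Hypothesis acX : forall j, (j < N)%N -> p ^+ j * (a * p / c) != 1.
Hypothesis adX : forall j, (j < N)%N -> p ^+ j * (a * p / d) != 1.

(** As 1/a' = a p/(b c d) by [aa'], these are the terms of a terminating very-well-poised 6phi5. *)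
Definition weight s :=
  qpoch b p s * qpoch c p s * qpoch d p s * qpoch a p s
  / (qpoch p p s * qpoch (a * p / b) p s * qpoch (a * p / c) p s
     * qpoch (a * p / d) p s)
  * ((1 - a * p ^+ (2 * s)) / ((1 - a) * a' ^+ s)).

(** With [down], the coefficients of the p-Racah difference equation: birth and death rates for
    which [weight] satisfies detailed balance ([weight_balance]). *)
Definition up s := (1 - b * p ^+ s) * (1 - c * p ^+ s) * (1 - d * p ^+ s)
  * (1 - a * p ^+ s) / ((1 - a * p ^+ (2 * s)) * (1 - a * p ^+ (2 * s).+1)).
Definition down s := a' * (1 - p ^+ s) * (1 - a * p ^+ s / b)
  * (1 - a * p ^+ s / c) * (1 - a * p ^+ s / d)
  / ((1 - a * p ^+ (2 * s) / p) * (1 - a * p ^+ (2 * s))).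
(* The q-difference operator with the p-Racah polynomials as eigenfunctions. *)
Definition qdiff (f : nat -> F) s :=
  up s * (f s.+1 - f s) + down s * (f s.-1 - f s).

Let abX j : p ^+ j * (a * p / b) != 1.
Proof.
have -> : a * p / b = p ^+ N.+1 * a.
  apply: (mulIf b0); rewrite mulfVK // exprSr -[in LHS](mul1r (a * p)) -bN.
  by ring.
by rewrite mulrA -exprD.
Qed.

Let aX1 j : 1 - a * p ^+ j != 0.
Proof. by rewrite subr_eq0 eq_sym mulrC. Qed.

Lemma weight0 : weight 0 = 1.
Proof.
rewrite /weight !qpoch0 !mulr1 divr1 mul1r divff //.
by have := aX1 0; rewrite mulr1.
Qed.

Lemma weight_balance s : (s < N)%N ->
  weight s.+1 * down s.+1 = weight s * up s.
Proof.
move=> sN; rewrite /weight /up /down !qpochS.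
have Hp' : 1 - p ^+ s * p != 0 by rewrite subr_eq0 eq_sym -exprSr.
have Hb' : 1 - p ^+ s * (a * p / b) != 0 by rewrite subr_eq0 eq_sym.
have Hc' : 1 - p ^+ s * (a * p / c) != 0 by rewrite subr_eq0 eq_sym acX.
have Hd' : 1 - p ^+ s * (a * p / d) != 0 by rewrite subr_eq0 eq_sym adX.
have Hp : qpoch p p s != 0 by apply: qpoch_neq0 => j _; rewrite -exprSr.
have Hb : qpoch (a * p / b) p s != 0 by exact: qpoch_neq0.
have Hc : qpoch (a * p / c) p s != 0.
  by apply: qpoch_neq0 => j js; apply: acX; apply: ltn_trans sN.
have Hd : qpoch (a * p / d) p s != 0.
  by apply: qpoch_neq0 => j js; apply: adX; apply: ltn_trans sN.
have A0 : 1 - a != 0 by have := aX1 0; rewrite mulr1.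
have A1 := aX1 (2 * s); have A2 := aX1 (2 * s).+1; have A3 := aX1 (2 * s.+1).
have -> : a * p ^+ (2 * s.+1) / p = a * p ^+ (2 * s).+1.
  by rewrite mulnS addSn exprS mulrA mulrAC mulrK // ?unitfE // exprSr mulrA mulrAC mulfK.
have An : a' ^+ s != 0 by exact: expf_neq0.
have subd z : 1 - p ^+ s * (a * p / z) != 0 -> z != 0 -> z - p ^+ s * (a * p) != 0.
  move=> H z0; have -> : z - p ^+ s * (a * p) = (1 - p ^+ s * (a * p / z)) * z by field.
  exact: mulf_neq0.
have := subd b Hb' b0; have := subd c Hc' c0; have := subd d Hd' d0.
move: A1 A2 A3; rewrite [(2 * s.+1)%N]mulnS !exprS.
set S := p ^+ s; set T := p ^+ (2 * s) => A1 A2 A3 Ed Ec Eb.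
field.
by rewrite A1 A2 A3 Ed Ec Eb An A0 Hp Hb Hc Hd Hp' a'0 b0 c0 d0.
Qed.

Lemma up_last : up N = 0.
Proof. by rewrite /up bN subrr !mul0r. Qed.
Lemma down0 : down 0 = 0.
Proof. by rewrite /down expr0 subrr mulr0 !mul0r. Qed.

(** Detailed balance cancels the flow between s and s+1. Nothing leaks at the ends: [up N] vanishes
    since b p^N = 1, and [down 0] vanishes, which also makes the truncated predecessor of 0
    harmless. *)
Lemma sum_qdiff f : \sum_(s < N.+1) weight s * qdiff f s = 0.
Proof.
under eq_bigr do rewrite /qdiff mulrDr.
rewrite big_split /= big_ord_recr /= up_last mul0r mulr0 addr0.
rewrite [X in _ + X]big_ord_recl /= down0 mul0r mulr0 add0r -big_split /=.
rewrite big1 // => s _; rewrite /bump leq0n add1n add0n mulrA [X in _ + X]mulrA weight_balance //.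
by rewrite -mulrDr -[f s - _]opprB subrr mulr0.
Qed.

Definition eigval k := grid a' k - grid a' 0.
Definition low k := - (p ^- k.+1 * (1 - b * p ^+ k) * (1 - c * p ^+ k)
   * (1 - d * p ^+ k) * (1 - p ^+ k.+1)).

(** In the Newton basis the difference operator is bidiagonal; this one identity yields both the
    eigenvalue equation ([qdiff_racah]) and the moments of the weight ([momentS]). *)
Lemma qdiff_tauS k s : qdiff (tau a k.+1) s =
  eigval k.+1 * tau a k.+1 s + low k * tau a k s.
Proof.
have A0 j : 1 - p ^+ j * a != 0 by rewrite subr_eq0 eq_sym.
have a'E : a' = b * c * d / (a * p) by rewrite -aa'; field; rewrite p0 a0.
have pk := pn0 k; have ps := pn0 s.
(* The values at neighbouring points are written as rational multiples of a value of [tau a k] at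
   the current point, which leaves a rational identity for [field]. *)
have up1 : tau a k.+1 s.+1 = tau a k s * ((1 - (p * p ^+ s)^-1)
    * (1 - a * p ^+ s * p ^+ k) * (1 - a * p ^+ s * p ^+ k * p) / (1 - a * p ^+ s)).
  have e1 : qpoch (p ^- s.+1) p k.+1 = (1 - (p * p ^+ s)^-1) * qpoch (p ^- s) p k.
    by rewrite qpochSl !exprS; congr (_ * qpoch _ _ _); field; rewrite p0 ps.
  have e2 : qpoch (a * p ^+ s.+1) p k.+1 * (1 - a * p ^+ s) = qpoch (a * p ^+ s) p k
       * ((1 - a * p ^+ s * p ^+ k) * (1 - a * p ^+ s * p ^+ k * p)).
    have -> : a * p ^+ s.+1 = a * p ^+ s * p by rewrite exprSr mulrA.
    by rewrite mulrC -qpochSl !qpochS !exprS; ring.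
  rewrite /tau e1; apply: (mulIf (aX1 s)); rewrite -!mulrA e2.
  by field; rewrite aX1 p0 ps.
(* The expression for the left neighbour divides by 1 - p^-s, so s = 0 is separate; there [down]
   vanishes. *)
case: s => [|s] in ps up1 *.
  rewrite /qdiff down0 mul0r addr0; case: k => [|k] in pk up1 *; last first.
    by rewrite up1 !(@tau_eq0 a) // mul0r !mulr0 subrr mulr0 addr0.
  rewrite up1 tauS !tau0 /up /eigval /grid /low !muln0 !expr0 expr1 a'E.
  have := aX1 0; have := aX1 1; rewrite expr0 expr1 mulr1 => H1 H0.
  field.
  by rewrite a0 p0 H0 H1 oner_eq0.
have down1 : tau a k.+1 s = tau a k s.+1 * ((1 - a * p ^+ s)
    * (1 - p ^+ k / (p * p ^+ s)) * (1 - p ^+ k * p / (p * p ^+ s))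
    / (1 - (p * p ^+ s)^-1)).
  have ps1 : 1 - (p * p ^+ s)^-1 != 0.
    by rewrite subr_eq0 eq_sym -exprS invr_eq1.
  have e1 : (1 - (p * p ^+ s)^-1) * qpoch (p ^- s) p k.+1
     = qpoch (p ^- s.+1) p k * ((1 - p ^+ k / (p * p ^+ s))
         * (1 - p ^+ k * p / (p * p ^+ s))).
    have -> : p ^- s = p ^- s.+1 * p by rewrite exprS; field; rewrite p0 pn0.
    by rewrite -{1}exprS -qpochSl !qpochS !exprS; ring.
  have e2 : qpoch (a * p ^+ s) p k.+1 = (1 - a * p ^+ s) * qpoch (a * p ^+ s.+1) p k.
    by rewrite qpochSl exprSr mulrA.
  rewrite /tau e2; apply: (mulfI ps1); rewrite mulrA e1.
  by move: ps1; set x := p ^+ k / _; set y := _ * p / _; set z := _^-1 => ps1; field.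
rewrite /qdiff up1 /= down1 !tauS /up /down /eigval /grid /low a'E.
have : 1 - (p * p ^+ s)^-1 != 0 by rewrite subr_eq0 eq_sym -exprS invr_eq1.
have := aX1 (2 * s.+1); have := aX1 (2 * s.+1).+1; have := aX1 (2 * s).+1.
have := aX1 s.+1; have := aX1 s.
rewrite mul2n -addnn mul2n -addnn !(exprS, exprD, addSn, addnS).
move: (tau a k s.+1) => t; move: pk (pn0 s).
rewrite !expr0; set S := p ^+ s; set X := p ^+ k => X0 S0 H1 H2 H3 H4 H5 H6.
have H7 : p * S - 1 != 0 by rewrite -exprS subr_eq0.
field.
by rewrite X0 S0 p0 a0 b0 c0 d0 H2 H4 H5 H7 [S * (p * S)]mulrCA H3 oner_eq0.
Qed.

Lemma qdiff_tau0 s : qdiff (tau a 0) s = 0.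
Proof. by rewrite /qdiff !tau0 subrr !mulr0 addr0. Qed.

Lemma qdiff_sum (f : nat -> nat -> F) s :
  qdiff (fun s => \sum_(k < N.+1) f k s) s = \sum_(k < N.+1) qdiff (f k) s.
Proof. by rewrite /qdiff big_split /= -!mulr_sumr !sumrB. Qed.

Lemma qdiff_scale (g : F) (f : nat -> F) s :
  qdiff (fun s => g * f s) s = g * qdiff f s.
Proof. by rewrite /qdiff; ring. Qed.

Lemma qdiff_ext (f g : nat -> F) s : f =1 g -> qdiff f s = qdiff g s.
Proof. by move=> fg; rewrite /qdiff !fg. Qed.

Lemma low_rcoef k : (k < N)%N -> low k * rcoef k.+1 = - p ^- k * rcoef k.
Proof.
move=> kN; have := rcoefS kN; rewrite /low.
set u := rcoef k.+1; set v := rcoef k => e.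
apply: (mulfI p0); rewrite [RHS]mulrCA -e !exprS; field; rewrite p0 pn0 //.
Qed.

(** By [tau_grid] in the degree variable and [low_rcoef], the term that lowers k+1 to k has
    coefficient [eigval m - eigval k]. Added to the diagonal [eigval k], it leaves [eigval m] for
    every k. *)
Lemma qdiff_racah m s : (m <= N)%N ->
  qdiff (racah a' a m) s = eigval m * racah a' a m s.
Proof.
move=> mN; rewrite (@qdiff_ext _ (fun s =>
  \sum_(k < N.+1) (tau a' k m * rcoef k) * tau a k s)); last first.
  by move=> z; apply: eq_bigr => k _; rewrite mulrAC.
rewrite (qdiff_sum (fun k s => (tau a' k m * rcoef k) * tau a k s)).
rewrite big_ord_recl /= qdiff_scale qdiff_tau0 mulr0 add0r.
rewrite (eq_bigr (fun i : 'I_N =>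
   tau a' i.+1 m * rcoef i.+1 * (eigval i.+1 * tau a i.+1 s)
   + tau a' i.+1 m * rcoef i.+1 * (low i * tau a i s))); last first.
  by move=> i _; rewrite qdiff_scale -[bump 0 i]/(i.+1) qdiff_tauS mulrDr.
rewrite big_split /=.
pose g k := tau a' k m * rcoef k * (eigval k * tau a k s).
have -> : \sum_(i < N) tau a' i.+1 m * rcoef i.+1 * (eigval i.+1 * tau a i.+1 s)
    = \sum_(k < N.+1) g k.
  rewrite big_ord_recl {1}/g /eigval subrr mul0r mulr0 add0r.
  by [].
(* The sum may be extended to k = N: either m < N and [tau a' N m] vanishes, or m = N and the
   eigenvalue difference does. *)
pose g' k := tau a' k m * rcoef k * ((eigval m - eigval k) * tau a k s).
have -> : \sum_(i < N) tau a' i.+1 m * rcoef i.+1 * (low i * tau a i s)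
    = \sum_(k < N.+1) g' k.
  rewrite big_ord_recr /=.
  have -> : g' N = 0.
    rewrite /g'; case: (ltnP m N) => mN'; first by rewrite tau_eq0 ?mul0r.
    by have -> : m = N; [apply/eqP; rewrite eqn_leq mN | rewrite subrr mul0r mulr0].
  rewrite addr0; apply: eq_bigr => i _; rewrite /g' tau_grid.
  have -> : eigval m - eigval i = grid a' m - grid a' i.
    by rewrite /eigval opprB addrA subrK.
  have := low_rcoef (ltn_ord i); set u := rcoef _; set v := rcoef _ => e.
  have pi := pn0 i.
  transitivity (- p ^+ i * (grid a' m - grid a' i) * tau a' i m * tau a i s * (low i * u)).
    by ring.
  by rewrite e; field.
rewrite -big_split /= mulr_sumr; apply: eq_bigr => k _.
by rewrite /g /g'; ring.
Qed.

(** Summing the eigenvalue equation against the weight gives [eigval m] times the sum equal to zero,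
    and [eigval m] is nonzero for m > 0. *)
Lemma sum_weight_racah m : (0 < m)%N -> (m <= N)%N ->
  \sum_(s < N.+1) weight s * racah a' a m s = 0.
Proof.
case: m => // m _ mN; have := sum_qdiff (racah a' a m.+1).
under eq_bigr do rewrite qdiff_racah // mulrCA.
rewrite -mulr_sumr => /eqP; rewrite mulf_eq0 => /orP [|/eqP //].
have -> : eigval m.+1 = p ^- m.+1 * (1 - p ^+ m.+1) * (1 - p ^+ m.+1 * a').
  rewrite /eigval /grid !expr0; field; rewrite pn0 oner_eq0 //.
rewrite !mulf_eq0 invr_eq0 (negbTE (pn0 _)) !subr_eq0 ![1 == _]eq_sym.
by rewrite (negbTE (pX _)) (negbTE (a'X _)).
Qed.

Definition moment k := \sum_(s < N.+1) weight s * tau a k s.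

(** [qdiff_tauS] summed against the weight, where the left side vanishes by [sum_qdiff]. *)
Lemma momentS k : moment k.+1 * (1 - p ^+ k * (a' * p)) =
  (1 - p ^+ k * b) * (1 - p ^+ k * c) * (1 - p ^+ k * d) * moment k.
Proof.
have := sum_qdiff (tau a k.+1).
under eq_bigr do rewrite qdiff_tauS mulrDr mulrCA [weight _ * (low _ * _)]mulrCA.
rewrite big_split /= -!mulr_sumr -/(moment k) -/(moment k.+1) => e.
have pk : p ^- k.+1 * (1 - p ^+ k.+1) != 0.
  by rewrite mulf_neq0 ?invr_eq0 // subr_eq0 eq_sym.
apply: (mulfI pk).
have -> : p ^- k.+1 * (1 - p ^+ k.+1) * (moment k.+1 * (1 - p ^+ k * (a' * p)))
   = eigval k.+1 * moment k.+1.
  rewrite /eigval /grid !expr0 !exprS; field; rewrite p0 pn0 oner_eq0 //.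
move/eqP: e; rewrite addr_eq0 => /eqP ->; rewrite /low; ring.
Qed.

Lemma moment_prod k : moment k * qpoch (a' * p) p k =
  qpoch b p k * qpoch c p k * qpoch d p k * moment 0.
Proof.
elim: k => [|k IH]; first by rewrite !qpoch0 !mulr1 mul1r.
have e := momentS k; rewrite !qpochS.
transitivity (moment k.+1 * (1 - p ^+ k * (a' * p)) * qpoch (a' * p) p k); first by ring.
rewrite e; transitivity ((1 - p ^+ k * b) * (1 - p ^+ k * c) * (1 - p ^+ k * d)
  * (moment k * qpoch (a' * p) p k)); first by ring.
by rewrite IH; ring.
Qed.

Lemma moment_last : moment N = weight N * tau a N N.
Proof.
rewrite /moment big_ord_recr /= big1 ?add0r // => s _.
by rewrite tau_eq0 ?mulr0.
Qed.

Definition mass := qpoch (a * p / (c * d)) p N * qpoch (a * p) p N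
  / (qpoch (a * p / c) p N * qpoch (a * p / d) p N).

Lemma qpoch_rev z k : z != 0 ->
  qpoch (z * p ^- k) p k = (- z) ^+ k * (\prod_(j < k) p ^- j.+1) * qpoch (p / z) p k.
Proof.
move=> z0; rewrite /qpoch (reindex_inj rev_ord_inj) /=.
rewrite -[k in (- z) ^+ k]card_ord -prodr_const -!big_split /=.
apply: eq_bigr => i _; have ik := ltn_ord i.
have -> : p ^+ k = p ^+ (k - i.+1) * p ^+ i.+1 by rewrite -exprD subnK.
by rewrite exprS; field; rewrite z0 p0 !pn0.
Qed.

(** The terminating very-well-poised 6phi5 summation. Among the grid points [tau a N] is nonzero at
    most at s = N, so the N-th moment is a single term, and the first-order recursion for moments
    leads from it down to the total mass. *)
Lemma massE : \sum_(s < N.+1) weight s = mass.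
Proof.
have -> : \sum_(s < N.+1) weight s = moment 0.
  by apply: eq_bigr => s _; rewrite tau0 mulr1.
have Hb : qpoch b p N != 0 by apply: qpoch_neq0 => j; exact: bX.
have Hc : qpoch c p N != 0 by exact: qpoch_neq0.
have Hd : qpoch d p N != 0 by exact: qpoch_neq0.
have HC : qpoch (a * p / c) p N != 0 by exact: qpoch_neq0.
have HD : qpoch (a * p / d) p N != 0 by exact: qpoch_neq0.
have Hp : qpoch p p N != 0 by apply: qpoch_neq0 => j _; rewrite -exprSr.
have HB : qpoch (a * p / b) p N != 0 by exact: qpoch_neq0.
have A0 : 1 - a != 0 by have := aX1 0; rewrite mulr1.
have H3 : qpoch b p N * qpoch c p N * qpoch d p N != 0 by rewrite !mulf_neq0.
apply: (mulfI H3); rewrite -moment_prod moment_last /weight /tau /mass.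
have bE : b = p ^- N by rewrite -[b]mulr1 -(mulfV (pn0 N)) mulrA bN mul1r.
have e1 : qpoch (p ^- N) p N = (-1) ^+ N * (\prod_(j < N) p ^- j.+1) * qpoch p p N.
  by have := @qpoch_rev 1 N (oner_neq0 _); rewrite mul1r divr1.
have z0 : c * d / a != 0 by rewrite !mulf_neq0 ?invr_eq0.
have e2 : qpoch (a' * p) p N = (- (c * d / a)) ^+ N * (\prod_(j < N) p ^- j.+1)
    * qpoch (a * p / (c * d)) p N.
  have -> : a' * p = (c * d / a) * p ^- N.
    by apply: (mulfI a0); rewrite mulrA aa' bE; field; rewrite a0 pn0.
  rewrite qpoch_rev //; congr (_ * qpoch _ _ _); field.
  by rewrite a0 c0 d0.
have abE : a * p / b = p ^+ N * (a * p).
  by apply: (mulIf b0); rewrite mulfVK // mulrAC [_ ^+ _ * b]mulrC bN mul1r.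
(* Both sides are the product (a;p)_(2N+1), cut in two ways; on the right a p/b = a p^(N+1). *)
have e3 : qpoch (a * p ^+ N) p N * (1 - a * p ^+ (2 * N)) * qpoch a p N
    = qpoch (a * p) p N * qpoch (a * p / b) p N * (1 - a).
  rewrite abE; transitivity (qpoch a p (N + N).+1).
    rewrite qpochS mul2n -addnn [p ^+ (N + N) * a]mulrC mulrAC; congr (_ * _).
    rewrite /qpoch big_split_ord /= mulrC; congr (_ * _).
    by apply: eq_bigr => i _; rewrite exprD; congr (1 - _); ring.
  rewrite qpochSl mulrC; congr (_ * _); rewrite /qpoch big_split_ord /=; congr (_ * _).
  by apply: eq_bigr => i _; rewrite exprD; congr (1 - _); ring.
(* Pairing j with N-1-j, each pair of factors is p^-(N+1). *)
have e4 : (\prod_(j < N) p ^- j.+1) * (\prod_(j < N) p ^- j.+1) * (p * p ^+ N) ^+ N = 1.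
  rewrite {2}(reindex_inj rev_ord_inj) /= -[N in _ ^+ N]card_ord -prodr_const.
  rewrite -!big_split /= big1 // => i _.
  have -> : p ^+ N = p ^+ (N - i.+1) * p ^+ i.+1 by rewrite -exprD subnK.
  by rewrite !exprS; field; rewrite p0 !pn0.
have e5 : (-1) ^+ N * (- (c * d / a)) ^+ N = a' ^+ N * (p * p ^+ N) ^+ N.
  rewrite -!exprMn; congr (_ ^+ N).
  have -> : a' = b * c * d / (a * p) by rewrite -aa'; field; rewrite p0 a0.
  by rewrite bE; field; rewrite a0 p0 pn0.
have An : a' ^+ N != 0 by exact: expf_neq0.
rewrite e1 e2; move: e3 e4 e5 An.
set G := \prod_(j < N) _; set q1 := qpoch (a * p ^+ N) p N.
set u := (-1) ^+ N; set v := (- _) ^+ N; set w := a' ^+ N; set r := (p * _) ^+ N.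
move=> e3 e4 e5 An.
transitivity (qpoch b p N * qpoch c p N * qpoch d p N
  / (qpoch (a * p / b) p N * qpoch (a * p / c) p N * qpoch (a * p / d) p N * (1 - a))
  * qpoch (a * p / (c * d)) p N * (q1 * (1 - a * p ^+ (2 * N)) * qpoch a p N)
  * (u * v / w * G * G)).
  by field; rewrite An A0 HD HC HB Hp.
rewrite e3 e5; transitivity (qpoch b p N * qpoch c p N * qpoch d p N
  / (qpoch (a * p / c) p N * qpoch (a * p / d) p N)
  * qpoch (a * p / (c * d)) p N * qpoch (a * p) p N * (G * G * r)).
  by field; rewrite An A0 HD HC HB.
by rewrite e4 mulr1; field; rewrite HC HD.
Qed.

Lemma racah_orth0 m : (m <= N)%N ->
  \sum_(s < N.+1) weight s * racah a' a m s = mass * (m == 0%N)%:R.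
Proof.
case: m => [_|m mN]; last by rewrite sum_weight_racah // mulr0.
by rewrite mulr1 -massE; apply: eq_bigr => s _; rewrite racah0 mulr1.
Qed.

End Weights.

(** * The split basis in coordinates *)

Section Split.
Variables (a a' : F).
Hypothesis aa' : a * a' * p = b * c * d.

(** The rescaled subdiagonal entry of Q^(12) from coordinate i-1 to i. The factors in p^i come from
    [sigma] of the first tensor factor at i, those in p^(N+1-i) from [sigma] of the third
    ([hop_sigma]). *)
Definition hop i := d / p * p ^- N * (1 - p ^+ i) * (1 - a' / d * p ^+ i)
  * (1 - p ^+ (N.+1 - i)) * (1 - a / d * p ^+ (N.+1 - i)).
(** The split sequence of the Leonard pair. Its reciprocals produce the coefficients of the 4phi3
    ([racah_term]). *)
Definition phi k := p * p ^- k * p ^- k * (1 - b * p ^+ k / p)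
  * (1 - c * p ^+ k / p) * (1 - d * p ^+ k / p) * (1 - p ^+ k).
Definition scoef k := \prod_(l < k) ((1 - c * p ^+ l) * (1 - d * p ^+ l) * p ^- l).
Definition stri k i := \prod_(l < k) (p ^+ l / p ^+ i - 1).
Definition supc t := \prod_(j < t) (1 - a * p ^+ N / p ^+ j).
(* Coordinates of the k-th vector of a basis in which both Casimirs are bidiagonal. *)
Definition splitc k i := scoef k * stri k i * qpoch b p i * supc (i - k).

Lemma striS k i : stri k.+1 i = stri k i * (p ^+ k / p ^+ i - 1).
Proof. by rewrite /stri big_ord_recr. Qed.
Lemma striSS k i : stri k.+1 i.+1 = (p ^- i.+1 - 1) * stri k i.
Proof.
rewrite /stri big_ord_recl /= expr0 mul1r; congr (_ * _); apply: eq_bigr => l _.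
by rewrite /bump leq0n add1n !exprS; congr (_ - 1); field; rewrite p0 pn0.
Qed.
Lemma stri_eq0 k i : (i < k)%N -> stri k i = 0.
Proof.
by move=> ik; rewrite /stri (bigD1 (Ordinal ik)) //= divff // subrr mul0r.
Qed.
Lemma stri_shift k i : (p ^- i.+1 - 1) * stri k i = stri k i.+1 * (p ^+ k / p ^+ i.+1 - 1).
Proof. by rewrite -striSS striS. Qed.
Lemma supcS t : supc t.+1 = supc t * (1 - a * p ^+ N / p ^+ t).
Proof. by rewrite /supc big_ord_recr. Qed.
Lemma scoefS k : scoef k.+1 = scoef k * ((1 - c * p ^+ k) * (1 - d * p ^+ k) * p ^- k).
Proof. by rewrite /scoef big_ord_recr. Qed.

Hypothesis a0 : a != 0.
Let a'E : a' = b * c * d / (a * p).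
Proof. by rewrite -aa'; field; rewrite p0 a0. Qed.
Let bE : b = (p ^+ N)^-1.
Proof. by rewrite -[b]mulr1 -(mulfV (pn0 N)) mulrA bN mul1r. Qed.

Lemma splitc_eq0 k i : (i < k)%N -> splitc k i = 0.
Proof. by move=> ik; rewrite /splitc stri_eq0 // mulr0 !mul0r. Qed.

(** Read as a recursion in k, this constructs vector k+1 by applying the lower bidiagonal operator
    minus [grid a' k] to vector k. Below the diagonal both sides vanish; above it the claim reduces
    to [stri_shift]. *)
Lemma splitc_raise k i : (i < N.+1)%N ->
  grid a' i * splitc k i + (if i is i'.+1 then hop i * splitc k i' else 0)
  = grid a' k * splitc k i + splitc k.+1 i.
Proof.
move=> iN; case: (ltngtP i k) => [ik|ki|<-]; last first.
- rewrite (@splitc_eq0 i.+1) // addr0; case: i iN => [|i] iN; first by rewrite addr0.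
  by rewrite (@splitc_eq0 i.+1 i) // mulr0 addr0.
- case: i iN ki => // i iN; rewrite ltnS => ki.
  have it : i = (k + (i - k))%N by rewrite subnKC.
  rewrite /splitc subSn // subSS; set t := (i - k)%N in it *.
  have pi : p ^+ i = p ^+ k * p ^+ t by rewrite {1}it exprD.
  have pNi : p ^+ (N.+1 - i.+1) = p ^+ N / (p ^+ k * p ^+ t).
    by apply: (mulIf (pn0 i)); rewrite -pi mulfVK // subSS -exprD subnK //; exact: ltnW.
  have := stri_shift k i; rewrite exprS pi => es.
  rewrite qpochS supcS scoefS striS /hop pNi exprS pi.
  set s1 := stri k i.+1 in es *; set s0 := stri k i in es *.
  move: (pn0 k) (pn0 t) (pn0 N) a'E bE es.
  rewrite /grid exprS pi; set X := p ^+ k; set T := p ^+ t; set P := p ^+ N.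
  move=> X0 T0 P0 -> bE' es.
  (* The two values of [stri] are opaque to [field], so the relation between them is substituted by
     hand, after isolating the factor in which it occurs. *)
  have es' : (1 - p * (X * T)) * s0 = p * (X * T) * (s1 * (X / (p * (X * T)) - 1)).
    by rewrite -es; field; rewrite p0 X0 T0.
  transitivity (scoef k * qpoch b p i * supc t *
    (((p * (X * T))^-1 + b * c * d / (a * p) * (p * (X * T))) * s1
       * (1 - X * T * b) * (1 - a * P / T)
     + d / p * P^-1 * (1 - b * c * d / (a * p) / d * (p * (X * T)))
       * (1 - P / (X * T)) * (1 - a / d * (P / (X * T)))
       * ((1 - p * (X * T)) * s0))); first by ring.
  by rewrite es' bE'; field; rewrite p0 a0 d0 X0 T0 P0.
- have -> : splitc k i = 0 by exact: splitc_eq0.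
  have -> : splitc k.+1 i = 0 by apply: splitc_eq0; exact: ltnW.
  rewrite !mulr0 !add0r; case: i iN ik => // i _ ik.
  by rewrite splitc_eq0 ?mulr0 // ltnW.
Qed.

(** For k = 0 this says that vector 0 is an eigenvector of the upper bidiagonal operator. The
    diagonal runs over [grid a (N - i)] because the third factor sits at N-i when the first sits at
    i. *)
Lemma splitc_lower k i : (i < N.+1)%N ->
  grid a (N - i) * splitc k i + (if (i < N)%N then splitc k i.+1 else 0)
  = grid a k * splitc k i + (if k is k'.+1 then phi k * splitc k' i else 0).
Proof.
(* The cutoff at i = N takes care of itself: coordinate N+1 contains (b;p)_(N+1), which is zero
   since b p^N = 1. *)
move=> iN; have -> : (if (i < N)%N then splitc k i.+1 else 0) = splitc k i.+1.
  case: ltnP => // Ni; have -> : i = N by apply/eqP; rewrite eqn_leq Ni andbT.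
  by rewrite /splitc (@qpoch_eq0 _ p b N.+1 N) ?mulr0 ?mul0r // mulrC.
have pNi : p ^+ (N - i) = p ^+ N / p ^+ i.
  by apply: (mulIf (pn0 i)); rewrite -exprD subnK // mulfVK.
rewrite {1}/grid pNi.
case: k => [|k].
  rewrite /splitc /scoef /stri !big_ord0 !subn0 qpochS supcS /grid !expr0 bE.
  by field; rewrite !pn0 oner_eq0.
case: (ltngtP i k) => [ik|ki|ik].
- by rewrite !splitc_eq0 ?mulr0 // ltnW.
- have it : i = (k + (i - k.+1)).+1 by rewrite -addSn subnKC.
  rewrite /splitc; have -> : (i.+1 - k.+1 = (i - k.+1).+1)%N by rewrite subSn.
  have -> : (i - k = (i - k.+1).+1)%N by rewrite -subSn // subSS.
  set t := (i - k.+1)%N in it *.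
  have pi : p ^+ i = p * (p ^+ k * p ^+ t) by rewrite {1}it exprS exprD.
  rewrite striSS striS qpochS supcS scoefS /phi /grid !exprS pi bE.
  move: (pn0 k) (pn0 t) (pn0 N); set X := p ^+ k; set T := p ^+ t; set P := p ^+ N.
  by move=> X0 T0 P0; field; rewrite p0 X0 T0 P0.
- rewrite ik (@splitc_eq0 k.+1 k) // !mulr0 !add0r /splitc !subnn striSS qpochS scoefS /phi.
  by rewrite !exprS; field; rewrite p0 pn0.
Qed.
End Split.
End Racah.

(** * Translation from alpha, beta, gamma, delta to the symmetric parameters *)

Section RacahParams.
Variables (F : fieldType) (p alpha beta gamma delta : F) (N : nat).
Hypothesis p0 : p != 0.
Hypothesis be0 : beta != 0.
Hypothesis ga0 : gamma != 0.
Hypothesis de0 : delta != 0.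
Hypothesis alN : alpha * p * p ^+ N = 1.

Local Notation a := (gamma * delta * p).
Local Notation a' := (alpha * beta * p).
Local Notation b := (alpha * p).
Local Notation c := (beta * delta * p).
Local Notation d := (gamma * p).

Let al0 : alpha != 0.
Proof.
apply: contra_eq_neq alN => ->.
by rewrite !mul0r eq_sym oner_neq0.
Qed.

(** The series is balanced: its lower parameters multiply to p times the product of its upper
    ones. *)
Lemma param_prod : a * a' * p = b * c * d.
Proof. by ring. Qed.

Lemma qpochs4 x y z t s :
  qpochs [:: x; y; z; t] p s = qpoch x p s * (qpoch y p s * (qpoch z p s * qpoch t p s)).
Proof. by rewrite /qpochs !big_cons big_nil mulr1. Qed.

Lemma pRacah_racah n s : (n <= N)%N -> (s <= N)%N ->
  pRacah n s alpha beta gamma delta p = racah p b c d N a' a n s.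
Proof.
move=> nN sN; rewrite /pRacah /phi43 /racah.
have Ms : (minn n s < N.+1)%N by rewrite ltnS geq_min nN.
pose f k := qpochs [:: p ^- n; alpha * beta * p ^+ n.+1; p ^- s;
  gamma * delta * p ^+ s.+1] p k / qpochs [:: b; c; d] p k * (p ^+ k / qpoch p p k).
rewrite (big_ord_widen N.+1 f) // big_mkcond /=; apply: eq_bigr => k _.
have fE : f k = tau p a' k n * tau p a k s * rcoef p b c d k.
  rewrite /f qpochs4 /qpochs !big_cons big_nil mulr1 /tau /rcoef !exprS.
  rewrite [alpha * beta * (p * _)]mulrA [gamma * delta * (p * _)]mulrA.
  by rewrite !invfM; ring.
rewrite fE ltnS leq_min; case: leqP => nk /=; last by rewrite tau_eq0 // !mul0r.
by case: leqP => sk //=; rewrite [tau p a k s]tau_eq0 // mulr0 mul0r.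
Qed.

Lemma Omega_weight s : Omega s alpha beta gamma delta p = weight p b c d a a' s.
Proof.
rewrite /Omega /weight !qpochs4 exprS.
have -> : a * p / b = alpha^-1 * gamma * delta * p by field; rewrite al0 p0.
have -> : a * p / c = beta^-1 * gamma * p by field; rewrite be0 p0 de0.
have -> : a * p / d = delta * p by field; rewrite ga0 p0.
rewrite !invfM !mulrA; ring.
Qed.

(** By duality the norm of R_n is the total mass divided by the weight with [a] and [a']
    exchanged. *)
Lemma hnorm_weight n : hnorm N n alpha beta gamma delta p =
  mass p c d N a / weight p b c d a' a n.
Proof.
have bE : b = p ^- N by rewrite -[b]mulr1 -(mulfV (expf_neq0 N p0)) mulrA alN mul1r.
rewrite /hnorm /mass /weight /qpochs !big_cons !big_nil !mulr1.
have -> : a * p / (c * d) = beta^-1 by field; rewrite be0 p0 de0 ga0.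
have -> : a * p / c = beta^-1 * gamma * p by field; rewrite be0 p0 de0.
have -> : a * p / d = delta * p by field; rewrite ga0 p0.
have -> : a * p = gamma * delta * p ^+ 2 by ring.
have -> : a' * p / b = beta * p by field; rewrite al0 p0.
have -> : a' * p / c = delta^-1 * p ^- N by rewrite -bE; field; rewrite be0 de0 p0.
have -> : a' * p / d = beta * gamma^-1 * p ^- N by rewrite -bE; field; rewrite ga0 p0.
have -> : a' = beta * p ^- N by rewrite -bE; ring.
rewrite bE.
have -> : p ^ ((2 * n)%:Z - N%:Z) = p ^+ (2 * n) * p ^- N.
  by rewrite expfzDr // -exprnN.
have -> : beta / p ^+ N * p ^+ (2 * n) = beta * (p ^+ (2 * n) / p ^+ N) by ring.
move: (_ / (qpoch (beta^-1 * gamma * p) p N * _)) => u.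
move: (1 - beta / p ^+ N) (1 - beta * (p ^+ (2 * n) / _)) => v w.
rewrite !(invfM, invrK); ring.
Qed.
End RacahParams.

(** * Overlaps of two operators bidiagonal in a common basis *)

Section Span.
Variables (C : numClosedFieldType) (V : lmodType C) (ip : V -> V -> C).
Hypothesis Hip : is_inner ip.
Variable VN : V -> Prop.
Hypothesis VN_lin : forall c u v, VN u -> VN v -> VN (c *: u + v).
Hypothesis VN0 : VN 0.
Variables (N : nat) (co : nat -> V -> C).
Hypothesis co_lin : forall i, functional (co i).
Hypothesis co_inj : forall w, VN w -> (forall i, (i <= N)%N -> co i w = 0) -> w = 0.

Lemma VN_comb (r : 'I_N.+1 -> C) (e : 'I_N.+1 -> V) :
  (forall t, VN (e t)) -> VN (\sum_t r t *: e t).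
Proof.
move=> eV; elim/big_rec: _ => [|t w _ wV]; first exact: VN0.
exact: VN_lin.
Qed.

Lemma co_comb (r : 'I_N.+1 -> C) (e : 'I_N.+1 -> V) i :
  co i (\sum_t r t *: e t) = \sum_t r t * co i (e t).
Proof.
have co0 : co i 0 = 0 by rewrite -(scale0r 0) (funZ (co_lin i)) mul0r.
rewrite (big_morph (co i) (funD (co_lin i)) co0).
by apply: eq_bigr => t _; rewrite (funZ (co_lin i)).
Qed.

(** A dimension count without a subspace type: [co_inj] embeds [VN] into C^(N+1), the coordinate
    rows of N+1 orthonormal vectors are independent, so their matrix is invertible and the vectors
    span. *)
Lemma orthonormal_expansion (e : 'I_N.+1 -> V) w :
  (forall t, VN (e t)) -> (forall t t', ip (e t) (e t') = (t == t')%:R) ->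
  VN w -> w = \sum_t ip (e t) w *: e t.
Proof.
move=> eV eO wV.
have ipc (r : 'I_N.+1 -> C) t : ip (e t) (\sum_t r t *: e t) = r t.
  rewrite (ip_sumr Hip) (bigD1 t) //= (ipZr Hip) eO eqxx mulr1 big1 ?addr0 // => t' t't.
  by rewrite (ipZr Hip) eO eq_sym (negbTE t't) mulr0.
pose M := \matrix_(t < N.+1, i < N.+1) co i (e t).
have MU : row_free M.
  apply: inj_row_free => r rM.
  have r0 : \sum_t r 0 t *: e t = 0.
    apply: co_inj => [|i iN]; first exact: VN_comb.
    rewrite co_comb; have := congr1 (fun A : 'rV_N.+1 => A 0 (Ordinal (iN : (i < N.+1)%N))) rM.
    by rewrite !mxE => {2}<-; apply: eq_bigr => t _; rewrite mxE.
  by apply/rowP => t; rewrite mxE -[LHS](ipc (r 0)) r0 (ip0r Hip).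
have {}MU : M \in unitmx by rewrite -row_free_unit.
pose r := (\row_i co i w) *m invmx M.
have wE : w = \sum_t r 0 t *: e t.
  apply/eqP; rewrite -subr_eq0; apply/eqP; apply: co_inj => [|i iN].
    by rewrite addrC -scaleN1r; apply: VN_lin => //; exact: VN_comb.
  rewrite (funD (co_lin i)) (funN (co_lin i)) co_comb.
  have : r *m M = \row_i co i w by rewrite mulmxKV.
  move/(congr1 (fun A : 'rV_N.+1 => A 0 (Ordinal (iN : (i < N.+1)%N)))).
  rewrite !mxE /= => <-; apply/eqP; rewrite subr_eq0; apply/eqP.
  by apply: eq_bigr => t _; rewrite [M _ _]mxE.
rewrite {1}wE; apply: eq_bigr => t _; congr (_ *: _).
by rewrite wE ipc.
Qed.
End Span.

(** * Distinctness of grid nodes and the product form of the series terms *)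

Section GridFacts.
Variables (F : fieldType) (p b c d : F) (N : nat).
Hypothesis p0 : p != 0.
Hypothesis pX : forall j, p ^+ j.+1 != 1.
Hypothesis bN : b * p ^+ N = 1.
Hypothesis cX : forall j, p ^+ j * c != 1.
Hypothesis dX : forall j, p ^+ j * d != 1.

(** The difference of two nodes factors, up to powers of p, as (1 - p^(j-i)) (1 - a p^(i+j)). *)
Lemma grid_inj a i j : (forall j, p ^+ j * a != 1) -> grid p a i = grid p a j -> i = j.
Proof.
move=> aX; wlog ij : i j / (i <= j)%N => [H e|].
  by case/orP: (leq_total i j) => ij; [apply: H | apply/esym/H].
rewrite leq_eqVlt in ij; case/orP: ij => [/eqP //|ij] e; exfalso.
have jE : j = ((j - i.+1).+1 + i)%N by rewrite addSnnS subnK.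
have pi := expf_neq0 i p0; have pj := expf_neq0 (j - i.+1).+1 p0.
have : p ^- i * (1 - p ^+ (j - i.+1).+1) * (1 - p ^+ (i + j) * a) = 0.
  have -> : 0 = - ((grid p a i - grid p a j) * p ^+ (j - i.+1).+1).
    by rewrite e subrr mul0r oppr0.
  have pjE : p ^+ j = p ^+ (j - i.+1).+1 * p ^+ i by rewrite -exprD -jE.
  by rewrite exprD /grid pjE; field; rewrite pi pj.
apply/eqP; rewrite !mulf_neq0 ?invr_eq0 // subr_eq0 eq_sym.
  exact: pX.
exact: aX.
Qed.

Lemma phi_neq0 k : (k < N)%N -> phi p b c d k.+1 != 0.
Proof.
move=> kN; have e z : z * p ^+ k.+1 / p = p ^+ k * z by rewrite exprS; field.
rewrite /phi !e !mulf_neq0 ?invr_eq0 ?expf_neq0 //.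
all: by rewrite subr_eq0 eq_sym ?(bX pX bN kN).
Qed.

(** The form in which the overlaps arise: the eigenvector of one operator contributes the factors in
    [a'], that of the other the factors in [a] divided by [phi]. *)
Lemma racah_term a a' n s k : (k <= N)%N ->
  tau p a' k n * tau p a k s * rcoef p b c d k =
  \prod_(i < k) ((grid p a' n - grid p a' i) * (grid p a s - grid p a i)
     / phi p b c d i.+1).
Proof.
elim: k => [|k IH] kN; first by rewrite big_ord0 !tau0 /rcoef !qpoch0 expr0 !mulr1 divr1 mulr1.
rewrite big_ord_recr /= -IH ?(ltnW kN) // !tau_grid //.
have ph := phi_neq0 kN; have e := @rcoefS _ _ _ _ _ _ pX bN cX dX _ kN.
have pk := expf_neq0 k p0.
have phE : phi p b c d k.+1 * (p * p ^+ k * p ^+ k) = 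
  ((1 - p ^+ k * b) * (1 - p ^+ k * c) * (1 - p ^+ k * d) * (1 - p ^+ k.+1)).
  by rewrite /phi !exprS; field; rewrite p0 pk.
apply: (mulIf ph); apply: (mulIf p0).
transitivity (tau p a' k n * tau p a k s * (grid p a' n - grid p a' k)
   * (grid p a s - grid p a k) * (rcoef p b c d k.+1
   * (phi p b c d k.+1 * (p * p ^+ k * p ^+ k)))); first by ring.
rewrite phE e; field; exact: ph.
Qed.
End GridFacts.

(** * Overlaps for an abstract pair of operators in split form *)

Section LeonardPair.
Variables (R : realType) (C : numClosedFieldType) (io : {rmorphism R -> C}).
Hypothesis io_conj : forall x, (io x)^* = io x.
Hypothesis io_ge0 : forall x, (0 <= io x) = (0 <= x).
Local Notation "x %:C" := (io x) (format "x %:C").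

Variables (V : lmodType C) (ip : V -> V -> C).
Hypothesis Hip : is_inner ip.
Variable VN : V -> Prop.
Hypothesis VN_lin : forall c u v, VN u -> VN v -> VN (c *: u + v).
Hypothesis VN0 : VN 0.
Variables (N : nat) (co : nat -> V -> C).
Hypothesis co_lin : forall i, functional (co i).
Hypothesis co_inj : forall w, VN w -> (forall i, (i <= N)%N -> co i w = 0) -> w = 0.

Variables (p b c d a a' X0 Y0 : R).
Hypothesis p0 : p != 0.
Hypothesis pX : forall j, p ^+ j.+1 != 1.
Hypothesis b0 : b != 0.
Hypothesis c0 : c != 0.
Hypothesis d0 : d != 0.
Hypothesis bN : b * p ^+ N = 1.
Hypothesis cX : forall j, p ^+ j * c != 1.
Hypothesis dX : forall j, p ^+ j * d != 1.
Hypothesis a0 : a != 0.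
Hypothesis a'0 : a' != 0.
Hypothesis aX : forall j, p ^+ j * a != 1.
Hypothesis a'X : forall j, p ^+ j * a' != 1.
Hypothesis aa' : a * a' * p = b * c * d.
Hypothesis acX : forall j, (j < N)%N -> p ^+ j * (a * p / c) != 1.
Hypothesis adX : forall j, (j < N)%N -> p ^+ j * (a * p / d) != 1.
Hypothesis a'cX : forall j, (j < N)%N -> p ^+ j * (a' * p / c) != 1.
Hypothesis a'dX : forall j, (j < N)%N -> p ^+ j * (a' * p / d) != 1.
Hypothesis X00 : X0 != 0.
Hypothesis Y00 : Y0 != 0.

Variables T12 T23 : V -> V.
Hypothesis T12L : linear T12.
Hypothesis T23L : linear T23.
Hypothesis T12A : self_adjoint ip T12.
Hypothesis T23A : self_adjoint ip T23.

Local Notation x := (grid p a').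
Local Notation y := (grid p a).
Local Notation phi := (phi p b c d).

Variable F : nat -> V.
Hypothesis FV : forall k, VN (F k).
Hypothesis F_last : F N.+1 = 0.
Hypothesis T12F : forall k, (k <= N)%N ->
  T12 (F k) = X0%:C *: ((x k)%:C *: F k + F k.+1).
Hypothesis T23F : forall k, (k <= N)%N ->
  T23 (F k) = Y0%:C *: ((y k)%:C *: F k + (if k is k'.+1 then (phi k)%:C *: F k' else 0)).
Hypothesis coF0 : forall i k, (i < k)%N -> (k <= N)%N -> co i (F k) = 0.
Hypothesis coF : forall k, (k <= N)%N -> co k (F k) != 0.

(** Solves the eigenvector recursion [vcoS]. The factor i = s makes it vanish for k > s, which is
    why the recursion closes at the top. *)
Definition vco s k : R := \prod_(i < k) ((y s - y i) / phi i.+1).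
Definition vhat s : V := \sum_(k < N.+1) (vco s k)%:C *: F k.
(** [T12] raises the index, so its n-th eigenvector starts at k = n; from there on [ucoS] determines
    the coefficients. *)
Definition uco n k : R :=
  if (k < n)%N then 0 else \prod_(n <= j < k) (x n - x j.+1)^-1.
Definition uhat n : V := \sum_(k < N.+1) (uco n k)%:C *: F k.

Lemma xE i j : (i <= N)%N -> (j <= N)%N -> X0 * x i = X0 * x j -> i = j.
Proof. by move=> _ _ /(mulfI X00); exact: grid_inj. Qed.
Lemma yE i j : (i <= N)%N -> (j <= N)%N -> Y0 * y i = Y0 * y j -> i = j.
Proof. by move=> _ _ /(mulfI Y00); exact: grid_inj. Qed.

Lemma vcoS s k : (k < N)%N -> vco s k.+1 * phi k.+1 = vco s k * (y s - y k).
Proof.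
move=> kN; rewrite /vco big_ord_recr /= -mulrA; congr (_ * _).
by rewrite mulfVK // (phi_neq0 p0 pX bN cX dX).
Qed.

Lemma vco_last s : (s <= N)%N -> vco s N * (y s - y N) = 0.
Proof.
rewrite leq_eqVlt => /orP [/eqP ->|sN]; first by rewrite subrr mulr0.
by rewrite /vco (bigD1 (Ordinal sN)) //= subrr !mul0r.
Qed.

Lemma vhat_eigen s : (s <= N)%N -> T23 (vhat s) = (Y0 * y s)%:C *: vhat s.
Proof.
move=> sN; rewrite /vhat (lin_sum T23L) rmorphM -scalerA scaler_sumr.
rewrite (eq_bigr (fun k : 'I_N.+1 => Y0%:C *: ((vco s k * y k)%:C *: F k
   + (if k : nat is k'.+1 then (vco s k * phi k)%:C *: F k' else 0)))); last first.
  move=> k _; rewrite (linZ T23L) T23F ?leq_ord // scalerA mulrC -scalerA.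
  rewrite scalerDr scalerA -rmorphM; congr (_ *: (_ + _)).
  by case: (k : nat) => [|k']; rewrite ?scaler0 // scalerA -rmorphM.
rewrite -[LHS]scaler_sumr; congr (_ *: _); rewrite big_split /=.
rewrite [X in _ + X]big_ord_recl /= add0r.
rewrite (eq_bigr (fun i : 'I_N => (vco s i * (y s - y i))%:C *: F i)); last first.
  by move=> i _; rewrite -[bump 0 i]/(i.+1) vcoS.
have -> : \sum_(i < N) (vco s i * (y s - y i))%:C *: F i
  = \sum_(i < N.+1) (vco s i * (y s - y i))%:C *: F i.
  by rewrite big_ord_recr /= vco_last // rmorph0 scale0r addr0.
rewrite -big_split /=; apply: eq_bigr => i _.
by rewrite -scalerDl -rmorphD scalerA -rmorphM; congr (_%:C *: _); ring.
Qed.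

Lemma ucoS n k : (n <= k)%N -> uco n k.+1 * (x n - x k.+1) = uco n k.
Proof.
move=> nk; rewrite /uco !ltnNge nk (leqW nk) /= big_nat_recr //= mulfVK //.
rewrite subr_eq0; apply: contraTN nk => /eqP /(grid_inj p0 pX a'X) ->.
by rewrite ltnn.
Qed.

Lemma uhat_eigen n : (n <= N)%N -> T12 (uhat n) = (X0 * x n)%:C *: uhat n.
Proof.
move=> nN; rewrite /uhat (lin_sum T12L) rmorphM -scalerA scaler_sumr.
rewrite (eq_bigr (fun k : 'I_N.+1 => X0%:C *: ((uco n k * x k)%:C *: F k
   + (uco n k)%:C *: F k.+1))); last first.
  move=> k _; rewrite (linZ T12L) T12F ?leq_ord // scalerA mulrC -scalerA.
  by rewrite scalerDr scalerA -rmorphM.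
rewrite -[LHS]scaler_sumr; congr (_ *: _); rewrite big_split /=.
rewrite [X in _ + X]big_ord_recr /= F_last scaler0 addr0.
have -> : \sum_(i < N) (uco n i)%:C *: F i.+1
  = \sum_(i < N.+1) (uco n i * (x n - x i))%:C *: F i.
  rewrite [RHS]big_ord_recl /=; have -> : uco n 0 * (x n - x 0) = 0.
    by rewrite /uco; case: n nN => [|n] nN; rewrite ?subrr ?mulr0 ?mul0r.
  rewrite rmorph0 scale0r add0r; apply: eq_bigr => i _; rewrite -[bump 0 i]/(i.+1).
  congr (_%:C *: _); case: (leqP n i) => ni; first by rewrite ucoS.
  rewrite {1}/uco ni; move: ni; rewrite leq_eqVlt => /orP [/eqP ->|ni].
    by rewrite subrr mulr0.
  by rewrite /uco ni mul0r.
rewrite -big_split /=; apply: eq_bigr => i _.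
by rewrite -scalerDl -rmorphD scalerA -rmorphM; congr (_%:C *: _); ring.
Qed.

Lemma vhat_VN s : VN (vhat s).
Proof. exact: (VN_comb VN_lin VN0). Qed.
Lemma uhat_VN s : VN (uhat s).
Proof. exact: (VN_comb VN_lin VN0). Qed.

Let co00 i : co i 0 = 0.
Proof. by rewrite -(scale0r 0) (funZ (co_lin i)) mul0r. Qed.

Lemma vhat_neq0 s : vhat s != 0.
Proof.
apply/eqP => /(congr1 (co 0)); rewrite co00 /vhat (co_comb co_lin) big_ord_recl /=.
rewrite big1 ?addr0 => [|i _]; last by rewrite coF0 ?mulr0 //= /bump leq0n add1n ltn_ord.
by rewrite /vco big_ord0 rmorph1 mul1r => /eqP; rewrite (negbTE (coF _)).
Qed.

Lemma uhat_neq0 n : (n <= N)%N -> uhat n != 0.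
Proof.
move=> nN; apply/eqP => /(congr1 (co n)); rewrite co00 /uhat (co_comb co_lin).
rewrite (bigD1 (Ordinal (nN : (n < N.+1)%N))) //= big1 ?addr0 => [|i]; last first.
  rewrite -val_eqE /= neq_ltn => /orP [ni|ni]; last by rewrite coF0 ?mulr0 ?leq_ord.
  by rewrite /uco ni rmorph0 mul0r.
rewrite /uco ltnn big_geq // rmorph1 mul1r => /eqP.
by rewrite (negbTE (coF _)).
Qed.

Variables u v : 'I_N.+1 -> V.
Hypothesis uV : forall n, VN (u n).
Hypothesis vV : forall s, VN (v s).
Hypothesis uE : forall n, T12 (u n) = (X0 * x n)%:C *: u n.
Hypothesis vE : forall s, T23 (v s) = (Y0 * y s)%:C *: v s.
Hypothesis uO : forall n n', ip (u n) (u n') = (n == n')%:R.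
Hypothesis vO : forall n n', ip (v n) (v n') = (n == n')%:R.

(** [v s] is expanded in the normalised [vhat]; the eigenvalues of [T23] are distinct, so only the
    term s survives. *)
Lemma v_vhat s : exists2 B, v s = B *: vhat s & B != 0.
Proof.
pose e (t : 'I_N.+1) := (sqrtC (ip (vhat t) (vhat t)))^-1 *: vhat t.
have v0 t : ip (vhat t) (vhat t) != 0.
  by apply: contra (vhat_neq0 t) => /eqP /(ip_eq0 Hip) ->.
have eV t : VN (e t) by rewrite /e -[_ *: _]addr0; apply: VN_lin => //; exact: vhat_VN.
have orth (t t' : 'I_N.+1) w w' : t != t' -> T23 w = (Y0 * y t)%:C *: w ->
    T23 w' = (Y0 * y t')%:C *: w' -> ip w w' = 0.
  move=> tt'; apply: (T_orth io_conj Hip T23A).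
  apply: contra tt' => /eqP /yE E; apply/eqP/val_inj/E; exact: leq_ord.
have eE t : T23 (e t) = (Y0 * y t)%:C *: e t.
  by rewrite /e (linZ T23L) vhat_eigen ?leq_ord // !scalerA mulrC.
have eO t t' : ip (e t) (e t') = (t == t')%:R.
  case: eqVneq => [<-|tt']; last exact: orth tt' (eE t) (eE t').
  rewrite /e (ipZl Hip) (ipZr Hip) mulrA -normCKC normfV.
  by rewrite ger0_norm ?sqrtC_ge0 ?(ip_ge0 Hip) // exprVn sqrtCK mulVf.
have := orthonormal_expansion Hip VN_lin VN0 co_lin co_inj eV eO (vV s).
rewrite (bigD1 s) //= big1 ?addr0 => [vs|t ts]; last first.
  by rewrite (orth t s) ?scale0r.
have : v s != 0.
  apply/eqP => v00; have := vO s s; rewrite v00 (ip0r Hip) eqxx => /eqP.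
  by rewrite eq_sym oner_eq0.
rewrite {}vs {2}/e scalerA; set B := _ / _ => B0; exists B => //.
by apply: contra B0 => /eqP ->; rewrite scale0r.
Qed.

(** Moving [T12] across the inner product gives <u_n, F_(k+1)> = (x_n - x_k) <u_n, F_k>, so the
    expansion of [u n] itself is not computed. *)
Lemma ip_uF n k : (k <= N)%N ->
  ip (u n) (F k) = (\prod_(i < k) (x n - x i))%:C * ip (u n) (F 0).
Proof.
elim: k => [|k IH] kN; first by rewrite big_ord0 rmorph1 mul1r.
have := T12A (u n) (F k); rewrite uE T12F ?(ltnW kN) // (ipZl Hip) io_conj.
rewrite (ipZr Hip) (ipDr Hip) (ipZr Hip) rmorphM -mulrA => /(mulfI _).
rewrite fmorph_eq0 => /(_ X00) /eqP.
rewrite addrC -subr_eq -mulrBl -rmorphB IH ?(ltnW kN) // => /eqP <-.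
by rewrite big_ord_recr /= rmorphM; ring.
Qed.

Local Notation racah := (racah p b c d N a' a).

Lemma overlap s : exists2 B, (forall n, ip (u n) (v s) =
  ip (u n) (F 0) * B * (racah n s)%:C) & B != 0.
Proof.
have [B vs B0] := v_vhat s; exists B => // n.
rewrite vs (ipZr Hip) /vhat (ip_sumr Hip) mulr_sumr rmorph_sum mulr_sumr.
apply: eq_bigr => k _; rewrite (ipZr Hip) ip_uF ?leq_ord //.
rewrite (racah_term p0 pX bN cX dX) ?leq_ord //.
have -> : \prod_(i < k) ((x n - x i) * (y s - y i) / phi i.+1)
  = \prod_(i < k) (x n - x i) * vco s k.
  by rewrite /vco -big_split /=; apply: eq_bigr => i _; rewrite mulrA.
by rewrite rmorphM; ring.
Qed.

Local Notation w := (weight p b c d a a').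
Local Notation w' := (weight p b c d a' a).
Local Notation H := (mass p c d N a).

Theorem overlap_racah : exists A B : 'I_N.+1 -> C,
  [/\ forall n s, ip (u n) (v s) = A n * B s * (racah n s)%:C,
      forall n, A n != 0, forall s, B s != 0
    & forall n s, `|A n| ^+ 2 * `|B s| ^+ 2 = (w s * w' n / H)%:C].
Proof.
have /fin_all_exists2 [B HB B0] := overlap.
pose A n := ip (u n) (F 0); exists A, B.
pose cc n s := ip (u n) (v s).
have ccE n s : cc n s = A n * B s * (racah n s)%:C by exact: HB.
have rows n m : \sum_s cc n s * (cc m s)^* = (n == m)%:R.
  rewrite -uO; have e := orthonormal_expansion Hip VN_lin VN0 co_lin co_inj vV vO (uV m).
  rewrite [in RHS]e (ip_sumr Hip); apply: eq_bigr => s _.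
  by rewrite (ipZr Hip) mulrC /cc -(ipC Hip).
have cols s t : \sum_n cc n s * (cc n t)^* = (s == t)%:R.
  rewrite eq_sym -vO; have e := orthonormal_expansion Hip VN_lin VN0 co_lin co_inj uV uO (vV s).
  rewrite [in RHS]e (ip_sumr Hip); apply: eq_bigr => n _.
  by rewrite (ipZr Hip) /cc -(ipC Hip).
have A0 n : A n != 0.
  apply/eqP => An; have := rows n n; rewrite eqxx big1 => [/eqP|s _].
    by rewrite eq_sym oner_eq0.
  by rewrite ccE An !mul0r.
have a'a : a' * a * p = b * c * d by rewrite -aa' [a' * a]mulrC.
pose o : 'I_N.+1 := ord0.
pose H' := mass p c d N a'.
have wE (s : 'I_N.+1) : (w s)%:C = H%:C * `|A o| ^+ 2 * `|B s| ^+ 2.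
  (* Orthogonality to R_0 says that the overlap matrix sends this vector to a multiple of the basis
     vector 0. Inverting by unitarity expresses [z] through row 0, where R_0 = 1. *)
  pose z (t : 'I_N.+1) := (w t)%:C / B t.
  have zc m : \sum_t z t * cc m t = A m * H%:C * (m == o)%:R.
    have := racah_orth0 p0 pX b0 c0 d0 bN cX dX a0 a'0 aX a'X aa' acX adX (leq_ord m).
    move/(congr1 io); rewrite rmorphM rmorph_nat => e.
    rewrite -mulrA -[m == o]/(m == 0%N :> nat) -e rmorph_sum mulr_sumr; apply: eq_bigr => t _.
    by rewrite ccE rmorphM /z; field; exact: B0.
  have zs : z s = A o * H%:C * (cc o s)^*.
    transitivity (\sum_m (\sum_t z t * cc m t) * (cc m s)^*).
      under eq_bigr do rewrite mulr_suml.
      rewrite exchange_big /= (eq_bigr (fun t => z t * (t == s)%:R)); last first.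
        by move=> t _; rewrite -cols mulr_sumr; apply: eq_bigr => m _; rewrite mulrA.
      rewrite (bigD1 s) //= eqxx mulr1 big1 ?addr0 // => t ts.
      by rewrite (negbTE ts) mulr0.
    rewrite (bigD1 o) //= zc eqxx mulr1 big1 ?addr0 // => m mo.
    by rewrite zc (negbTE mo) mulr0 mul0r.
  have -> : (w s)%:C = z s * B s by rewrite /z mulfVK.
  rewrite zs ccE racah0 // rmorph1 mulr1 rmorphM !normCK; ring.
(* The same argument for columns, with the dual weight and total mass. *)
have wE' (n : 'I_N.+1) : (w' n)%:C = H'%:C * `|B o| ^+ 2 * `|A n| ^+ 2.
  pose z (t : 'I_N.+1) := (w' t)%:C / A t.
  have zc m : \sum_t z t * cc t m = B m * H'%:C * (m == o)%:R.
    have := racah_orth0 p0 pX b0 c0 d0 bN cX dX a'0 a0 a'X aX a'a a'cX a'dX (leq_ord m).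
    move/(congr1 io); rewrite rmorphM rmorph_nat => e.
    rewrite -mulrA -[m == o]/(m == 0%N :> nat) -e rmorph_sum mulr_sumr; apply: eq_bigr => t _.
    by rewrite ccE rmorphM /z [in RHS]racahC; field; exact: A0.
  have zs : z n = B o * H'%:C * (cc n o)^*.
    transitivity (\sum_m (\sum_t z t * cc t m) * (cc n m)^*).
      under eq_bigr do rewrite mulr_suml.
      rewrite exchange_big /= (eq_bigr (fun t => z t * (t == n)%:R)); last first.
        by move=> t _; rewrite -rows mulr_sumr; apply: eq_bigr => m _; rewrite mulrA.
      rewrite (bigD1 n) //= eqxx mulr1 big1 ?addr0 // => t ts.
      by rewrite (negbTE ts) mulr0.
    rewrite (bigD1 o) //= zc eqxx mulr1 big1 ?addr0 // => m mo.
    by rewrite zc (negbTE mo) mulr0 mul0r.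
  have -> : (w' n)%:C = z n * A n by rewrite /z mulfVK.
  rewrite zs ccE racahC racah0 // rmorph1 mulr1 rmorphM !normCK; ring.
(* Both weights are 1 at 0. This makes [H] nonzero and supplies H' |B_0|^2 |A_0|^2 = 1, which
   removes the unknown constants from the product of [wE] and [wE']. *)
have w0 := wE o; have w0' := wE' o.
rewrite (weight0 b c d a' aX) rmorph1 in w0.
rewrite (weight0 b c d a a'X) rmorph1 in w0'.
split => // n s; rewrite rmorphM fmorphV rmorphM wE wE'.
have Ho : H%:C != 0.
  by apply: contra_eq_neq w0 => ->; rewrite !mul0r oner_neq0.
apply: (mulIf Ho); rewrite mulfVK //.
transitivity (`|A n| ^+ 2 * `|B s| ^+ 2 * H%:C * (H'%:C * `|B o| ^+ 2 * `|A o| ^+ 2)).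
  by rewrite -w0' mulr1.
by ring.
Qed.

End LeonardPair.

(** * Transfer to all levels and choice of phases *)

Section Overlaps.
Variables (R : realType) (C : numClosedFieldType) (io : {rmorphism R -> C}).
Hypothesis io_conj : forall x, (io x)^* = io x.
Hypothesis io_ge0 : forall x, (0 <= io x) = (0 <= x).
Variable q : R.
Hypothesis hq : 0 < q < 1.
Local Notation "x %:C" := (io x) (format "x %:C").

Variables (V : lmodType C) (ip : V -> V -> C).
Hypothesis Hip : is_inner ip.
Variables Ap Am P K KV E : V -> V.
Hypothesis HX : star_rep io q ip Ap Am P K KV.
Variables (muN epsN : R).
Hypothesis muN_gt0 : 0 < muN.
Hypothesis epsN2 : epsN * epsN = 1.
Local Notation levN := (lev io q K muN).
Local Notation VN := (VN io q Am K muN).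
Hypothesis HE : forall k w, E w = (muN + 2^-1 + k%:R)%:C *: w <-> levN k w.
Hypothesis HP : forall k w, levN k w -> P w = (epsN * (-1) ^+ k)%:C *: w.

Variables T12 T23 : V -> V.
Hypothesis T12L : linear T12.
Hypothesis T23L : linear T23.
Hypothesis T12A : self_adjoint ip T12.
Hypothesis T23A : self_adjoint ip T23.
Hypothesis T12Ap : forall v, T12 (Ap v) = Ap (T12 v).
Hypothesis T23Ap : forall v, T23 (Ap v) = Ap (T23 v).
Hypothesis T12Am : forall v, T12 (Am v) = Am (T12 v).
Hypothesis T23Am : forall v, T23 (Am v) = Am (T23 v).

Variables (N : nat) (co : nat -> V -> C).
Hypothesis co_lin : forall i, functional (co i).
Hypothesis co_inj : forall w, VN w -> (forall i, (i <= N)%N -> co i w = 0) -> w = 0.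

Variables (p b c d a a' X0 Y0 : R).
Hypothesis p0 : p != 0.
Hypothesis pX : forall j, p ^+ j.+1 != 1.
Hypothesis b0 : b != 0.
Hypothesis c0 : c != 0.
Hypothesis d0 : d != 0.
Hypothesis bN : b * p ^+ N = 1.
Hypothesis cX : forall j, p ^+ j * c != 1.
Hypothesis dX : forall j, p ^+ j * d != 1.
Hypothesis a0 : a != 0.
Hypothesis a'0 : a' != 0.
Hypothesis aX : forall j, p ^+ j * a != 1.
Hypothesis a'X : forall j, p ^+ j * a' != 1.
Hypothesis aa' : a * a' * p = b * c * d.
Hypothesis acX : forall j, (j < N)%N -> p ^+ j * (a * p / c) != 1.
Hypothesis adX : forall j, (j < N)%N -> p ^+ j * (a * p / d) != 1.
Hypothesis a'cX : forall j, (j < N)%N -> p ^+ j * (a' * p / c) != 1.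
Hypothesis a'dX : forall j, (j < N)%N -> p ^+ j * (a' * p / d) != 1.
Hypothesis X00 : X0 != 0.
Hypothesis Y00 : Y0 != 0.
Local Notation x := (grid p a').
Local Notation y := (grid p a).
Local Notation phi := (phi p b c d).

Variable F : nat -> V.
Hypothesis FV : forall k, VN (F k).
Hypothesis F_last : F N.+1 = 0.
Hypothesis T12F : forall k, (k <= N)%N ->
  T12 (F k) = X0%:C *: ((x k)%:C *: F k + F k.+1).
Hypothesis T23F : forall k, (k <= N)%N ->
  T23 (F k) = Y0%:C *: ((y k)%:C *: F k + (if k is k'.+1 then (phi k)%:C *: F k' else 0)).
Hypothesis coF0 : forall i k, (i < k)%N -> (k <= N)%N -> co i (F k) = 0.
Hypothesis coF : forall k, (k <= N)%N -> co k (F k) != 0.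

Local Notation basis T lam := (@joint_eigenbasis R C io q V ip Ap Am P K KV E muN epsN T N lam).
Local Notation lam12 := (fun n => X0 * x n).
Local Notation lam23 := (fun s => Y0 * y s).

Let VNL z u v : VN u -> VN v -> VN (z *: u + v). Proof. exact: (VN_lin HX). Qed.
Let VNz : VN 0. Proof. exact: (VN0 HX muN). Qed.

Lemma basis12_exists : exists u, basis T12 lam12 u.
Proof.
apply: (@joint_eigenbasis_exists R C io io_conj q hq V ip Hip Ap Am P K KV E HX muN epsN
  muN_gt0 epsN2 HE HP T12 T12L T12A T12Ap N lam12 _ (uhat io N p a' F)) => [i j iN jN|n nN].
  exact: (xE p0 pX a'X X00 iN jN).
split; [exact: uhat_VN|exact: uhat_neq0|exact: uhat_eigen].
Qed.

Lemma basis23_exists : exists v, basis T23 lam23 v.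
Proof.
apply: (@joint_eigenbasis_exists R C io io_conj q hq V ip Hip Ap Am P K KV E HX muN epsN
  muN_gt0 epsN2 HE HP T23 T23L T23A T23Ap N lam23 _ (vhat io N p b c d a F)) => [i j iN jN|n nN].
  exact: (yE p0 pX aX Y00 iN jN).
split; [exact: vhat_VN|exact: vhat_neq0|exact: vhat_eigen].
Qed.

Lemma ip_lowered T lam S mu u v k n s : basis T lam u -> basis S mu v ->
  ip (lowered io q Am muN u k n) (lowered io q Am muN v k s) = ip (u n k) (v s k).
Proof.
move=> [Hu _] [Hv _]; have [_ u2 /HE u3] := Hu n k; have [_ v2 /HE v3] := Hv s k.
have [_ _ e] := lower io_conj hq Hip HX epsN2 HP u3 u2 v3 v2.
rewrite /lowered (ipZl Hip) (ipZr Hip) e io_conj mulrA mulrA -!rmorphM.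
have l0 := levprod_gt0 hq muN_gt0 k.
by rewrite -invfM -expr2 sqr_sqrtr ?ltW // mulVf ?gt_eqF // rmorph1 mul1r.
Qed.

Local Notation w := (weight p b c d a a').
Local Notation w' := (weight p b c d a' a).
Local Notation H := (mass p c d N a).

Theorem overlap_phases u v : basis T12 lam12 u -> basis T23 lam23 v ->
  exists theta ph : 'I_N.+1 -> nat -> C,
  [/\ forall n k, `|theta n k| = 1, forall s k, `|ph s k| = 1
    & forall n s k, ip (theta n k *: u n k) (ph s k *: v s k) =
      ((-1) ^+ n * Num.sqrt (w s * w' n / H) * racah p b c d N a' a n s)%:C].
Proof.
move=> Hu Hv.
have step k : exists AB : ('I_N.+1 -> C) * ('I_N.+1 -> C),
  [/\ forall n s, ip (u n k) (v s k) = AB.1 n * AB.2 s * (racah p b c d N a' a n s)%:C,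
      forall n, AB.1 n != 0, forall s, AB.2 s != 0
    & forall n s, `|AB.1 n| ^+ 2 * `|AB.2 s| ^+ 2 = (w s * w' n / H)%:C].
  have uu := ip_lowered k _ _ Hu Hu; have vv := ip_lowered k _ _ Hv Hv.
  have uv := ip_lowered k _ _ Hu Hv.
  have Hl n := lowered_VN io_conj hq Hip HX epsN2 HE HP T12L T12Am k n Hu.
  have Hr s := lowered_VN io_conj hq Hip HX epsN2 HE HP T23L T23Am k s Hv.
  have uO n n' : ip (lowered io q Am muN u k n) (lowered io q Am muN u k n') = (n == n')%:R.
    by rewrite uu (proj2 Hu) eqxx andbT.
  have vO n n' : ip (lowered io q Am muN v k n) (lowered io q Am muN v k n') = (n == n')%:R.
    by rewrite vv (proj2 Hv) eqxx andbT.
  have [A [B [e1 e2 e3 e4]]] := overlap_racah io_conj Hip VNL VNz co_lin co_inj p0 pX b0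
    c0 d0 bN cX dX a0 a'0 aX a'X aa' acX adX a'cX a'dX X00 Y00 T23L T12A T23A FV T12F T23F
    coF0 coF (fun n => proj1 (Hl n)) (fun s => proj1 (Hr s)) (fun n => proj2 (Hl n))
    (fun s => proj2 (Hr s)) uO vO.
  by exists (A, B); split => // n s; rewrite -uv.
have [AB HAB] := choice step.
(* [ip] is conjugate-linear on the left, so the phase of A is used as it is and that of B is
   conjugated. The sign (-1)^n of the statement is a convention placed in the first phase. *)
exists (fun (n : 'I_N.+1) k => (-1) ^+ n * ((AB k).1 n / `|(AB k).1 n|)).
exists (fun s k => ((AB k).2 s / `|(AB k).2 s|)^*).
split=> [n k|s k|n s k].
- have [_ A0 _ _] := HAB k; rewrite normrM normrX normrN normr1 expr1n mul1r.
  by rewrite normrM normfV normr_id divff // normr_eq0.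
- have [_ _ B0 _] := HAB k.
  by rewrite norm_conjC normrM normfV normr_id divff // normr_eq0.
have [e A0 B0 nAB] := HAB k.
move: (A0 n) (B0 s) (e n s) (nAB n s).
set A := (AB k).1 n; set B := (AB k).2 s => A0' B0' eAB {}nAB.
rewrite (ipZl Hip) (ipZr Hip) eAB.
have nA : (A / `|A|)^* * A = `|A|.
  rewrite rmorphM fmorphV /= (conj_Creal (normr_real _)).
  by rewrite mulrAC [_ * A]mulrC -normCK expr2 mulfK // normr_eq0.
have nB : (B / `|B|)^* * B = `|B|.
  rewrite rmorphM fmorphV /= (conj_Creal (normr_real _)).
  by rewrite mulrAC [_ * B]mulrC -normCK expr2 mulfK // normr_eq0.
(* Nonnegativity of the radicand is inherited from the squared moduli, without any sign analysis of
   the Pochhammer factors. *)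
have W0 : 0 <= w s * w' n / H.
  by rewrite -io_ge0 -nAB mulr_ge0 ?exprn_ge0.
have nE : `|A| * `|B| = (Num.sqrt (w s * w' n / H))%:C.
  apply/eqP; rewrite -(@eqrXn2 _ 2) ?mulr_ge0 ?io_ge0 ?sqrtr_ge0 //.
  by rewrite exprMn nAB -rmorphXn /= sqr_sqrtr.
have sA : ((-1) ^+ n * (A / `|A|))^* * A = (-1) ^+ n * `|A|.
  by rewrite rmorphM rmorphXn rmorphN rmorph1 -mulrA nA.
transitivity (((-1) ^+ n * (A / `|A|))^* * A * ((B / `|B|)^* * B) *
  (racah p b c d N a' a n s)%:C); first by ring.
by rewrite sA nB !rmorphM -nE rmorphXn rmorphN rmorph1 mulrA.
Qed.
End Overlaps.

Local Opaque tens assoc unassoc.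

(** * The intermediate Casimirs on the triple tensor product *)

Section Casimirs.
Variables (R : realType) (C : numClosedFieldType) (io : {rmorphism R -> C}).
Hypothesis io_conj : forall x, (io x)^* = io x.
Variable q : R.
Hypothesis hq : 0 < q < 1.
Local Notation "x %:C" := (io x) (format "x %:C").

Lemma inner_innerP (I : choiceType) : is_inner (@inner C I).
Proof.
split.
- exact: innerDr.
- exact: innerZr.
- exact: innerC.
- exact: inner_ge0.
- exact: inner_eq0.
Qed.

Lemma osp_star_rep (I : choiceType) (X : osp_ops C I) : osp_rep io q X ->
  star_rep io q (@inner C I) (opAp X) (opAm X) (opP X) (opK X) (opKV X).
Proof.
case=> h1 h2 h3 h4 h5 h6 h7 h8 h9 h10 h11 h12 h13 h14 h15 h16 h17.
split; [exact: h1|exact: h2|exact: h3|exact: h4|exact: h5|exact: h6|exact: h7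
 |exact: h8|exact: h9|exact: h10|exact: h11|exact: h12|exact: h13|exact: h14
 |exact: h15|exact: h16|exact: h17].
Qed.

Definition casC (I : choiceType) (X : osp_ops C I) : {malg C[I]} -> {malg C[I]} :=
  casV io q (opAp X) (opAm X) (opP X) (opK X) (opKV X).

Lemma casC_linear (I : choiceType) (X : osp_ops C I) : osp_rep io q X ->
  linear (casC X).
Proof. by move=> /osp_star_rep; exact: casV_linear. Qed.

Lemma casC_adj (I : choiceType) (X : osp_ops C I) : osp_rep io q X ->
  adjoint (casC X) (casC X).
Proof. by move=> /osp_star_rep H; exact: (casV_adj io_conj (inner_innerP I) H). Qed.

Definition Q23C (I J L : choiceType) (Y : osp_ops C J) (Z : osp_ops C L) :
    {malg C[(I * (J * L))%type]} -> {malg C[(I * (J * L))%type]} :=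
  tensop id (casC (coprod Y Z)).

Definition Q12C (I J L : choiceType) (X : osp_ops C I) (Y : osp_ops C J)
    (v : {malg C[(I * (J * L))%type]}) : {malg C[(I * (J * L))%type]} :=
  assoc (tensop (casC (coprod X Y)) id (unassoc v)).

Section Triple.
Variables (I J L : choiceType).
Variables (X : osp_ops C I) (Y : osp_ops C J) (Z : osp_ops C L).
Hypothesis (HX : osp_rep io q X) (HY : osp_rep io q Y) (HZ : osp_rep io q Z).
Local Notation XYZ := (coprod X (coprod Y Z)).
Local Notation XYZ' := (coprod (coprod X Y) Z).
Local Notation Q12 := (@Q12C I J L X Y).
Local Notation Q23 := (@Q23C I J L Y Z).

Let HXY := coprod_rep hq HX HY.
Let HYZ := coprod_rep hq HY HZ.

Lemma assoc_linear : linear (@assoc C I J L).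
Proof. exact: (@lext_linear C (I * J * L)%type (I * (J * L))%type). Qed.
Lemma unassoc_linear : linear (@unassoc C I J L).
Proof. exact: (@lext_linear C (I * (J * L))%type (I * J * L)%type). Qed.

Lemma tens3_ext (V : lmodType C) (f g : {malg C[(I * J * L)%type]} -> V) :
  linear f -> linear g -> (forall u v w, f (tens (tens u v) w) = g (tens (tens u v) w)) ->
  f =1 g.
Proof.
move=> fL gL fg; apply: tens_ext => // z w; move: z; apply: tens_ext.
- by move=> c u v; rewrite tensDl fL.
- by move=> c u v; rewrite tensDl gL.
- by move=> u v; exact: fg.
Qed.

(** Coassociativity of the coproduct on A_+. *)
Lemma assoc_Ap v : opAp XYZ (assoc v) = assoc (opAp XYZ' v).
Proof.
have aL := assoc_linear; have f1 := coApL X (coprod Y Z).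
have f2 := coApL (coprod X Y) Z.
move: v; apply: tens3_ext; [exact: (linear_comp f1 aL)|exact: (linear_comp aL f2)|].
move=> u v w.
rewrite assocE (coApE HX HYZ) (coApE HXY HZ) (coApE HY HZ) (coApE HX HY).
rewrite (coPE HY HZ) (coKE HY HZ) (coKVE HX HY) tensAl tensAr.
rewrite assocD assocD addrA.
by apply: f_equal2; [apply: f_equal2|]; symmetry; apply: assocE.
Qed.

Lemma assoc_Am v : opAm XYZ (assoc v) = assoc (opAm XYZ' v).
Proof.
have aL := assoc_linear; have f1 := coAmL X (coprod Y Z).
have f2 := coAmL (coprod X Y) Z.
move: v; apply: tens3_ext; [exact: (linear_comp f1 aL)|exact: (linear_comp aL f2)|].
move=> u v w.
rewrite assocE (coAmE HX HYZ) (coAmE HXY HZ) (coAmE HY HZ) (coAmE HX HY).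
rewrite (coPE HY HZ) (coKE HY HZ) (coKVE HX HY) tensAl tensAr.
rewrite assocD assocD addrA.
by apply: f_equal2; [apply: f_equal2|]; symmetry; apply: assocE.
Qed.

Lemma assoc_K v : opK XYZ (assoc v) = assoc (opK XYZ' v).
Proof.
have aL := assoc_linear.
have f1 : linear (opK XYZ) by exact: tensop_linear.
have f2 : linear (opK XYZ') by exact: tensop_linear.
move: v; apply: tens3_ext; [exact: (linear_comp f1 aL)|exact: (linear_comp aL f2)|].
move=> u v w.
by rewrite assocE (coKE HX HYZ) (coKE HXY HZ) (coKE HY HZ) (coKE HX HY) assocE.
Qed.

Lemma casC_comm (I' : choiceType) (X' : osp_ops C I') : osp_rep io q X' ->
  [/\ forall v, casC X' (opAp X' v) = opAp X' (casC X' v),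
      forall v, casC X' (opAm X' v) = opAm X' (casC X' v),
      forall v, casC X' (opK X' v) = opK X' (casC X' v)
    & forall v, casC X' (opP X' v) = opP X' (casC X' v)].
Proof.
move=> /osp_star_rep H; split.
- exact: (casVAp hq (inner_innerP I') H).
- exact: (casVAm hq (inner_innerP I') H).
- exact: (casVK hq H).
- exact: (casVP H).
Qed.

Lemma Q23_comm : [/\ forall v, Q23 (opAp XYZ v) = opAp XYZ (Q23 v),
    forall v, Q23 (opAm XYZ v) = opAm XYZ (Q23 v)
  & forall v, Q23 (opK XYZ v) = opK XYZ (Q23 v)].
Proof.
have [h1 h2 h3 h4] := casC_comm HYZ.
exact: (commute_coprodr HX HYZ (casC_linear HYZ) h1 h2 h3 h4).
Qed.

Lemma Q12_assoc v : Q12 (assoc v) = assoc (tensop (casC (coprod X Y)) id v).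
Proof. by rewrite /Q12C assocK. Qed.

(** Q^(12) lives naturally on (X x Y) x Z, where [commute_coprodl] applies; coassociativity carries
    the result to X x (Y x Z). *)
Lemma Q12_comm : [/\ forall v, Q12 (opAp XYZ v) = opAp XYZ (Q12 v),
    forall v, Q12 (opAm XYZ v) = opAm XYZ (Q12 v)
  & forall v, Q12 (opK XYZ v) = opK XYZ (Q12 v)].
Proof.
have [h1 h2 h3 h4] := casC_comm HXY.
have [e1 e2 e3] := commute_coprodl HXY HZ (casC_linear HXY) h1 h2 h3.
split=> v; rewrite -[v]unassocK.
- by rewrite assoc_Ap !Q12_assoc assoc_Ap e1.
- by rewrite assoc_Am !Q12_assoc assoc_Am e2.
- by rewrite assoc_K !Q12_assoc assoc_K e3.
Qed.

Lemma Q23_linear : linear Q23.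
Proof. exact: tensop_linear. Qed.

Lemma Q12_linear : linear Q12.
Proof.
by move=> c u v; rewrite /Q12C unassoc_linear tensop_linear assoc_linear.
Qed.

Lemma Q23_adj : adjoint Q23 Q23.
Proof.
apply: adjoint_tensop; [exact: linear_id|exact: linear_id|exact: (casC_linear HYZ)|
  exact: (casC_linear HYZ)| exact: adjoint_id |exact: (casC_adj HYZ)].
Qed.

Lemma Q12_adj : adjoint Q12 Q12.
Proof.
apply: adjoint_assoc.
apply: adjoint_tensop; [exact: (casC_linear HXY)|exact: (casC_linear HXY)|
 exact: linear_id|exact: linear_id|exact: (casC_adj HXY)|exact: adjoint_id].
Qed.
End Triple.
End Casimirs.

(** * Coordinates of lowest-weight vectors in the triple product *)

Section Coords.
Variables (R : realType) (C : numClosedFieldType) (io : {rmorphism R -> C}).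
Hypothesis io_conj : forall x, (io x)^* = io x.
Variable q : R.
Hypothesis hq : 0 < q < 1.
Local Notation "x %:C" := (io x) (format "x %:C").

Lemma tensUU3 (I J L : choiceType) (i : I) (j : J) (l : L) :
  tens << i >> (tens << j >> << l >>) = << (i, (j, l)) >> :> {malg C[(I * (J * L))%type]}.
Proof. by rewrite !tensUU. Qed.

Section CoprodA0.
Variables (I J : choiceType) (X : osp_ops C I) (Y : osp_ops C J).
Hypothesis (XL : linear (opA0 X)) (YL : linear (opA0 Y)).

Lemma coA0L : linear (opA0 (coprod X Y)).
Proof. by apply: linear_add; exact: tensop_linear. Qed.

Lemma coA0E u v : opA0 (coprod X Y) (tens u v) = tens (opA0 X u) v + tens u (opA0 Y v).
Proof.
have iL := @linear_id C {malg C[I]}; have jL := @linear_id C {malg C[J]}.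
by rewrite /= (tensopE _ _ XL jL) (tensopE _ _ iL YL).
Qed.

Lemma coA0_adj : adjoint (opA0 X) (opA0 X) -> adjoint (opA0 Y) (opA0 Y) ->
  adjoint (opA0 (coprod X Y)) (opA0 (coprod X Y)).
Proof.
move=> XA YA; apply: adjoint_tens => [||u v u' v']; [exact: coA0L|exact: coA0L|].
by rewrite !coA0E innerDl innerDr !inner_tens XA YA.
Qed.
End CoprodA0.

Section OneFactor.
Variables (eps mu : R).
Definition kweight n := q `^ ((n%:R + mu + 2^-1) / 2).
Definition ladder n := Num.sqrt (sigma q mu n).
Definition parity n : R := eps * (-1) ^+ n.

Record irr_action (X : osp_ops C nat) : Prop := IrrAction {
  irr_rep : osp_rep io q X;
  aA0 : forall n, opA0 X << n >> = (n%:R + mu + 2^-1)%:C *: << n >>;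
  aA0L : linear (opA0 X);
  aA0adj : adjoint (opA0 X) (opA0 X);
  aAp : forall n, opAp X << n >> = (ladder n.+1)%:C *: << n.+1 >>;
  aAm : forall n, opAm X << n >> = (ladder n)%:C *: << n.-1 >>;
  aP : forall n, opP X << n >> = (parity n)%:C *: << n >>;
  aK : forall n, opK X << n >> = (kweight n)%:C *: << n >>;
  aKV : forall n, opKV X << n >> = ((kweight n)^-1)%:C *: << n >>
}.

Lemma irrepC_action : eps = 1 \/ eps = -1 -> 0 < mu ->
  irr_action (irrepC io q eps mu).
Proof.
move=> heps hmu; split.
- exact: irrep_rep.
- exact: irA0.
- exact: (@lext_linear C nat nat).
- apply: adjoint_basis => [||n m]; [exact: lext_linear|exact: lext_linear|].
  rewrite !irA0 innerZl innerZr !innerU io_conj !mcoeffU.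
  by rewrite eq_sym; case: eqP => [->|_] //; rewrite !mulr0.
- exact: irAp.
- exact: irAm.
- exact: irP.
- exact: irK.
- by move=> n; rewrite irKV powRN.
Qed.

Lemma aKP X : irr_action X -> forall n,
  opK X (opP X << n >>) = (kweight n * parity n)%:C *: << n >>.
Proof.
move=> H n; rewrite (aP H) (linZ (KL (irr_rep H))) (aK H) scalerA -rmorphM.
by rewrite mulrC.
Qed.
Lemma kweight_neq0 n : kweight n != 0.
Proof. exact: qpow_neq0. Qed.
Lemma ladder0 : ladder 0 = 0. Proof. by rewrite /ladder sigma0 sqrtr0. Qed.
Hypothesis mu_gt0 : 0 < mu.
Lemma ladder_neq0 n : ladder n.+1 != 0.
Proof. by rewrite gt_eqF // sqrtr_gt0 sigma_gt0. Qed.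
Lemma ladder_sq n : ladder n * ladder n = sigma q mu n.
Proof. by rewrite -expr2 sqr_sqrtr // sigma_ge0. Qed.
End OneFactor.

Variables (eps1 eps2 eps3 mu1 mu2 mu3 : R) (N : nat).
Hypothesis hmu1 : 0 < mu1.
Hypothesis hmu2 : 0 < mu2.
Hypothesis hmu3 : 0 < mu3.
Hypothesis e1sq : eps1 * eps1 = 1.
Hypothesis e2sq : eps2 * eps2 = 1.
Hypothesis e3sq : eps3 * eps3 = 1.
Variables X1 X2 X3 : osp_ops C nat.
Hypothesis A1 : irr_action eps1 mu1 X1.
Hypothesis A2 : irr_action eps2 mu2 X2.
Hypothesis A3 : irr_action eps3 mu3 X3.
Local Notation X123 := (coprod X1 (coprod X2 X3)).
Local Notation Q12 := (@Q12C R C io q nat nat nat X1 X2).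
Local Notation Q23 := (@Q23C R C io q nat nat nat X2 X3).
Local Notation I3 := (nat * (nat * nat))%type.
Local Notation V := {malg C[I3]}.
Local Notation k1 := (kweight mu1).
Local Notation k2 := (kweight mu2).
Local Notation k3 := (kweight mu3).
Local Notation s1 := (ladder mu1).
Local Notation s2 := (ladder mu2).
Local Notation s3 := (ladder mu3).
Local Notation g2 n := (k2 n * parity eps2 n).
Local Notation g3 n := (k3 n * parity eps3 n).

Let H1 := irr_rep A1.
Let H2 := irr_rep A2.
Let H3 := irr_rep A3.
Let H12 := coprod_rep hq H1 H2.
Let H23 := coprod_rep hq H2 H3.
Let H123 := coprod_rep hq H1 H23.

Definition cf (w : V) a b c : C := w@_(a, (b, c)).

Local Notation e3 a b c := (tens << a >> (tens << b >> << c >>) : V).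

Lemma tensZ3 x y z (u v w : {malg C[nat]}) :
  tens (x%:C *: u) (tens (y%:C *: v) (z%:C *: w)) = (x * y * z)%:C *: tens u (tens v w).
Proof. by rewrite tensZl tensZl !tensZr !scalerA !rmorphM. Qed.

Lemma innerZ3 x (u w : V) : inner (x%:C *: u) w = x%:C * inner u w.
Proof. by rewrite innerZl io_conj. Qed.

Lemma cf_e3 w a b c : inner (e3 a b c) w = cf w a b c.
Proof. by rewrite tensUU3 innerU. Qed.

Lemma Ap_basis a b c : opAp X123 (e3 a b c) =
  (s1 a.+1 * g2 b * g3 c)%:C *: e3 a.+1 b c
  + ((k1 a)^-1 * s2 b.+1 * g3 c)%:C *: e3 a b.+1 c
  + ((k1 a)^-1 * (k2 b)^-1 * s3 c.+1)%:C *: e3 a b c.+1.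
Proof.
rewrite (coApE H1 H23) (coPE H2 H3) (coKE H2 H3) (coApE H2 H3).
rewrite (aKP A2) (aKP A3) (aAp A1) (aAp A2) (aAp A3) (aKV A1) (aKV A2).
rewrite tensAr addrA.
by apply: f_equal2; [apply: f_equal2|]; exact: tensZ3.
Qed.

(** Read off from A_+ on basis vectors through adjointness, which avoids truncated predecessors. *)
Lemma cf_Am w a b c : cf (opAm X123 w) a b c =
  (s1 a.+1 * g2 b * g3 c)%:C * cf w a.+1 b c
  + ((k1 a)^-1 * s2 b.+1 * g3 c)%:C * cf w a b.+1 c
  + ((k1 a)^-1 * (k2 b)^-1 * s3 c.+1)%:C * cf w a b c.+1.
Proof.
rewrite -[LHS]cf_e3 -(adjA H123) Ap_basis innerDl innerDl.
by apply: f_equal2; [apply: f_equal2|]; rewrite innerZ3 cf_e3.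
Qed.

Definition tot a b c : R := (a + b + c)%:R + mu1 + mu2 + mu3 + 1 + 2^-1.

Lemma K_basis a b c : opK X123 (e3 a b c) = (q `^ (tot a b c / 2))%:C *: e3 a b c.
Proof.
rewrite (coKE H1 H23) (coKE H2 H3) (aK A1) (aK A2) (aK A3) tensZ3.
congr (_%:C *: _); rewrite /kweight -!(qpowD hq); congr (q `^ _).
by rewrite /tot !natrD; field.
Qed.

Lemma P_basis a b c : opP X123 (e3 a b c) =
  (eps1 * eps2 * eps3 * (-1) ^+ (a + b + c))%:C *: e3 a b c.
Proof.
rewrite (coPE H1 H23) (coPE H2 H3) (aP A1) (aP A2) (aP A3) tensZ3.
by congr (_%:C *: _); rewrite /parity !exprD; ring.
Qed.

Lemma A0_basis a b c : opA0 X123 (e3 a b c) = (tot a b c)%:C *: e3 a b c.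
Proof.
have L23 := coA0L X2 X3.
rewrite (coA0E (aA0L A1) L23) (coA0E (aA0L A2) (aA0L A3)).
rewrite (aA0 A1) (aA0 A2) (aA0 A3).
rewrite tensAr tensZl tensZl tensZr tensZr tensZr addrA -scalerDl -scalerDl -!rmorphD.
by congr (_%:C *: _); rewrite /tot !natrD; field.
Qed.

Lemma coef_K w a b c : cf (opK X123 w) a b c = (q `^ (tot a b c / 2))%:C * cf w a b c.
Proof. by rewrite -[LHS]cf_e3 -(adjK H123) K_basis innerZ3 cf_e3. Qed.
Lemma coef_P w a b c : cf (opP X123 w) a b c =
  (eps1 * eps2 * eps3 * (-1) ^+ (a + b + c))%:C * cf w a b c.
Proof. by rewrite -[LHS]cf_e3 -(adjP H123) P_basis innerZ3 cf_e3. Qed.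
Lemma coef_A0 w a b c : cf (opA0 X123 w) a b c = (tot a b c)%:C * cf w a b c.
Proof.
have L23 := coA0L X2 X3.
have A := coA0_adj (aA0L A1) L23 (aA0adj A1) (coA0_adj (aA0L A2) (aA0L A3) (aA0adj A2) (aA0adj A3)).
by rewrite -[LHS]cf_e3 -A A0_basis innerZ3 cf_e3.
Qed.

Lemma qpow_inj x y : q `^ x = q `^ y -> x = y.
Proof.
move=> exy; apply/eqP; case: (ltgtP x y) => // xy.
  by have := qpow_lt hq xy; rewrite exy ltxx.
by have := qpow_lt hq xy; rewrite exy ltxx.
Qed.

Local Notation muN := (N%:R + mu1 + mu2 + mu3 + 1).
Local Notation epsN := ((-1) ^+ N * eps1 * eps2 * eps3).
Local Notation levN := (lev io q (opK X123) muN).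

Lemma cf_ext (u v : V) : (forall a b c, cf u a b c = cf v a b c) -> u = v.
Proof. by move=> uv; apply/malgP => -[a [b c]]; exact: uv. Qed.

Lemma cfZ x (u : V) a b c : cf (x *: u) a b c = x * cf u a b c.
Proof. exact: mcoeffZ. Qed.

Lemma tot_level a b c k : tot a b c = muN + 2^-1 + k%:R <-> (a + b + c)%N = (N + k)%N.
Proof.
split=> e; last by rewrite /tot e natrD; ring.
apply/eqP; rewrite -(eqr_nat R) natrD; apply/eqP.
by move: e; rewrite /tot => e; lra.
Qed.

Lemma diag_supp (f : nat -> nat -> nat -> R) (D : V -> V) (x : R) w :
  (forall w a b c, cf (D w) a b c = (f a b c)%:C * cf w a b c) ->
  D w = x%:C *: w <-> (forall a b c, cf w a b c != 0 -> f a b c = x).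
Proof.
move=> Df; split=> [Dw a b c w0|H].
  have := Df w a b c; rewrite Dw cfZ => /(mulIf w0) /eqP.
  by rewrite -subr_eq0 -rmorphB fmorph_eq0 subr_eq0 => /eqP ->.
apply: cf_ext => a b c; rewrite Df cfZ.
by case: (eqVneq (cf w a b c) 0) => [->|/H ->]; rewrite ?mulr0.
Qed.

Lemma lev_supp k w : levN k w <->
  (forall a b c, cf w a b c != 0 -> (a + b + c = N + k)%N).
Proof.
rewrite /lev (diag_supp (kap q muN k) w coef_K); split=> H a b c /H.
  by move/qpow_inj => e; apply/tot_level; apply: (mulIf (_ : (2 : R)^-1 != 0)) => //; rewrite invr_eq0 pnatr_eq0.
by move/tot_level => e; rewrite /kap e.
Qed.

Lemma E_lev k w : opA0 X123 w = (muN + 2^-1 + k%:R)%:C *: w <-> levN k w.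
Proof.
rewrite (diag_supp (muN + 2^-1 + k%:R) w coef_A0) lev_supp.
by split=> H a b c /H /tot_level.
Qed.

Lemma P_lev k w : levN k w -> opP X123 w = (epsN * (-1) ^+ k)%:C *: w.
Proof.
move/lev_supp => H; apply/(diag_supp _ w coef_P) => a b c /H ->.
by rewrite exprD; ring.
Qed.

Lemma epsN_sq : epsN * epsN = 1.
Proof.
have e : ((-1) ^+ N * (-1) ^+ N : R) = 1 by rewrite -expr2 sqrr_sign.
by ring: e e1sq e2sq e3sq.
Qed.

Local Notation VN := (VN io q (opAm X123) (opK X123) muN).

(** [al1], [al2], [al3] are the coefficients of the equation A_- w = 0 at (a,b,c). As [al2] never
    vanishes, the equation can be solved for the coordinate with middle index b+1. *)
Definition al1 a b c : R := s1 a.+1 * g2 b * g3 c.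
Definition al2 a b c : R := (k1 a)^-1 * s2 b.+1 * g3 c.
Definition al3 a b c : R := (k1 a)^-1 * (k2 b)^-1 * s3 c.+1.

Lemma parity_sq eps n : eps * eps = 1 -> parity eps n * parity eps n = 1.
Proof. by move=> e; rewrite /parity mulrACA e mul1r -expr2 sqrr_sign. Qed.
Lemma parity_neq0 eps n : eps * eps = 1 -> parity eps n != 0.
Proof.
move=> e1; have := parity_sq n e1; apply: contra_eq_neq => ->.
by rewrite mul0r eq_sym oner_neq0.
Qed.

Lemma al2_neq0 a b c : al2 a b c != 0.
Proof.
apply: mulf_neq0; apply: mulf_neq0.
- by rewrite invr_eq0; exact: kweight_neq0.
- exact: ladder_neq0.
- exact: kweight_neq0.
- exact: parity_neq0.
Qed.

Definition co (a : nat) (w : V) : C := cf w a 0%N (N - a)%N.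

Lemma co_functional a : functional (co a).
Proof. exact: coef_functional. Qed.

Lemma VN_supp w a b c : VN w -> (a + b + c)%N != N -> cf w a b c = 0.
Proof.
move=> [/lev_supp H _]; apply: contraNeq => /H ->.
by rewrite addn0.
Qed.

Lemma VN_rel w a b c : VN w ->
  (al1 a b c)%:C * cf w a.+1 b c + (al2 a b c)%:C * cf w a b.+1 c
  + (al3 a b c)%:C * cf w a b c.+1 = 0.
Proof. by move=> [_ Aw]; rewrite -cf_Am Aw; exact: mcoeff0. Qed.

(** Induction on the middle index: [VN_rel] expresses the coordinates at b+1 through those at b. *)
Lemma co_inj w : VN w -> (forall a, (a <= N)%N -> co a w = 0) -> w = 0.
Proof.
move=> wV w0; apply: cf_ext => a b c; rewrite [RHS]mcoeff0.
elim: b a c => [|b IH] a c.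
  case: (eqVneq (a + 0 + c)%N N) => [e|/(VN_supp wV) //].
  have aN : (a <= N)%N by rewrite -e addn0 leq_addr.
  by have := w0 a aN; rewrite /co (_ : (N - a)%N = c) // -e addn0 addKn.
have := VN_rel a b c wV; rewrite !IH !mulr0 add0r addr0 => /eqP.
by rewrite mulf_eq0 fmorph_eq0 (negbTE (al2_neq0 _ _ _)) => /eqP.
Qed.

(** The equations [VN_rel] solved for the middle index b+1, starting from arbitrary data [om] at b =
    0. Every choice of N+1 coordinates is thus realised by a lowest-weight vector. *)
Fixpoint extend_coef (om : nat -> R) b a c : R := if b is b'.+1 then
  - (al2 a b' c)^-1 * (al1 a b' c * extend_coef om b' a.+1 c
     + al3 a b' c * extend_coef om b' a c.+1) else om a.

(** A finite set containing every (a,b,c) with a+b+c = N, as required to build a finitely supported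
    vector. *)
Definition box : {fset I3} := seq_fset tt
  [seq (a, bc) | a <- iota 0 N.+1,
     bc <- [seq (b, c) | b <- iota 0 N.+1, c <- iota 0 N.+1]].

Definition extend (om : nat -> R) : V :=
  [malg x in box => if (x.1 + x.2.1 + x.2.2)%N == N
     then (extend_coef om x.2.1 x.1 x.2.2)%:C else 0].

Lemma cf_extend om a b c :
  cf (extend om) a b c = if (a + b + c)%N == N then (extend_coef om b a c)%:C else 0.
Proof.
rewrite /cf /extend mcoeffE /=; case: eqP => [e|_]; last by rewrite if_same.
rewrite seq_fsetE allpairs_f //; first by rewrite mem_iota; lia.
by apply: allpairs_f; rewrite mem_iota; lia.
Qed.

Lemma extend_VN om : VN (extend om).
Proof.
split.
  apply/lev_supp => a b c; rewrite cf_extend addn0.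
  by case: ifP => [/eqP //|_]; rewrite eqxx.
apply: cf_ext => a b c; rewrite cf_Am [RHS]mcoeff0 !cf_extend.
rewrite -/(al1 a b c) -/(al2 a b c) -/(al3 a b c).
rewrite !addSn !addnS addSn; case: eqP => _; last by rewrite !mulr0 !addr0.
rewrite -!rmorphM -!rmorphD /= -[RHS](rmorph0 io); congr (_%:C).
by field; exact: al2_neq0.
Qed.

Lemma co_extend om a : (a <= N)%N -> co a (extend om) = (om a)%:C.
Proof. by move=> aN; rewrite /co cf_extend addn0 subnKC // eqxx. Qed.

Lemma cas_weight (I : choiceType) (X : osp_ops C I) (HX : osp_rep io q X)
    (e f : {malg C[I]}) x k k' y :
  opP X e = x%:C *: e -> opK X e = k%:C *: e ->
  opKV X e = k'%:C *: e -> opAm X e = y%:C *: f ->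
  casC io q X e = (x * y)%:C *: opAp X f
    - (x * ((q - q^-1)^-1 * (q `^ (- 2^-1) * (k * k) - q `^ 2^-1 * (k' * k'))))%:C *: e.
Proof. exact: (casV_weight (osp_star_rep HX)). Qed.

(** * The Casimir of a two-fold product on the vectors |n,0> and |0,n> *)

Section Pair.
Variables (epsY epsZ muY muZ : R) (Y Z : osp_ops C nat).
Hypothesis AY : irr_action epsY muY Y.
Hypothesis AZ : irr_action epsZ muZ Z.
Local Notation YZ := (coprod Y Z).
Let HY := irr_rep AY.
Let HZ := irr_rep AZ.

Definition pair_eig n m : R := qnum q (n%:R + muY + (m%:R + muZ) + 2^-1).

Lemma pair_diag n m : (q - q^-1)^-1 * (q `^ (- 2^-1) * (kweight muY n * kweight muZ m * (kweight muY n * kweight muZ m))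
   - q `^ 2^-1 * ((kweight muY n)^-1 * (kweight muZ m)^-1 * ((kweight muY n)^-1 * (kweight muZ m)^-1)))
  = pair_eig n m.
Proof.
rewrite -!invfM /kweight -!(qpowD hq) -powRN -!(qpowD hq) /pair_eig /qnum mulrC.
by congr ((q `^ _ - q `^ _) * _); field.
Qed.

Let tens2Z x y (u v : {malg C[nat]}) :
  tens (x%:C *: u) (y%:C *: v) = (x * y)%:C *: tens u v.
Proof. by rewrite tensZl tensZr scalerA rmorphM. Qed.

Let pairP n m : opP YZ (tens << n >> << m >>) = (parity epsY n * parity epsZ m)%:C *: tens << n >> << m >>.
Proof. by rewrite (coPE HY HZ) (aP AY) (aP AZ) tens2Z. Qed.
Let pairK n m : opK YZ (tens << n >> << m >>) = (kweight muY n * kweight muZ m)%:C *: tens << n >> << m >>.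
Proof. by rewrite (coKE HY HZ) (aK AY) (aK AZ) tens2Z. Qed.
Let pairKV n m : opKV YZ (tens << n >> << m >>) = ((kweight muY n)^-1 * (kweight muZ m)^-1)%:C *: tens << n >> << m >>.
Proof. by rewrite (coKVE HY HZ) (aKV AY) (aKV AZ) tens2Z. Qed.
Lemma pairAp n m : opAp YZ (tens << n >> << m >>) =
  (ladder muY n.+1 * (kweight muZ m * parity epsZ m))%:C *: tens << n.+1 >> << m >>
  + ((kweight muY n)^-1 * ladder muZ m.+1)%:C *: tens << n >> << m.+1 >>.
Proof.
rewrite (coApE HY HZ) (aAp AY) (aAp AZ) (aKP AZ) (aKV AY).
by apply: f_equal2; exact: tens2Z.
Qed.

(** The second factor is in its ground state, so A_- lowers only the first. A_+ is left unexpanded,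
    since the case n = 0 is settled by its vanishing coefficient. *)
Lemma cas_left n : casC io q YZ (tens << n >> << 0%N >>) =
  (parity epsY n * parity epsZ 0 * (ladder muY n * (kweight muZ 0 * parity epsZ 0)))%:C *: opAp YZ (tens << n.-1 >> << 0%N >>)
  - (parity epsY n * parity epsZ 0 * pair_eig n 0)%:C *: tens << n >> << 0%N >>.
Proof.
rewrite -pair_diag; apply: (cas_weight (coprod_rep hq HY HZ)); rewrite ?pairP ?pairK ?pairKV //.
rewrite (coAmE HY HZ) (aAm AY) (aAm AZ) (aKP AZ) (aKV AY) ladder0 rmorph0 scale0r.
by rewrite (lin0 (tensDr _)) addr0 tens2Z.
Qed.

Lemma cas_right n : casC io q YZ (tens << 0%N >> << n >>) =
  (parity epsY 0 * parity epsZ n * ((kweight muY 0)^-1 * ladder muZ n))%:C *: opAp YZ (tens << 0%N >> << n.-1 >>)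
  - (parity epsY 0 * parity epsZ n * pair_eig 0 n)%:C *: tens << 0%N >> << n >>.
Proof.
rewrite -pair_diag; apply: (cas_weight (coprod_rep hq HY HZ)); rewrite ?pairP ?pairK ?pairKV //.
rewrite (coAmE HY HZ) (aAm AY) (aAm AZ) (aKP AZ) (aKV AY) ladder0 rmorph0 scale0r.
by rewrite (lin0 (tensDl _)) add0r tens2Z.
Qed.
End Pair.

(** The common value of [k1 a * k3 c] for a + c + 1 = N: the exponent depends only on a + c. *)
Definition edge : R := q `^ ((N%:R + mu1 + mu3) / 2).

Lemma edge_neq0 : edge != 0. Proof. exact: qpow_neq0. Qed.

Lemma kweight_edge a c : (a + c).+1 = N -> k1 a * k3 c = edge.
Proof.
move=> e; rewrite /kweight /edge -(qpowD hq); congr (q `^ _).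
have -> : N%:R = a%:R + c%:R + 1 :> R by rewrite -e -natrD natr1.
by field.
Qed.

(** Conjugate-linear in [z], so only real scalars pass through unchanged, as in [psi12D]. By
    self-adjointness, the coordinates of Q^(12) w are such pairings of w with the Casimir of a basis
    vector ([cf_Q12]). *)
Definition psi12 (c : nat) (w : V) (z : {malg C[(nat * nat)%type]}) : C :=
  inner (assoc (tens z << c >>)) w.
Definition psi23 (a : nat) (w : V) (z : {malg C[(nat * nat)%type]}) : C :=
  inner (tens << a >> z) w.

Lemma psi12D c w x y (A B : {malg C[(nat * nat)%type]}) :
  psi12 c w (x%:C *: A + y%:C *: B) = x%:C * psi12 c w A + y%:C * psi12 c w B.
Proof.
rewrite /psi12 tensAl assocD innerDl.
by apply: f_equal2; rewrite tensZl assocZ innerZ3.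
Qed.

Lemma psi23D a w x y (A B : {malg C[(nat * nat)%type]}) :
  psi23 a w (x%:C *: A + y%:C *: B) = x%:C * psi23 a w A + y%:C * psi23 a w B.
Proof. rewrite /psi23 tensAr innerDl.
by apply: f_equal2; rewrite tensZr innerZ3. Qed.

Lemma psi12B c w x y (A B : {malg C[(nat * nat)%type]}) :
  psi12 c w (x%:C *: A - y%:C *: B) = x%:C * psi12 c w A - y%:C * psi12 c w B.
Proof. by rewrite -scaleNr -rmorphN psi12D rmorphN mulNr. Qed.

Lemma psi23B a w x y (A B : {malg C[(nat * nat)%type]}) :
  psi23 a w (x%:C *: A - y%:C *: B) = x%:C * psi23 a w A - y%:C * psi23 a w B.
Proof. by rewrite -scaleNr -rmorphN psi23D rmorphN mulNr. Qed.

Lemma psi12e c w a b : psi12 c w (tens << a >> << b >>) = cf w a b c.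
Proof. by rewrite /psi12 assocE cf_e3. Qed.

Lemma psi23e a w b c : psi23 a w (tens << b >> << c >>) = cf w a b c.
Proof. exact: cf_e3. Qed.

Lemma cf_Q12 w a b c :
  cf (Q12 w) a b c = psi12 c w (casC io q (coprod X1 X2) (tens << a >> << b >>)).
Proof.
have A := Q12_adj io_conj hq H1 H2 (L := nat).
have iL := @linear_id C {malg C[nat]}.
by rewrite -cf_e3 -A /Q12C unassocE (tensopE _ _ (casC_linear H12) iL).
Qed.

Lemma cf_Q23 w a b c :
  cf (Q23 w) a b c = psi23 a w (casC io q (coprod X2 X3) (tens << b >> << c >>)).
Proof.
have A := Q23_adj io_conj hq H2 H3 (I := nat).
have iL := @linear_id C {malg C[nat]}.
by rewrite -cf_e3 -A /Q23C (tensopE _ _ iL (casC_linear H23)).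
Qed.

Lemma parity_inv eps n : eps * eps = 1 -> (parity eps n)^-1 = parity eps n.
Proof. by move=> e; apply: (mulfI (parity_neq0 n e)); rewrite divff ?parity_neq0 // parity_sq. Qed.

(** Expanding A_+ in [cas_left] produces the coordinate itself and one with middle index 1. By
    [VN_rel] this combination is a multiple of the neighbouring coordinate on the line b = 0, whence
    a lower bidiagonal form. *)
Lemma co_Q12 w a : VN w -> (a <= N)%N -> co a (Q12 w) =
  (- (parity eps1 a * parity eps2 0 * pair_eig mu1 mu2 a 0))%:C * co a w
  + (if a is a'.+1 then
       (- (eps1 * eps3 * (-1) ^+ N / edge * (s1 a * s3 (N - a'))))%:C * co a' w
     else 0).
Proof.
move=> wV aN; set c := (N - a)%N.
rewrite /co cf_Q12 (cas_left A1 A2) psi12B psi12e -/c.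
case: a aN @c => [|a] aN c.
  by rewrite ladder0 mul0r mulr0 rmorph0 mul0r add0r addr0 rmorphN mulNr.
rewrite (pairAp A1 A2) psi12D !psi12e.
have cE : (N - a)%N = c.+1 by rewrite /c; lia.
rewrite cE; have := VN_rel a 0 c wV; rewrite /al1 /al2 /al3.
have kL : k1 a * k3 c = edge by apply: kweight_edge; rewrite /c; lia.
have k1n : k1 a != 0 by exact: kweight_neq0.
have k2n : k2 0 != 0 by exact: kweight_neq0.
have k3n : k3 c != 0 by exact: kweight_neq0.
have p3n := parity_neq0 c e3sq.
set Z0 := cf w a.+1 0 c; set Z1 := cf w a 1 c; set Z2 := cf w a 0 c.+1 => rel.
have -> : (s1 a.+1 * (k2 0 * parity eps2 0))%:C * Z0 + ((k1 a)^-1 * s2 1)%:C * Z1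
    = - ((g3 c)^-1 * (k1 a)^-1 * (k2 0)^-1 * s3 c.+1)%:C * Z2.
  have g3C : (g3 c)%:C != 0 by rewrite fmorph_eq0; exact: (mulf_neq0 k3n p3n).
  apply: (mulfI g3C); apply/eqP; rewrite -subr_eq0; apply/eqP.
  have e3' : ((k1 a)^-1 * (k2 0)^-1 * s3 c.+1)%:C
     = (g3 c)%:C * ((g3 c)^-1 * (k1 a)^-1 * (k2 0)^-1 * s3 c.+1)%:C.
    by rewrite -rmorphM /=; congr (_%:C); field; rewrite k1n k2n k3n p3n.
  by rewrite -[RHS]rel e3' !rmorphM; ring.
have e : parity eps1 a.+1 * parity eps2 0 * (s1 a.+1 * (k2 0 * parity eps2 0))
   * ((g3 c)^-1 * (k1 a)^-1 * (k2 0)^-1 * s3 c.+1)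
   = eps1 * eps3 * (-1) ^+ N / edge * (s1 a.+1 * s3 c.+1).
  have sN : (-1) ^+ N = (-1) ^+ a.+1 * (-1) ^+ c :> R.
    by rewrite -exprD; congr (_ ^+ _); rewrite /c; lia.
  rewrite invfM (parity_inv c e3sq) -kL sN.
  transitivity (parity eps1 a.+1 * (parity eps2 0 * parity eps2 0) * parity eps3 c * s1 a.+1 * s3 c.+1
     / (k1 a * k3 c)); first by field; rewrite k1n k2n k3n.
  by rewrite parity_sq // /parity; field; rewrite k1n k3n.
rewrite mulNr mulrN mulrA -rmorphM e !rmorphN; ring.
Qed.

(** The mirror image of [co_Q12]: the relation now trades the two terms for the coordinate a+1. *)
Lemma co_Q23 w a : VN w -> (a <= N)%N -> co a (Q23 w) =
  (- (parity eps2 0 * parity eps3 (N - a) * pair_eig mu2 mu3 0 (N - a)))%:C * co a w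
  + (if (a < N)%N then (edge * (s1 a.+1 * s3 (N - a)))%:C * co a.+1 w else 0).
Proof.
move=> wV aN; set c := (N - a)%N.
rewrite /co cf_Q23 (cas_right A2 A3) psi23B psi23e -/c.
case: ltnP => aN'; last first.
  have -> : c = 0%N by rewrite /c; lia.
  by rewrite ladder0 !mulr0 rmorph0 mul0r add0r addr0 rmorphN mulNr.
have cE : c = (N - a.+1).+1 by rewrite /c; lia.
set c' := (N - a.+1)%N in cE *; rewrite cE -[(c'.+1).-1]/c'.
rewrite (pairAp A2 A3) psi23D !psi23e.
have := VN_rel a 0 c' wV; rewrite /al1 /al2 /al3.
have kL : k1 a * k3 c' = edge by apply: kweight_edge; rewrite /c'; lia.
have k1n : k1 a != 0 by exact: kweight_neq0.
have k2n : k2 0 != 0 by exact: kweight_neq0.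
have k3n : k3 c' != 0 by exact: kweight_neq0.
set Z0 := cf w a.+1 0 c'; set Z1 := cf w a 1 c'; set Z2 := cf w a 0 c'.+1 => rel.
have -> : (s2 1 * g3 c')%:C * Z1 + ((k2 0)^-1 * s3 c'.+1)%:C * Z2
    = - (k1 a * (s1 a.+1 * g2 0 * g3 c'))%:C * Z0.
  have k1C : ((k1 a)^-1)%:C != 0 by rewrite fmorph_eq0 invr_eq0.
  apply: (mulfI k1C); apply/eqP; rewrite -subr_eq0; apply/eqP.
  have e3' : (s1 a.+1 * g2 0 * g3 c')%:C
     = ((k1 a)^-1)%:C * (k1 a * (s1 a.+1 * g2 0 * g3 c'))%:C.
    by rewrite -rmorphM /= mulKf.
  by rewrite -[RHS]rel e3' !rmorphM; ring.
have e : parity eps2 0 * parity eps3 c'.+1 * ((k2 0)^-1 * s3 c'.+1)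
   * (k1 a * (s1 a.+1 * g2 0 * g3 c')) = - (edge * (s1 a.+1 * s3 c'.+1)).
  rewrite -kL; transitivity (- (parity eps2 0 * parity eps2 0) * (parity eps3 c' * parity eps3 c')
     * (k1 a * k3 c' * (s1 a.+1 * s3 c'.+1))).
    have -> : parity eps3 c'.+1 = - parity eps3 c' by rewrite /parity exprS; ring.
    by field.
  by rewrite !parity_sq // mulr1 mulN1r.
rewrite mulNr mulrN mulrA -rmorphM e !rmorphN; ring.
Qed.

End Coords.

(** * The parameters of the Racah problem *)

Section Scalars.
Variables (R : realType) (q : R) (eps1 eps2 eps3 mu1 mu2 mu3 : R) (N : nat).
Hypothesis hq : 0 < q < 1.
Hypothesis hmu1 : 0 < mu1.
Hypothesis hmu2 : 0 < mu2.
Hypothesis hmu3 : 0 < mu3.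
Hypothesis e1sq : eps1 * eps1 = 1.
Hypothesis e2sq : eps2 * eps2 = 1.
Hypothesis e3sq : eps3 * eps3 = 1.

Local Notation p := (- q).
Local Notation muN := (N%:R + mu1 + mu2 + mu3 + 1).
Definition alpha : R := - (-1) ^+ N * q `^ (mu1 + mu2 + mu3 - muN).
Definition beta : R := - (-1) ^+ N * q `^ (mu1 + mu2 - mu3 + muN).
Definition gamma : R := - q `^ (2 * mu2).
Definition delta : R := - q `^ (2 * mu3).
Local Notation a := (gamma * delta * p).
Local Notation a' := (alpha * beta * p).
Local Notation b := (alpha * p).
Local Notation c := (beta * delta * p).
Local Notation d := (gamma * p).
Local Notation t1 := (q `^ mu1).
Local Notation t2 := (q `^ mu2).
Local Notation t3 := (q `^ mu3).
Local Notation h := (q `^ 2^-1).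

Let q0 : q != 0 := q_neq0 hq.
Let q_pos : 0 < q := q_gt0 hq.
Let q_lt1 : q < 1. Proof. by case/andP: hq. Qed.
Let t_pos x : 0 < q `^ x := qpow_gt0 hq x.
Let t0 x : q `^ x != 0 := qpow_neq0 hq x.
Let t_lt1 x : 0 < x -> q `^ x < 1.
Proof. by move=> x0; have := qpow_lt hq x0; rewrite powRr0. Qed.
Let tsq x : q `^ (2 * x) = q `^ x * q `^ x.
Proof. by rewrite -(qpowD hq); congr (q `^ _); ring. Qed.
Let e2 : (-1) ^+ N * (-1) ^+ N = 1 :> R.
Proof. by rewrite -expr2 sqrr_sign. Qed.

Lemma p_neq0 : p != 0. Proof. by rewrite oppr_eq0. Qed.

Lemma p_pow n : p ^+ n = (-1) ^+ n * q ^+ n.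
Proof. exact: exprNn. Qed.

Lemma gammaE : gamma = - (t2 * t2). Proof. by rewrite /gamma tsq. Qed.
Lemma deltaE : delta = - (t3 * t3). Proof. by rewrite /delta tsq. Qed.
Lemma alphaE : alpha = - (-1) ^+ N * (q ^+ N.+1)^-1.
Proof.
rewrite /alpha; congr (_ * _); rewrite -(qpow_nat hq) -powRN; congr (q `^ _).
by rewrite -natr1; ring.
Qed.
Lemma betaE : beta = - (-1) ^+ N * (t1 * t1 * (t2 * t2) * q ^+ N.+1).
Proof.
rewrite /beta; congr (_ * _); rewrite -(qpow_nat hq) -!(qpowD hq); congr (q `^ _).
by rewrite -natr1; ring.
Qed.

Lemma gamma_neq0 : gamma != 0. Proof. by rewrite oppr_eq0. Qed.
Lemma delta_neq0 : delta != 0. Proof. by rewrite oppr_eq0. Qed.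
Lemma sN_neq0 : (-1) ^+ N != 0 :> R.
Proof. by rewrite expf_neq0 // oppr_eq0 oner_eq0. Qed.
Lemma beta_neq0 : beta != 0.
Proof. by rewrite /beta mulf_neq0 ?oppr_eq0 ?sN_neq0. Qed.
Lemma alpha_neq0 : alpha != 0.
Proof. by rewrite /alpha mulf_neq0 ?oppr_eq0 ?sN_neq0. Qed.

Lemma bN : b * p ^+ N = 1.
Proof.
have qn : q ^+ N.+1 != 0 by rewrite expf_neq0.
rewrite -mulrA -exprS p_pow alphaE [(-1) ^+ N.+1]exprS.
transitivity (((-1) ^+ N * (-1) ^+ N) * (q ^+ N.+1 / q ^+ N.+1)); first by ring.
by rewrite e2 divff // mulr1.
Qed.

Lemma aE : a = - (q * (t2 * t2) * (t3 * t3)).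
Proof. by rewrite gammaE deltaE; ring. Qed.
Lemma a'E : a' = - (q * (t1 * t1) * (t2 * t2)).
Proof.
have qn : q ^+ N.+1 != 0 by rewrite expf_neq0.
transitivity (((-1) ^+ N * (-1) ^+ N) * (q ^+ N.+1 / q ^+ N.+1) * - (q * (t1 * t1) * (t2 * t2))).
  by rewrite alphaE betaE; ring.
by rewrite e2 divff // !mul1r.
Qed.
Lemma cE : c = - (-1) ^+ N * (q ^+ N.+2 * (t1 * t1) * (t2 * t2) * (t3 * t3)).
Proof. by rewrite betaE deltaE !exprS; ring. Qed.
Lemma dE : d = q * (t2 * t2).
Proof. by rewrite gammaE; ring. Qed.

Lemma small_neq1 j (z : R) : `|z| < 1 -> p ^+ j * z != 1.
Proof.
move=> z1; apply/eqP => /(congr1 (fun x => `|x|)); rewrite normrM normrX normrN.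
rewrite (gtr0_norm q_pos) normr1; apply/eqP; rewrite lt_eqF //.
apply: le_lt_trans z1; rewrite ler_piMl // exprn_ile1 // ltW //.
Qed.

(** For j < N the factor p^j shrinks z by no more than q^N, so the product keeps modulus above 1.
    This is why [acX] and [a'cX] are restricted to j < N. *)
Lemma large_neq1 j (z : R) : (j < N)%N -> 1 < `|z| * q ^+ N -> p ^+ j * z != 1.
Proof.
move=> jN z1; apply/eqP => /(congr1 (fun x => `|x|)); rewrite normrM normrX normrN.
rewrite (gtr0_norm q_pos) normr1; apply/eqP; rewrite gt_eqF //.
apply: lt_le_trans z1 _; rewrite mulrC ler_wpM2r //.
by apply: ler_wiXn2l; rewrite ?(ltW q_pos) ?(ltW q_lt1) //; exact: ltnW.
Qed.

Let sq_lt1 (x : R) : 0 < x -> q `^ x * q `^ x < 1.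
Proof. by move=> x0; rewrite mulr_ilt1 // ?ltW // t_lt1. Qed.

Let prod_lt1 (x y : R) : 0 <= x -> 0 <= y -> x < 1 -> y < 1 -> x * y < 1.
Proof. by move=> *; rewrite mulr_ilt1. Qed.

Let tt_ge0 (x : R) : 0 <= q `^ x * q `^ x. Proof. by rewrite mulr_ge0 // ltW. Qed.

Let qn_ge0 n : 0 <= q ^+ n. Proof. by rewrite exprn_ge0 // ltW. Qed.
Let qn_lt1 n : q ^+ n.+1 < 1. Proof. by rewrite exprn_ilt1 // ltW. Qed.

Ltac in_unit := repeat first
  [ exact: (ltW q_pos) | exact: q_lt1 | exact: tt_ge0 | exact: qn_ge0 | exact: qn_lt1
  | exact: (sq_lt1 hmu1) | exact: (sq_lt1 hmu2) | exact: (sq_lt1 hmu3)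
  | apply: prod_lt1 | apply: mulr_ge0 ].

Lemma pX j : p ^+ j.+1 != 1.
Proof. by rewrite exprSr small_neq1 // normrN gtr0_norm. Qed.
Lemma aX j : p ^+ j * a != 1.
Proof.
apply: small_neq1; rewrite aE normrN ger0_norm.
  by in_unit.
by in_unit.
Qed.
Lemma a'X j : p ^+ j * a' != 1.
Proof.
apply: small_neq1; rewrite a'E normrN ger0_norm.
  by in_unit.
by in_unit.
Qed.
Lemma cX j : p ^+ j * c != 1.
Proof.
apply: small_neq1; rewrite cE normrM normrN normrX normrN normr1 expr1n mul1r ger0_norm.
  by in_unit.
by in_unit.
Qed.
Lemma dX j : p ^+ j * d != 1.
Proof.
apply: small_neq1; rewrite dE ger0_norm.
  by in_unit.
by in_unit.
Qed.
Lemma adX j : (j < N)%N -> p ^+ j * (a * p / d) != 1.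
Proof.
move=> _; have -> : a * p / d = delta * p.
  by field; rewrite gamma_neq0 q0.
apply: small_neq1; rewrite deltaE mulrNN ger0_norm.
  by in_unit.
by in_unit.
Qed.
Lemma a'dX j : (j < N)%N -> p ^+ j * (a' * p / d) != 1.
Proof.
move=> _; have -> : a' * p / d = q * (t1 * t1).
  by rewrite a'E dE; field; rewrite !t0 q0.
apply: small_neq1; rewrite ger0_norm.
  by in_unit.
by in_unit.
Qed.
Lemma acX j : (j < N)%N -> p ^+ j * (a * p / c) != 1.
Proof.
move=> jN; have -> : a * p / c = - (-1) ^+ N * (q ^+ N * (t1 * t1))^-1.
  have sN := sN_neq0; have qn : q ^+ N != 0 by rewrite expf_neq0.
  transitivity (- ((-1) ^+ N)^-1 * (q ^+ N * (t1 * t1))^-1).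
    by rewrite aE cE !exprS; field; rewrite !t0 q0 qn sN.
  by congr (- _ * _); apply: (mulfI sN); rewrite divff // e2.
apply: large_neq1 => //.
rewrite normrM normrN normrX normrN normr1 expr1n mul1r ger0_norm; last first.
  by rewrite invr_ge0; in_unit.
rewrite invfM mulrAC mulVf ?expf_neq0 // mul1r invf_gt1 ?sq_lt1 //.
by rewrite mulr_gt0.
Qed.
Lemma a'cX j : (j < N)%N -> p ^+ j * (a' * p / c) != 1.
Proof.
move=> jN; have -> : a' * p / c = - (-1) ^+ N * (q ^+ N * (t3 * t3))^-1.
  have sN := sN_neq0; have qn : q ^+ N != 0 by rewrite expf_neq0.
  transitivity (- ((-1) ^+ N)^-1 * (q ^+ N * (t3 * t3))^-1).
    by rewrite a'E cE !exprS; field; rewrite !t0 q0 qn sN.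
  by congr (- _ * _); apply: (mulfI sN); rewrite divff // e2.
apply: large_neq1 => //.
rewrite normrM normrN normrX normrN normr1 expr1n mul1r ger0_norm; last first.
  by rewrite invr_ge0; in_unit.
rewrite invfM mulrAC mulVf ?expf_neq0 // mul1r invf_gt1 ?sq_lt1 //.
by rewrite mulr_gt0.
Qed.

(** The constant relating the eigenvalues of Q^(12) to a grid; [Y0] does the same for Q^(23) (see
    [tau12E], [tau23E]). *)
Definition X0 : R := eps1 * eps2 / (t1 * t2 * h) / (q - q^-1).
Definition Y0 : R := eps2 * eps3 / (t2 * t3 * h) / (q - q^-1).

Let eps_neq0 e : e * e = 1 :> R -> e != 0.
Proof. by move=> E; apply: contra_eq_neq E => ->; rewrite mul0r eq_sym oner_neq0. Qed.

Lemma X0_neq0 : X0 != 0.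
Proof.
rewrite /X0; apply: mulf_neq0; last by rewrite invr_eq0 qV_neq.
apply: mulf_neq0; first by rewrite mulf_neq0 ?eps_neq0.
by rewrite invr_eq0 !mulf_neq0.
Qed.
Lemma Y0_neq0 : Y0 != 0.
Proof.
rewrite /Y0; apply: mulf_neq0; last by rewrite invr_eq0 qV_neq.
apply: mulf_neq0; first by rewrite mulf_neq0 ?eps_neq0.
by rewrite invr_eq0 !mulf_neq0.
Qed.

Definition tau12 (n : nat) : R :=
  - (-1) ^+ n * eps1 * eps2 * qnum q (n%:R + mu1 + mu2 + 2^-1).
Definition tau23 (s : nat) : R :=
  - (-1) ^+ s * eps2 * eps3 * qnum q (s%:R + mu2 + mu3 + 2^-1).

Let sgn_inv n : ((-1) ^+ n)^-1 = (-1) ^+ n :> R.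
Proof. by rewrite -signr_odd; case: odd; rewrite ?expr0 ?invr1 ?expr1 ?invrN1. Qed.

(** The sign (-1)^n is absorbed by p^n and p^-n, and the two exponentials in [n+x+y+1/2] become the
    two terms of the grid. *)
Lemma grid_qnum (x y : R) n : - (-1) ^+ n * qnum q (n%:R + x + y + 2^-1) =
  (q `^ x * q `^ y * h)^-1 / (q - q^-1) *
    grid p (- (q * (q `^ x * q `^ x) * (q `^ y * q `^ y))) n.
Proof.
rewrite /qnum /grid powRN !(qpowD hq) (qpow_nat hq) p_pow.
rewrite [in RHS](invfM ((-1) ^+ n)) sgn_inv.
have := hh hq; set z := h => zz; have z0 : z != 0 by exact: t0.
have qn : q ^+ n != 0 by rewrite expf_neq0.
have := qV_neq hq; set r := q - q^-1 => r0.
move: (t0 x) (t0 y) qn; set X := q `^ x; set Y := q `^ y; set Q := q ^+ n => X0 Y0 qn.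
by rewrite -zz; field; rewrite r0 z0 qn X0 Y0.
Qed.

Lemma tau12E n : tau12 n = X0 * grid p a' n.
Proof.
rewrite a'E /tau12 /X0; transitivity (eps1 * eps2 * (- (-1) ^+ n * qnum q (n%:R + mu1 + mu2 + 2^-1))).
  by ring.
by rewrite grid_qnum; ring.
Qed.

Lemma tau23E n : tau23 n = Y0 * grid p a n.
Proof.
rewrite aE /tau23 /Y0; transitivity (eps2 * eps3 * (- (-1) ^+ n * qnum q (n%:R + mu2 + mu3 + 2^-1))).
  by ring.
by rewrite grid_qnum; ring.
Qed.

(** For fixed parity of n the difference [n+mu] -+ [mu] factors; written in p the two factorisations
    coincide. *)
Lemma sigma_prod mu n : sigma q mu n =
  (-1) ^+ n / p ^+ n / q `^ mu * (p ^+ n - 1) * (1 + q `^ mu * q `^ mu * p ^+ n) / (q - q^-1).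
Proof.
rewrite /sigma /qnum !powRN !(qpowD hq) (qpow_nat hq) p_pow.
have qn : q ^+ n != 0 by rewrite expf_neq0.
have := qV_neq hq; set r := q - q^-1 => r0; have tm := t0 mu.
rewrite -signr_odd; case: (odd n); rewrite ?expr0 ?expr1.
  by field; rewrite r0 qn tm.
by field; rewrite r0 qn tm.
Qed.

(** The product of the two opposite off-diagonal entries does not depend on how the coordinates are
    scaled, so this is the one comparison needed between [hop] and the matrix entries. *)
Lemma hop_sigma i j : (i + j)%N = N.+1 ->
  X0 * Y0 * hop p d N a a' i = - (eps1 * eps3 * (-1) ^+ N * (sigma q mu1 i * sigma q mu3 j)).
Proof.
move=> ij; have jE : (N.+1 - i)%N = j by rewrite -ij addKn.
rewrite /hop jE !sigma_prod.
have pij : p ^+ N = p ^+ i * p ^+ j / p.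
  by rewrite -exprD ij exprSr mulfK // p_neq0.
have sij : (-1) ^+ N = - ((-1) ^+ i * (-1) ^+ j) :> R.
  by rewrite -exprD ij exprS mulN1r opprK.
rewrite pij sij.
have -> : a' / d = - (t1 * t1) by rewrite a'E dE; field; rewrite !t0 q0.
have -> : a / d = - (t3 * t3) by rewrite aE dE; field; rewrite !t0 q0.
have -> : d / p = - (t2 * t2) by rewrite dE; field; rewrite q0.
have si : (-1) ^+ i * (-1) ^+ i = 1 :> R by rewrite -expr2 sqrr_sign.
have sj : (-1) ^+ j * (-1) ^+ j = 1 :> R by rewrite -expr2 sqrr_sign.
have pi := expf_neq0 i p_neq0; have pj := expf_neq0 j p_neq0.
have r0 := qV_neq hq.
transitivity ((eps2 * eps2) * eps1 * eps3 / (t1 * t3) * ((p ^+ i)^-1 / p ^+ j)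
   * (1 - p ^+ i) * (1 - p ^+ j) * (1 + t1 * t1 * p ^+ i) * (1 + t3 * t3 * p ^+ j)
   / (q - q^-1) / (q - q^-1)).
  rewrite /X0 /Y0; have := hh hq; set z := h => zz; have z0 : z != 0 by exact: t0.
  move: pi pj r0; set r := q - q^-1; set P := p ^+ i; set S := p ^+ j => pi pj r0.
  rewrite -[q in _ / (- q)]zz; field.
  by rewrite r0 z0 pi pj !t0.
transitivity (eps1 * eps3 * (((-1) ^+ i * (-1) ^+ i) * ((-1) ^+ j * (-1) ^+ j)) / (t1 * t3) * ((p ^+ i)^-1 / p ^+ j)
   * (1 - p ^+ i) * (1 - p ^+ j) * (1 + t1 * t1 * p ^+ i) * (1 + t3 * t3 * p ^+ j)
   / (q - q^-1) / (q - q^-1)); first by rewrite si sj e2sq !mulr1 mul1r.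
move: pi pj r0; set r := q - q^-1; set P := p ^+ i; set S := p ^+ j => pi pj r0.
by field; rewrite r0 pi pj !t0.
Qed.
End Scalars.

Local Opaque alpha beta gamma delta X0 Y0.

(** * The split basis inside the lowest-weight space and the overlaps *)

Section SplitBasis.
Variables (R : realType) (C : numClosedFieldType) (io : {rmorphism R -> C}).
Hypothesis io_conj : forall x, (io x)^* = io x.
Hypothesis io_ge0 : forall x, (0 <= io x) = (0 <= x).
Variable q : R.
Hypothesis hq : 0 < q < 1.
Local Notation "x %:C" := (io x) (format "x %:C").
Variables (eps1 eps2 eps3 mu1 mu2 mu3 : R) (N : nat).
Hypothesis hmu1 : 0 < mu1.
Hypothesis hmu2 : 0 < mu2.
Hypothesis hmu3 : 0 < mu3.
Hypothesis e1sq : eps1 * eps1 = 1.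
Hypothesis e2sq : eps2 * eps2 = 1.
Hypothesis e3sq : eps3 * eps3 = 1.
Variables X1 X2 X3 : osp_ops C nat.
Hypothesis A1 : irr_action io q eps1 mu1 X1.
Hypothesis A2 : irr_action io q eps2 mu2 X2.
Hypothesis A3 : irr_action io q eps3 mu3 X3.
Local Notation X123 := (coprod X1 (coprod X2 X3)).
Local Notation Q12 := (@Q12C R C io q nat nat nat X1 X2).
Local Notation Q23 := (@Q23C R C io q nat nat nat X2 X3).
Local Notation muN := (N%:R + mu1 + mu2 + mu3 + 1).
Local Notation epsN := ((-1) ^+ N * eps1 * eps2 * eps3).
Local Notation VN := (VN io q (opAm X123) (opK X123) muN).
Local Notation s1 := (ladder q mu1).
Local Notation s3 := (ladder q mu3).
Local Notation L := (edge q mu1 mu3 N).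
Local Notation p := (- q).
Local Notation al := (alpha q mu1 mu2 mu3 N).
Local Notation be := (beta q mu1 mu2 mu3 N).
Local Notation ga := (gamma q mu2).
Local Notation de := (delta q mu3).
Local Notation a := (ga * de * p).
Local Notation a' := (al * be * p).
Local Notation b := (al * p).
Local Notation c := (be * de * p).
Local Notation d := (ga * p).
Local Notation X0 := (X0 q eps1 eps2 mu1 mu2).
Local Notation Y0 := (Y0 q eps2 eps3 mu2 mu3).
Local Notation splitk := (splitc p b c d N a).
Local Notation co := (co N).

Let p0 : p != 0 := p_neq0 hq.
Let bN' : b * p ^+ N = 1 := bN mu1 mu2 mu3 N hq.
Let al0 : al != 0 := alpha_neq0 mu1 mu2 mu3 N hq.
Let be0 : be != 0 := beta_neq0 mu1 mu2 mu3 N hq.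
Let ga0 : ga != 0 := gamma_neq0 mu2 hq.
Let de0 : de != 0 := delta_neq0 mu3 hq.
Let b0 : b != 0 := mulf_neq0 al0 p0.
Let c0 : c != 0 := mulf_neq0 (mulf_neq0 be0 de0) p0.
Let d0 : d != 0 := mulf_neq0 ga0 p0.
Let a0 : a != 0 := mulf_neq0 (mulf_neq0 ga0 de0) p0.
Let a'0 : a' != 0 := mulf_neq0 (mulf_neq0 al0 be0) p0.

(* Rescales the coordinates so that splitc_raise and splitc_lower apply. *)
Definition gauge i : R := \prod_(j < i) (Y0 / (L * (s1 j.+1 * s3 (N - j)))).
Definition splitvec k := extend io q eps2 eps3 mu1 mu2 mu3 N (fun i => gauge i * splitk k i).

Let sL_neq0 j : (j < N)%N -> L * (s1 j.+1 * s3 (N - j)) != 0.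
Proof.
move=> jN; rewrite mulf_neq0 ?edge_neq0 // mulf_neq0 //; first exact: ladder_neq0.
by rewrite -(subnSK jN); exact: ladder_neq0.
Qed.

Lemma gaugeS i : (i < N)%N -> L * (s1 i.+1 * s3 (N - i)) * gauge i.+1 = Y0 * gauge i.
Proof.
move=> iN; rewrite /gauge big_ord_recr /= mulrCA.
by rewrite [L * _ * (Y0 / _)]mulrC divfK ?sL_neq0 // mulrC.
Qed.

Lemma gauge_neq0 i : (i <= N)%N -> gauge i != 0.
Proof.
move=> iN; apply/prodf_neq0 => j _.
rewrite mulf_neq0 ?Y0_neq0 // invr_eq0 sL_neq0 //.
exact: leq_trans (ltn_ord j) iN.
Qed.

Lemma splitvec_VN k : VN (splitvec k).
Proof. exact: (extend_VN io_conj hq N hmu1 hmu2 hmu3 e3sq A1 A2 A3). Qed.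

Lemma co_splitvec k i : (i <= N)%N -> co i (splitvec k) = (gauge i * splitk k i)%:C.
Proof. exact: (co_extend io q eps2 eps3 hmu1 hmu2 hmu3). Qed.

Lemma co_ext u v : VN u -> VN v -> (forall i, (i <= N)%N -> co i u = co i v) -> u = v.
Proof.
move=> uV vV uv; apply/eqP; rewrite -subr_eq0 -scaleN1r addrC; apply/eqP.
have H := osp_star_rep (coprod_rep hq (irr_rep A1) (coprod_rep hq (irr_rep A2) (irr_rep A3))).
apply: (co_inj io_conj hq hmu2 e3sq A1 A2 A3); first exact: (VN_lin H (-1) vV uV).
by move=> i iN; rewrite (funD (co_functional C N i)) (funZ (co_functional C N i)) uv // mulN1r addNr.
Qed.

Lemma splitvec_last : splitvec N.+1 = 0.
Proof.
apply: (co_inj io_conj hq hmu2 e3sq A1 A2 A3); first exact: splitvec_VN.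
by move=> i iN; rewrite co_splitvec // splitc_eq0 // mulr0 rmorph0.
Qed.

Lemma co_splitvec0 i k : (i < k)%N -> (k <= N)%N -> co i (splitvec k) = 0.
Proof.
move=> ik kN; rewrite co_splitvec ?splitc_eq0 ?mulr0 ?rmorph0 //.
exact: ltnW (leq_trans ik kN).
Qed.

Lemma co_splitvec_diag k : (k <= N)%N -> co k (splitvec k) != 0.
Proof.
move=> kN; rewrite co_splitvec // fmorph_eq0 mulf_neq0 ?gauge_neq0 //.
rewrite /splitc subnn /supc big_ord0 mulr1; apply: mulf_neq0.
  apply: mulf_neq0; apply/prodf_neq0 => l _.
    apply: mulf_neq0; last by rewrite invr_eq0 expf_neq0.
    apply: mulf_neq0; rewrite subr_eq0 eq_sym [_ * p ^+ l]mulrC.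
      exact: (cX N hq hmu1 hmu2 hmu3).
    exact: (dX hq hmu2).
  rewrite subr_eq0; apply/eqP => e; have := pX hq (k - l.+1).
  rewrite -subSn // subSS; case/eqP.
  apply: (mulIf (expf_neq0 l p0)); rewrite mul1r -exprD subnK; last exact: ltnW.
  by rewrite -[LHS]mul1r -e mulfVK // expf_neq0.
apply: (@qpoch_neq0 R p b k) => j jk; exact: (bX (pX hq) bN' (leq_trans jk kN)).
Qed.

Let H23 := coprod_rep hq (irr_rep A2) (irr_rep A3).
Let H123 := coprod_rep hq (irr_rep A1) H23.
Lemma tau12_diag i : - (parity eps1 i * parity eps2 0 * pair_eig q mu1 mu2 i 0) = X0 * grid p a' i.
Proof.
rewrite -tau12E // /tau12 /parity /pair_eig expr0 mulr1 mulr0n add0r.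
by ring.
Qed.

Lemma tau23_diag i : - (parity eps2 0 * parity eps3 i * pair_eig q mu2 mu3 0 i) = Y0 * grid p a i.
Proof.
rewrite -tau23E // /tau23 /parity /pair_eig expr0 mulr1 mulr0n add0r.
by rewrite [mu2 + _]addrCA [i%:R + (_ + _)]addrA; ring.
Qed.

(** The gauge is fixed by making every superdiagonal entry of Q^(23) equal to [Y0]; the subdiagonal
    of Q^(12) is then forced by [hop_sigma], and the square roots in the ladder coefficients combine
    into [sigma]. *)
Lemma gauge_hop i : (i < N)%N ->
  - (eps1 * eps3 * (-1) ^+ N / L * (s1 i.+1 * s3 (N - i))) * gauge i
  = X0 * hop p d N a a' i.+1 * gauge i.+1.
Proof.
move=> iN; have LL0 : L != 0 by exact: edge_neq0.
apply: (mulfI (sL_neq0 iN)).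
transitivity (X0 * hop p d N a a' i.+1 * (L * (s1 i.+1 * s3 (N - i)) * gauge i.+1)); last by ring.
have ij : (i.+1 + (N - i))%N = N.+1 by rewrite addSn subnKC // ltnW.
rewrite gaugeS //; transitivity (X0 * Y0 * hop p d N a a' i.+1 * gauge i); last by ring.
rewrite (hop_sigma eps1 eps3 mu1 mu2 mu3 hq e2sq ij).
by rewrite -(ladder_sq hq hmu1) -(ladder_sq hq hmu3); field.
Qed.

Lemma Q12_VN w : VN w -> VN (Q12 w).
Proof.
have [_ cAm cK] := Q12_comm hq (irr_rep A1) (irr_rep A2) (irr_rep A3).
exact: (VN_T (@Q12_linear R C io q nat nat nat X1 X2) cAm cK).
Qed.

Lemma Q23_VN w : VN w -> VN (Q23 w).
Proof.
have [_ cAm cK] := Q23_comm hq (irr_rep A1) (irr_rep A2) (irr_rep A3).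
exact: (VN_T (@Q23_linear R C io q nat nat nat X2 X3) cAm cK).
Qed.

Let HX := osp_star_rep H123.
Let coD i := funD (co_functional C N i).
Let coZ i := funZ (co_functional C N i).

Lemma Q12_splitvec k : (k <= N)%N ->
  Q12 (splitvec k) = X0%:C *: ((grid p a' k)%:C *: splitvec k + splitvec k.+1).
Proof.
move=> kN; apply: co_ext => [||i iN].
- exact: (Q12_VN (splitvec_VN k)).
- exact: (VN_Z HX _ (VN_D HX (VN_Z HX _ (splitvec_VN k)) (splitvec_VN k.+1))).
rewrite (co_Q12 io_conj hq hmu1 hmu2 hmu3 e2sq e3sq A1 A2 A3 (splitvec_VN k) iN).
rewrite coZ coD coZ !co_splitvec // tau12_diag.
have := splitc_raise p0 d0 bN' (param_prod p al be ga de) a0 k (i := i) iN.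
case: i iN => [|i] iN e.
  by rewrite addr0 -!rmorphM -!rmorphD -!rmorphM; congr (io _); rewrite addr0 in e; ring: e.
rewrite co_splitvec; last exact: ltnW.
rewrite -!rmorphM -!rmorphD -!rmorphM; congr (io _).
rewrite [in LHS]mulrA [X in _ + X]mulrA gauge_hop //.
transitivity (X0 * gauge i.+1 * (grid p a' k * splitk k i.+1 + splitk k.+1 i.+1)).
  by rewrite -e; ring.
by ring.
Qed.

Lemma Q23_splitvec k : (k <= N)%N ->
  Q23 (splitvec k) = Y0%:C *: ((grid p a k)%:C *: splitvec k +
    (if k is k'.+1 then (phi p b c d k)%:C *: splitvec k' else 0)).
Proof.
move=> kN; apply: co_ext => [||i iN].
- exact: (Q23_VN (splitvec_VN k)).
- apply: (VN_Z HX); apply: (VN_D HX); first exact: (VN_Z HX _ (splitvec_VN k)).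
  by case: k {kN} => [|k]; [exact: (VN0 HX)|exact: (VN_Z HX _ (splitvec_VN k))].
rewrite (co_Q23 io_conj hq hmu1 hmu2 hmu3 e2sq e3sq A1 A2 A3 (splitvec_VN k) iN).
rewrite coZ coD coZ co_splitvec // tau23_diag.
have e := splitc_lower c d p0 bN' a k (i := i) iN.
transitivity (Y0 * gauge i * (grid p a k * splitk k i
    + (if k is k'.+1 then phi p b c d k * splitk k' i else 0)))%:C.
  rewrite -e; case: ltnP => iN'.
    rewrite co_splitvec // -!rmorphM -!rmorphD; congr (io _).
    by rewrite [X in _ + X]mulrA gaugeS //; ring.
  by rewrite !addr0 -!rmorphM; congr (io _); ring.
case: k kN {e} => [|k] kN.
  have -> : co i (0 : {malg C[(nat * (nat * nat))%type]}) = 0 by exact: mcoeff0.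
  by rewrite !addr0 -!rmorphM; congr (io _); ring.
rewrite coZ co_splitvec // -!rmorphM -!rmorphD -!rmorphM; congr (io _); ring.
Qed.

Local Notation E := (opA0 X123).
Local Notation T12 := (tau12 q eps1 eps2 mu1 mu2).
Local Notation T23 := (tau23 q eps2 eps3 mu2 mu3).
Local Notation basis T lam := (@joint_eigenbasis R C io q {malg C[(nat * (nat * nat))%type]}
  (@inner C _) (opAp X123) (opAm X123) (opP X123) (opK X123) (opKV X123) E muN epsN T N lam).

Let muN_gt0 : 0 < muN.
Proof. by have := ler0n R N; move: hmu1 hmu2 hmu3; lra. Qed.
Let eps_sq := epsN_sq N e1sq e2sq e3sq.
Let HE := E_lev io_conj hq N A1 A2 A3.
Let HP := fun k w => @P_lev R C io io_conj q hq eps1 eps2 eps3 mu1 mu2 mu3 N X1 X2 X3 A1 A2 A3 k w.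

Let X00 := X0_neq0 mu1 mu2 hq e1sq e2sq.
Let Y00 := Y0_neq0 mu2 mu3 hq e2sq e3sq.
Let Hip := inner_innerP C (nat * (nat * nat))%type.
Let Q12L := @Q12_linear R C io q nat nat nat X1 X2.
Let Q23L := @Q23_linear R C io q nat nat nat X2 X3.
Let Q12A := Q12_adj io_conj hq (L := nat) (irr_rep A1) (irr_rep A2).
Let Q23A := Q23_adj io_conj hq (I := nat) (irr_rep A2) (irr_rep A3).
Let Q12c := Q12_comm hq (irr_rep A1) (irr_rep A2) (irr_rep A3).
Let Q23c := Q23_comm hq (irr_rep A1) (irr_rep A2) (irr_rep A3).

Let T12E : T12 = fun n => X0 * grid p a' n.
Proof. by apply: funext => n; exact: tau12E. Qed.
Let T23E : T23 = fun n => Y0 * grid p a n.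
Proof. by apply: funext => n; exact: tau23E. Qed.

Theorem basis12_nonempty : exists u, basis Q12 T12 u.
Proof.
rewrite T12E; have [Q12Ap _ _] := Q12c.
exact: (basis12_exists io_conj hq Hip HX muN_gt0 eps_sq HE HP Q12L Q12A Q12Ap
  (co_functional C N) p0 (pX hq) (a'X mu3 N hq hmu1 hmu2) X00 splitvec_VN splitvec_last
  Q12_splitvec co_splitvec0 co_splitvec_diag).
Qed.

Theorem basis23_nonempty : exists v, basis Q23 T23 v.
Proof.
rewrite T23E; have [Q23Ap _ _] := Q23c.
exact: (basis23_exists io_conj hq Hip HX muN_gt0 eps_sq HE HP Q23L Q23A Q23Ap
  (co_functional C N) p0 (pX hq) bN' (cX N hq hmu1 hmu2 hmu3) (dX hq hmu2) (aX hq hmu2 hmu3)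
  Y00 splitvec_VN Q23_splitvec co_splitvec0 co_splitvec_diag).
Qed.

Theorem racah_overlaps u v : basis Q12 T12 u -> basis Q23 T23 v ->
  exists theta ph : 'I_N.+1 -> nat -> C,
  [/\ forall n k, `|theta n k| = 1, forall s k, `|ph s k| = 1
    & forall n s k, inner (theta n k *: u n k) (ph s k *: v s k) =
      ((-1) ^+ n * Num.sqrt (Omega s al be ga de p / hnorm N n al be ga de p)
         * pRacah n s al be ga de p)%:C].
Proof.
rewrite T12E T23E => Hu Hv; have [_ Q12Am _] := Q12c; have [_ Q23Am _] := Q23c.
have [theta [ph [h1 h2 h3]]] := overlap_phases io_conj io_ge0 hq Hip HX muN_gt0 eps_sq HE HP
  Q12L Q23L Q12A Q23A Q12Am Q23Am (co_functional C N) (co_inj io_conj hq hmu2 e3sq A1 A2 A3)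
  p0 (pX hq) b0 c0 d0 bN' (cX N hq hmu1 hmu2 hmu3) (dX hq hmu2) a0 a'0 (aX hq hmu2 hmu3)
  (a'X mu3 N hq hmu1 hmu2) (param_prod p al be ga de) (acX mu2 mu3 hq hmu1)
  (adX mu2 hq hmu3) (a'cX mu1 mu2 hq hmu3) (a'dX mu2 mu3 hq hmu1) X00 Y00 splitvec_VN Q12_splitvec
  Q23_splitvec co_splitvec0 co_splitvec_diag Hu Hv.
exists theta, ph; split => // n s k; rewrite h3.
rewrite (Omega_weight p0 be0 ga0 de0 bN') (hnorm_weight p0 be0 ga0 de0 bN').
rewrite (pRacah_racah _ _ _ _ p0 (leq_ord n) (leq_ord s)).
by rewrite [in RHS]invf_div mulrA.
Qed.
End SplitBasis.

Unset Implicit Arguments.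
Local Transparent tens assoc unassoc alpha beta gamma delta X0 Y0.
Local Open Scope complex_scope.

Theorem mainTheorem3 (R : realType) (q : R)
    (eps1 eps2 eps3 mu1 mu2 mu3 : R) (N : nat)
    (hq : 0 < q < 1)
    (heps1 : eps1 = 1 \/ eps1 = -1)
    (heps2 : eps2 = 1 \/ eps2 = -1)
    (heps3 : eps3 = 1 \/ eps3 = -1)
    (hmu1 : 0 < mu1) (hmu2 : 0 < mu2) (hmu3 : 0 < mu3) :
  let p := - q in
  let muN := N%:R + mu1 + mu2 + mu3 + 1 in
  let alpha := - (-1) ^+ N * q `^ (mu1 + mu2 + mu3 - muN) in
  let beta := - (-1) ^+ N * q `^ (mu1 + mu2 - mu3 + muN) in
  let gamma := - q `^ (2 * mu2) in
  let delta := - q `^ (2 * mu3) in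
  let X1 := irrep q eps1 mu1 in
  let X2 := irrep q eps2 mu2 in
  let X3 := irrep q eps3 mu3 in
  let X123 := coprod X1 (coprod X2 X3) in
  let Q12 := casimir12 q X1 X2 in
  let Q23 := casimir23 q X2 X3 in
  let QQ := casimir q X123 in
  let E := opA0 X123 in
  let epsN := (-1) ^+ N * eps1 * eps2 * eps3 in
  let tauN := - epsN * qnum q muN in
  let tau12 (n : nat) :=
    - (-1) ^+ n * eps1 * eps2 * qnum q (n%:R + mu1 + mu2 + 2^-1) in
  let tau23 (s : nat) :=
    - (-1) ^+ s * eps2 * eps3 * qnum q (s%:R + mu2 + mu3 + 2^-1) in
  let m (k : nat) := muN + 2^-1 + k%:R in
  let basis12 :=
    @orthonormal_joint_eigenvectors R _ N Q12 QQ E tau12 tauN m in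
  let basis23 :=
    @orthonormal_joint_eigenvectors R _ N Q23 QQ E tau23 tauN m in
  [/\ exists u, basis12 u,
      exists v, basis23 v
    & forall u v, basis12 u -> basis23 v ->
      exists theta phi : 'I_N.+1 -> nat -> R[i],
        [/\ forall n k, `|theta n k| = 1,
            forall s k, `|phi s k| = 1
          & forall (n s : 'I_N.+1) (k : nat),
              inner (theta n k *: u n k) (phi s k *: v s k)
              = ((-1) ^+ n
                 * Num.sqrt (Omega s alpha beta gamma delta p
                             / hnorm N n alpha beta gamma delta p)
                 * pRacah n s alpha beta gamma delta p)%:C]].
Proof.
move=> p muN al be ga de X1 X2 X3 X123 Q12 Q23 QQ E epsN tauN tau12 tau23 m basis12 basis23.
(* With this embedding, the abstract operators [casC], [Q12C], [Q23C], [irrepC] and the predicate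
   [joint_eigenbasis] are convertible to those of the statement, so the abstract theorems apply
   directly. *)
pose io : {rmorphism R -> R[i]} := real_complex R.
have io_conj x : Num.conj (io x) = io x by exact: conjc_real.
have io_ge0 x : (0 <= io x) = (0 <= x) by rewrite lecR.
have sq e : e = 1 \/ e = -1 -> e * e = 1 :> R by case=> ->; rewrite ?mulr1 ?mulN1r ?opprK.
have A1 : irr_action io q eps1 mu1 X1 := irrepC_action io_conj hq heps1 hmu1.
have A2 : irr_action io q eps2 mu2 X2 := irrepC_action io_conj hq heps2 hmu2.
have A3 : irr_action io q eps3 mu3 X3 := irrepC_action io_conj hq heps3 hmu3.
have e1 := sq _ heps1; have e2 := sq _ heps2; have e3 := sq _ heps3.
split.
- exact: (basis12_nonempty io_conj hq N hmu1 hmu2 hmu3 e1 e2 e3 A1 A2 A3).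
- exact: (basis23_nonempty io_conj hq N hmu1 hmu2 hmu3 e1 e2 e3 A1 A2 A3).
- exact: (racah_overlaps io_conj io_ge0 hq hmu1 hmu2 hmu3 e1 e2 e3 A1 A2 A3).
Qed.
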